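(* There exist an absolute constant $\alpha_0>0$ and a constant $c_{\alpha_0}>0$ depending only on $\alpha_0$ such that the following holds. Let $n\ge 1$, let $(\xi_i,\mathcal{F}_i)_{i=0,\dots,n}$ be a sequence of martingale differences, let $X_n=\sum_{i=1}^n\xi_i$, and assume that for some $\epsilon\in(0,\frac12]$ and some $\delta\in[0,\frac12]$ conditions (A1) and (A2) hold. Then for all $0\le x\le\alpha_0\min\{(\epsilon|\log\epsilon|)^{-1},\delta^{-1}\}$ there are real numbers $\theta_1,\theta_2,\theta_3,\theta_4$ with $|\theta_j|\le1$ (possibly depending on $(\xi_i,\mathcal{F}_i)_{i=0,\dots,n}$, $n$ and $x$) such that $$\frac{\mathbb{P}(X_n>x)}{1-\Phi(x)}=\exp\{\theta_1c_{\alpha_0}x^3\epsilon\}\Big(1+\theta_2c_{\alpha_0}(1+x)\big(\epsilon|\log\epsilon|+\delta\big)\Big)$$ and $$\frac{\mathbb{P}(X_n<-x)}{\Phi(-x)}=\exp\{\theta_3c_{\alpha_0}x^3\epsilon\}\Big(1+\theta_4c_{\alpha_0}(1+x)\big(\epsilon|\log\epsilon|+\delta\big)\Big).$$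
   Context: $(\xi_i,\mathcal{F}_i)_{i=0,\dots,n}$ is a sequence of square integrable real martingale differences on a probability space $(\Omega,\mathcal{F},\mathbb{P})$: $\xi_0=0$, $\{\emptyset,\Omega\}=\mathcal{F}_0\subseteq\dots\subseteq\mathcal{F}_n\subseteq\mathcal{F}$ are increasing $\sigma$-fields, each $\xi_i$ is $\mathcal{F}_i$-measurable and $\mathbb{E}(\xi_i|\mathcal{F}_{i-1})=0$ for $1\le i\le n$. The quadratic characteristic is $\langle X\rangle_n=\sum_{i=1}^n\mathbb{E}(\xi_i^2|\mathcal{F}_{i-1})$. (In)equalities between random variables hold $\mathbb{P}$-almost surely. $\Phi(x)=\frac{1}{\sqrt{2\pi}}\int_{-\infty}^x e^{-t^2/2}\,dt$ is the standard normal distribution function. When $\delta=0$, $\delta^{-1}$ is read as $+\infty$. Condition (A1), with parameter $\epsilon\in(0,\frac12]$: the moments exist and $|\mathbb{E}(\xi_i^k|\mathcal{F}_{i-1})|\le \frac12 k!\,\epsilon^{k-2}\,\mathbb{E}(\xi_i^2|\mathcal{F}_{i-1})$ for all $k\ge3$ and $1\le i\le n$. Condition (A2), with parameter $\delta\in[0,\frac12]$: $|\langle X\rangle_n-1|\le\delta^2$. *)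

(* Defs.v *)
From HB Require Import structures.
From mathcomp Require Import all_boot all_order all_algebra.
From mathcomp Require Import all_classical all_reals all_analysis measurable_realfun.

Set Implicit Arguments.
Unset Strict Implicit.
Unset Printing Implicit Defensive.

Import Order.TTheory GRing.Theory Num.Theory.
Import numFieldNormedType.Exports.

Local Open Scope classical_set_scope.
Local Open Scope ring_scope.

Section conditional_expectation.
Context (d : measure_display) (T : measurableType d) (R : realType).
Variable P : probability T R.

(* [g_sigma_algebraType G] carries <<s G >>, which is G itself when G is a
   sigma-algebra. *)
Definition measurable_wrt (G : set (set T)) (Y : T -> R) : Prop :=
  measurable_fun [set: g_sigma_algebraType G] (Y : g_sigma_algebraType G -> R).

Definition is_condexp (G : set (set T)) (X Y : T -> R) : Prop :=
  [/\ measurable_wrt G Y,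
      P.-integrable [set: T] (EFin \o Y) &
      forall A, G A ->
        (\int[P]_(w in A) (Y w)%:E = \int[P]_(w in A) (X w)%:E)%E].

(* The value 0 is a default used only when no version exists; by [condexpP]
   this does not happen for integrable X and a sub-sigma-algebra G. *)
Definition condexp (G : set (set T)) (X : T -> R) : T -> R :=
  xget (cst 0) [set Y | is_condexp G X Y].

Lemma condexpP (G : set (set T)) (X : T -> R) :
  sigma_algebra [set: T] G -> G `<=` measurable ->
  P.-integrable [set: T] (EFin \o X) -> is_condexp G X (condexp G X).
Proof.
move=> sG GM iX; rewrite /condexp; case: xgetP => [Y -> //|noY].
suff [Y YP] : exists Y, is_condexp G X Y by case: (noY Y).
have GE : G.-sigma.-measurable = G := measurable_g_measurableTypeE sG.
pose GT := g_sigma_algebraType G.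
pose h : T -> GT := id.
have mh : measurable_fun [set: T] h.
  by move=> _ A mA; rewrite setTI; apply: GM; rewrite -GE.
pose hM : {mfun T >-> GT} := HB.pack h (isMeasurableFun.Build _ _ _ _ h mh).
pose Q : probability GT R := distribution P hM.
have [nu nuE] : exists nu : {charge set GT -> \bar R},
    forall A, nu A = (\int[P]_(w in A) (X w)%:E)%E.
  unshelve eexists (pushforward (induced_charge iX) h : {charge set GT -> \bar R}).
    exact: mh.
  by [].
have dom : nu `<< Q.
  apply/null_content_dominatesP => A mA QA; rewrite nuE.
  have mA' : d.-measurable (A : set T) by apply: GM; rewrite -GE.
  apply: null_set_integral mA' _ QA.
  by apply: measurable_funTS; exact: measurable_int iX.
pose Y : T -> R := fine \o Radon_Nikodym nu Q.
have YE w : (Y w)%:E = (Radon_Nikodym nu Q) w by rewrite fineK// Radon_Nikodym_fin_num.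
have YEf : EFin \o Y = Radon_Nikodym nu Q by apply/funext => w; exact: YE.
have iY := Radon_Nikodym_integrable dom.
have mY := measurable_int _ iY.
have mYT := measurableT_comp mY mh.
have iYT : P.-integrable [set: T] (Radon_Nikodym nu Q).
  apply/integrableP; split=> //; move/integrableP : iY => [_].
  rewrite (ge0_integral_pushforward mh)//.
  by apply: measurableT_comp => //; exact: mY.
exists Y; split.
- by apply: measurableT_comp => //; exact: mY.
- by rewrite YEf.
- move=> A GA; have mA : G.-sigma.-measurable A by rewrite GE.
  rewrite -nuE (Radon_Nikodym_integral dom mA) (integral_pushforward mh)//.
    by apply: eq_integral => w _; rewrite YE.
  by apply: integrableS iYT => //; exact: GM.
Qed.

End conditional_expectation.

Section martingale_differences.
Context (d : measure_display) (T : measurableType d) (R : realType).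
Variables (P : probability T R) (n : nat).
Variables (F : nat -> set (set T)) (xi : nat -> T -> R).

Record martingale_differences : Prop := MartingaleDifferences {
  md_sigma_algebra : forall i, (i <= n)%N -> sigma_algebra [set: T] (F i) ;
  md_F0 : F 0%N = [set set0; setT] ;
  md_increasing : forall i, (i < n)%N -> F i `<=` F i.+1 ;
  md_sub : F n `<=` measurable ;
  md_xi0 : {ae P, forall w, xi 0%N w = 0} ;
  md_adapted : forall i, (i <= n)%N -> measurable_wrt (F i) (xi i) ;
  md_square_integrable : forall i, (i <= n)%N ->
    P.-integrable [set: T] (fun w => (xi i w ^+ 2)%:E) ;
  md_condexp0 : forall i, (1 <= i <= n)%N ->
    {ae P, forall w, condexp P (F i.-1) (xi i) w = 0} }.

Definition quadratic_characteristic : T -> R := fun w =>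
  \sum_(1 <= i < n.+1) condexp P (F i.-1) (fun v => xi i v ^+ 2) w.

Definition condition_A1 (eps : R) : Prop :=
  forall i k, (1 <= i <= n)%N -> (3 <= k)%N ->
    P.-integrable [set: T] (fun w => (xi i w ^+ k)%:E) /\
    {ae P, forall w,
      `| condexp P (F i.-1) (fun v => xi i v ^+ k) w | <=
        2^-1 * k`!%:R * eps ^+ (k - 2) *
        condexp P (F i.-1) (fun v => xi i v ^+ 2) w}.

Definition condition_A2 (delta : R) : Prop :=
  {ae P, forall w, `|quadratic_characteristic w - 1| <= delta ^+ 2}.

Definition partial_sum : T -> R := fun w => \sum_(1 <= i < n.+1) xi i w.

End martingale_differences.

Definition std_normal_cdf (R : realType) (x : R) : R :=
  (Num.sqrt (2 * pi))^-1 *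
  \int[lebesgue_measure]_(t in `]-oo, x]) expR (- (t ^+ 2) / 2).

(* Main.v *)
Require Import Defs.
From HB Require Import structures.
From mathcomp Require Import all_boot all_order all_algebra.
From mathcomp Require Import all_classical all_reals all_analysis measurable_realfun.
From mathcomp Require Import ring lra.

Set Implicit Arguments.
Unset Strict Implicit.
Unset Printing Implicit Defensive.

Import Order.TTheory GRing.Theory Num.Theory.
Import numFieldNormedType.Exports.

Local Open Scope classical_set_scope.
Local Open Scope ring_scope.

(** The proof combines Cramer's change of measure with a Berry-Esseen bound for
    the martingale under the new law.

    The moment condition enters through a single consequence,
    [cge0_cosh_of_moments]: the conditional mean of [cosh (xi_i / (2 eps)) - 1]
    is at most [v_i / (6 eps^2)], where [v_i] is the conditional variance. It is
    symmetric in [xi_i], so that the lower tail is the upper tail of the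
    martingale with increments [- xi_i] ([bernstein_martingaleN]).

    Tilting ([exponential_tilt]). For [lam >= 0] let [Q] have density [prod_i
    expR (lam xi_i) / m_i], where [m_i] is the conditional mean of [expR (lam
    xi_i)]. Under [Q] the steps have conditional means [b_i = lam v_i], up to a
    relative error of order [lam eps], and the recentred steps [xi_i - b_i] have
    nearly the same conditional variances and still satisfy a third moment
    condition. With [lam] slightly larger than [x], the sum of the [b_i] lies
    just above [x] ([drift_bounds]). Moreover [P (X_n > x)] is the [Q]-integral
    of [expR (- lam X_n) prod_i m_i] over [X_n > x], where the product is
    [expR (lam^2 / 2)] up to a factor controlled by [x^3 eps] and [x^2 delta^2].

    Normal approximation ([berry_esseen]). The Kolmogorov distance [K] between
    the recentred sum under [Q] and the normal law is at most a multiple of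
    [eps |ln eps| + delta + lam eps]. Lindeberg's method follows [Phi ((y - Y_k)
    / sqrt A_k)], with [A_k] the remaining variance after a small smoothing.
    Since this function solves the backward heat equation, a step costs only a
    third-order error [eps v_k / r_k^3], where [r_k] is the parabolic distance
    from the current time and position to the singularity. The function [1 / r]
    is a strict subsolution of the same equation, so that the expected sum of
    these errors telescopes and is at most [eps] times the final mean of [1 / r]
    ([inv_norm_drift]). That mean is the expected inverse distance of [Y_n] from
    [y], cut off at the smoothing scale; cut into dyadic scales, it is estimated
    by the normal law and by [K] itself ([Exp_inv_norm_le]), and the number of
    scales is the logarithm in the bound. The result is [K <= K / 2 + c], hence
    [K <= 2 c] ([self_improving_bound]).

    The tail ratio. The mean of [expR (- lam Y)] over a half-line is explicit for
    the normal law ([gauss_laplace]). Replacing the law of the recentred sum by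
    the normal one costs at most [2 K] ([exp_transfer]), and by [mills_lower] the
    main term is of order [1 / (1 + x)]; the relative error is of order [(1 + x)
    K] ([tilted_tail_upper], [tilted_tail_lower]). The part [(1 + x) lam eps] of
    this error is harmless when [x^2 eps] is small. Otherwise [x] is at most a
    multiple of [x^3 eps], and a lower bound that loses a factor exponential in
    [x] is enough ([tilted_tail_window]). *)

(** * Sub-sigma-algebras and conditional inequalities in integrated form *)

Section sub_sigma_algebra.
Context (d : measure_display) (T : measurableType d) (R : realType).
Implicit Type G : set (set T).

Lemma measurable_wrt_sub G (f : T -> R) : G `<=` measurable ->
  measurable_wrt G f -> measurable_fun setT f.
Proof.
move=> GM mf _ B mB; have := mf measurableT B mB; rewrite !setTI.
apply: (@smallest_sub _ (sigma_algebra setT)) => //; exact: sigma_algebra_measurable.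
Qed.

Lemma measurable_wrt_mono G H (f : T -> R) : G `<=` H ->
  measurable_wrt G f -> measurable_wrt H f.
Proof.
move=> GH mf _ B mB; have := mf measurableT B mB; rewrite !setTI.
by apply: sub_sigma_algebra2.
Qed.

Lemma measurable_wrt_preimage G (f : T -> R) (B : set R) :
  sigma_algebra setT G -> measurable_wrt G f -> measurable B -> G (f @^-1` B).
Proof.
move=> sG mf mB; have := mf measurableT B mB; rewrite setTI.
by rewrite (measurable_g_measurableTypeE sG).
Qed.

Lemma measurable_wrt_measurable (f : T -> R) :
  measurable_fun setT f -> measurable_wrt measurable f.
Proof.
by move=> mf _ B mB; rewrite setTI; apply: sub_gen_smallest; have := mf measurableT B mB; rewrite setTI.
Qed.

Lemma measurable_wrt_le (F : nat -> set (set T)) i j (f : T -> R) :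
  (forall k, F k `<=` F k.+1) -> (i <= j)%N ->
  measurable_wrt (F i) f -> measurable_wrt (F j) f.
Proof.
move=> F_le ij mf; elim: j ij => [|j IH]; first by rewrite leqn0 => /eqP <-.
rewrite leq_eqVlt => /predU1P[<-//|]; rewrite ltnS => /IH.
exact: measurable_wrt_mono.
Qed.

Lemma measurable_preimage_itv (f : T -> R) (i : interval R) :
  measurable_fun setT f -> measurable [set w | f w \in i].
Proof. by move=> mf; rewrite -[X in measurable X]setTI; exact: (mf measurableT _ (measurable_itv i)). Qed.

Lemma measurable_le_set (f : T -> R) y : measurable_fun setT f -> measurable [set w | f w <= y].
Proof.
by move=> /(measurable_preimage_itv `]-oo, y]); congr measurable; apply/seteqP; split=> w /=; rewrite in_itv.
Qed.

Lemma measurable_lt_set (f : T -> R) y : measurable_fun setT f -> measurable [set w | f w < y].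
Proof.
by move=> /(measurable_preimage_itv `]-oo, y[); congr measurable; apply/seteqP; split=> w /=; rewrite in_itv.
Qed.

Lemma measurable_ge_set (f : T -> R) y : measurable_fun setT f -> measurable [set w | y <= f w].
Proof.
by move=> /(measurable_preimage_itv `[y, +oo[); congr measurable; apply/seteqP; split=> w /=; rewrite in_itv/= andbT.
Qed.

Lemma measurable_gt_set (f : T -> R) y : measurable_fun setT f -> measurable [set w | y < f w].
Proof.
by move=> /(measurable_preimage_itv `]y, +oo[); congr measurable; apply/seteqP; split=> w /=; rewrite in_itv/= andbT.
Qed.

End sub_sigma_algebra.

Section density_comparison.
Context (d : measure_display) (T : measurableType d) (R : realType).
Variables (mu nu : {measure set T -> \bar R}) (G : set (set T)).
Hypotheses (sG : sigma_algebra setT G) (GM : G `<=` measurable).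

Import HBNNSimple.

(** Immediate for simple functions of [G]; monotone convergence does the rest. *)
Lemma ge0_le_integral_sub (v w f : T -> R) :
  measurable_fun setT v -> measurable_fun setT w ->
  (forall x, 0 <= v x) -> (forall x, 0 <= w x) ->
  (forall A, G A ->
    (\int[mu]_(x in A) (v x)%:E <= \int[nu]_(x in A) (w x)%:E)%E) ->
  measurable_wrt G f -> (forall x, 0 <= f x) ->
  (\int[mu]_x (f x * v x)%:E <= \int[nu]_x (f x * w x)%:E)%E.
Proof.
move=> mv mw v0 w0 vw mf f0.
pose S := g_sigma_algebraType G.
have mf' : measurable_fun [set: S] (EFin \o f : S -> \bar R).
  exact/measurable_EFinP.
pose h := nnsfun_approx (@measurableT _ S) mf'.
have GE : G.-sigma.-measurable = G := measurable_g_measurableTypeE sG.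
have gE A : G.-sigma.-measurable A -> G A by rewrite GE.
have hG n (y : R) : G (h n @^-1` [set y]).
  by apply: gE; exact: measurable_funPTI.
have hm n : measurable_fun [set: T] (h n : T -> R).
  apply: (measurable_wrt_sub GM); rewrite /measurable_wrt; exact: measurable_funPT.
have lim_h (m : {measure set T -> \bar R}) (u : T -> R) : measurable_fun setT u -> (forall x, 0 <= u x) ->
   (\int[m]_x ((h n x * u x)%:E) @[n --> \oo] --> \int[m]_x (f x * u x)%:E)%E.
  move=> mu_ u0.
  have -> : (\int[m]_x (f x * u x)%:E = \int[m]_x (lim ((h n x * u x)%:E @[n --> \oo])))%E.
    apply: eq_integral => x _; apply/esym/cvg_lim => //.
    rewrite EFinM; under eq_fun do rewrite EFinM; apply: cvgeZr => //.
    by apply: (cvg_nnsfun_approx (@measurableT _ S) mf') => // y _; rewrite lee_fin.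
  apply: cvg_monotone_convergence => //.
  - by move=> n; apply/measurable_EFinP; apply: measurable_funM.
  - by move=> n x _; rewrite lee_fin mulr_ge0.
  - move=> x _ a b ab; rewrite lee_fin ler_wpM2r//.
    by have /lefP := nd_nnsfun_approx (@measurableT _ S) mf' ab; exact.
have int_h (m : {measure set T -> \bar R}) (u : T -> R) n : measurable_fun setT u -> (forall x, 0 <= u x) ->
   (\int[m]_x ((h n x * u x)%:E) = \sum_(y \in range (h n)) (y%:E * \int[m]_(x in h n @^-1` [set y]) (u x)%:E))%E.
  move=> mu_ u0.
  have mh y : measurable (h n @^-1` [set y] : set T) by apply: GM; exact: hG.
  transitivity (\int[m]_x (\sum_(y \in range (h n)) (y * \1_(h n @^-1` [set y]) x * u x)%:E))%E.
    by apply: eq_integral => x _; rewrite [in LHS](fimfunE (h n) x) mulr_fsuml// fsumEFin.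
  rewrite ge0_integral_fsum//; last 2 first.
    by move=> y; apply/measurable_EFinP; apply: measurable_funM => //; apply: measurable_funM => //; exact: measurable_indic.
    move=> y x _; rewrite lee_fin mulr_ge0//; exact: (@nnfun_muleindic_ge0).
  apply: eq_fsbigr => r; rewrite inE => -[t _ rE].
  under eq_integral do rewrite -mulrA EFinM.
  rewrite ge0_integralZl//; first last.
    by rewrite lee_fin -rE.
    by move=> x _; rewrite lee_fin mulr_ge0.
    by apply/measurable_EFinP; apply: measurable_funM => //; exact: measurable_indic.
  congr (_ * _)%E; rewrite [RHS]integral_mkcond; apply: eq_integral => x _.
  by rewrite patchE indicE; case: ifP; rewrite ?mul1r ?mul0r.
apply: (lee_cvg_to (lim_h mu v mv v0) (lim_h nu w mw w0)).
apply: nearW => n; rewrite !int_h//.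
apply: lee_fsum => //; move=> r [t _ rE].
by apply: lee_wpmul2l; [rewrite lee_fin -rE|exact: vw].
Qed.
End density_comparison.

(** [ge0_le_integral_sub] in both directions, with all measurable sets in the
    role of [G]. *)
Lemma ge0_integral_density (d : measure_display) (T : measurableType d)
    (R : realType) (mu nu : {measure set T -> \bar R}) (w f : T -> R) :
  measurable_fun setT w -> (forall x, 0 <= w x) ->
  (forall A, measurable A -> nu A = \int[mu]_(x in A) (w x)%:E)%E ->
  measurable_fun setT f -> (forall x, 0 <= f x) ->
  (\int[nu]_x (f x)%:E = \int[mu]_x (f x * w x)%:E)%E.
Proof.
move=> mw w0 nuw mf f0.
have sM : sigma_algebra setT (@measurable d T) by exact: sigma_algebra_measurable.
have mf' := measurable_wrt_measurable mf.
have m1 : measurable_fun setT (cst (1 : R) : T -> R) by [].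
have nu1 A : measurable A -> (\int[nu]_(x in A) (cst (1 : R) x)%:E = nu A)%E.
  by move=> mA; rewrite (@integral_cst _ _ _ nu _ mA 1%E) mul1e.
have <- : (\int[nu]_x (f x * cst 1 x)%:E = \int[nu]_x (f x)%:E)%E.
  by apply: eq_integral => x _; rewrite mulr1.
apply/eqP; rewrite eq_le; apply/andP; split.
- by apply: (ge0_le_integral_sub sM) => //= A mA; rewrite nu1// nuw.
- by apply: (ge0_le_integral_sub sM) => //= A mA; rewrite nu1// nuw.
Qed.

Section conditionally_nonnegative.
Context (d : measure_display) (T : measurableType d) (R : realType).
Variables (P : {finite_measure set T -> \bar R}).
Implicit Types (G : set (set T)) (f g h : T -> R).

Notation integ h := (P.-integrable setT (EFin \o h)).

Lemma integ_measurable h : integ h -> measurable_fun setT h.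
Proof. by move=> /measurable_int/measurable_EFinP. Qed.

Lemma integD f g : integ f -> integ g -> integ (fun w => f w + g w).
Proof.
move=> i1 i2; rewrite (_ : _ \o _ = (EFin \o f) \+ (EFin \o g))%E; last by [].
exact: integrableD.
Qed.

Lemma integN f : integ f -> integ (fun w => - f w).
Proof.
move=> i1; rewrite (_ : _ \o _ = -%E \o (EFin \o f))%E; last by [].
exact: integrableN.
Qed.

Lemma integB f g : integ f -> integ g -> integ (fun w => f w - g w).
Proof. by move=> i1 i2; apply: integD => //; exact: integN. Qed.

Lemma integ_le f g : measurable_fun setT f -> integ g ->
  (forall w, `|f w| <= g w) -> integ f.
Proof.
move=> mf ig fg; apply: (le_integrable measurableT) ig; first exact/measurable_EFinP.
by move=> w _ /=; rewrite lee_fin (le_trans (fg w))// ler_norm.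
Qed.

Lemma integZ (c : R) f : integ f -> integ (fun w => c * f w).
Proof.
move=> i1; rewrite (_ : _ \o _ = fun w => c%:E * (f w)%:E)%E; last by [].
exact: (integrableZl measurableT c i1).
Qed.

Lemma integ_cst (c : R) : integ (fun _ => c).
Proof. exact: finite_measure_integrable_cst. Qed.

Lemma integ_bounded f (M : R) : measurable_fun setT f -> (forall w, `|f w| <= M) -> integ f.
Proof. by move=> mf fM; apply: (integ_le mf (integ_cst M)). Qed.

Lemma integ_mul_bounded f h (M : R) : measurable_fun setT f ->
  (forall w, `|f w| <= M) -> integ h -> integ (fun w => f w * h w).
Proof.
move=> mf fM ih; have M0 : 0 <= M by rewrite (le_trans _ (fM point)).
apply: (@integ_le _ (fun w => M * `|h w|)).
- by apply: measurable_funM => //; exact: integ_measurable.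
- by apply: integZ; exact: integrable_norm ih.
- by move=> w; rewrite normrM ler_wpM2r.
Qed.

(** The conditional expectation of [h] given [G] is nonnegative, said without
    a version of it. Inequalities between conditional expectations are used
    below after integration against nonnegative [G]-measurable weights, and
    this form is enough for that. *)
Definition cge0 G h := integ h /\
  forall A, G A -> (0 <= \int[P]_(w in A) (h w)%:E)%E.

Section fixed_sigma_algebra.
Variable G : set (set T).
Hypotheses (sG : sigma_algebra setT G) (GM : G `<=` measurable).

Let GT : G setT.
Proof. by case: sG => G0 GC _; rewrite -(setD0 setT); exact: GC. Qed.

Lemma cge0_ge0 h : integ h -> (forall w, 0 <= h w) -> cge0 G h.
Proof. by move=> ih h0; split=> // A _; apply: integral_ge0 => w _; rewrite lee_fin. Qed.

Lemma cge0D f g : cge0 G f -> cge0 G g -> cge0 G (fun w => f w + g w).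
Proof.
move=> [iF f0] [ig g0]; split; first exact: integD.
move=> A GA; rewrite integralD_EFin//; [|by apply: GM|by apply: integrableS iF => //; exact: GM|by apply: integrableS ig => //; exact: GM].
by rewrite adde_ge0 ?f0 ?g0.
Qed.

Lemma cge0_le f g : cge0 G f -> integ g -> (forall w, f w <= g w) -> cge0 G g.
Proof.
move=> [iF f0] ig fg; split=> // A GA; apply: (le_trans (f0 A GA)).
by apply: le_integral => [|||w _]; rewrite ?lee_fin//; [by apply: GM|by apply: integrableS iF => //; exact: GM|by apply: integrableS ig => //; exact: GM].
Qed.

Lemma cge0_ae_eq f g : cge0 G f -> integ g -> {ae P, forall w, f w = g w} -> cge0 G g.
Proof.
move=> [iF f0] ig fg; split=> // A GA; have mA := GM GA.
rewrite (@ae_eq_integral _ _ _ P A (EFin \o f) (EFin \o g)) ?f0//.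
- by apply: measurable_funTS; exact: measurable_int ig.
- by apply: measurable_funTS; exact: measurable_int iF.
- by apply: filterS fg => w /= fgw _; rewrite fgw.
Qed.

Lemma cge0B f g : integ f -> integ g ->
  (cge0 G (fun w => g w - f w) <->
   forall A, G A -> (\int[P]_(w in A) (f w)%:E <= \int[P]_(w in A) (g w)%:E)%E).
Proof.
move=> iF ig.
have E A : G A -> (0 <= \int[P]_(w in A) (g w - f w)%:E)%E =
    (\int[P]_(w in A) (f w)%:E <= \int[P]_(w in A) (g w)%:E)%E.
  move=> GA; have mA := GM GA.
  have iA u : integ u -> P.-integrable A (EFin \o u) by move=> iu; exact: integrableS iu.
  under eq_integral do rewrite EFinB.
  rewrite integralB_EFin ?sube_ge0//; [|exact: iA..].
  by apply/orP; left; apply: integrable_fin_num => //; exact: iA.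
split=> [[_ h] A GA|h]; first by rewrite -E//; exact: h.
by split=> [|A GA]; [exact: integB|rewrite E//; exact: h].
Qed.

Lemma cge0_posneg h : integ h ->
  (cge0 G h <-> forall A, G A ->
    (\int[P]_(w in A) (Num.max (- h w) 0)%:E <= \int[P]_(w in A) (Num.max (h w) 0)%:E)%E).
Proof.
move=> ih; have mh := integ_measurable ih.
have ip : integ (fun w => Num.max (h w) 0).
  apply: (integ_le _ (integrable_norm ih)) => [|w /=]; first exact: measurable_maxr.
  by rewrite ger0_norm ?le_max ?lexx ?orbT// ge_max ler_norm/=.
have im : integ (fun w => Num.max (- h w) 0).
  apply: (integ_le _ (integrable_norm ih)) => [|w /=].
    by apply: measurable_maxr => //; exact: measurableT_comp.
  by rewrite ger0_norm ?le_max ?lexx ?orbT// ge_max ler_normr lexx orbT/=.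
rewrite -cge0B//; suff -> : (fun w => Num.max (h w) 0 - Num.max (- h w) 0) = h by [].
by apply/funext => w; case: (leP (h w) 0) => h1; case: (leP (- h w) 0) => h2; lra.
Qed.

(** The comparison of the two parts of [h] on the sets of [G] extends to
    [G]-measurable weights by [ge0_le_integral_sub]. *)
Lemma cge0_integral_mul f h : cge0 G h -> measurable_wrt G f ->
  (forall w, 0 <= f w) -> integ (fun w => f w * h w) ->
  (0 <= \int[P]_w (f w * h w)%:E)%E.
Proof.
move=> ch mf f0 ifh; have [ih _] := ch; have mh := integ_measurable ih.
pose p w := Num.max (h w) 0; pose m w := Num.max (- h w) 0.
have hpm w : h w = p w - m w.
  by rewrite /p /m; case: (leP (h w) 0) => h1; case: (leP (- h w) 0) => h2; lra.
have p0 w : 0 <= p w by rewrite le_max lexx orbT.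
have m0 w : 0 <= m w by rewrite le_max lexx orbT.
have mp : measurable_fun setT p by exact: measurable_maxr.
have mm : measurable_fun setT m.
  by apply: measurable_maxr => //; exact: measurableT_comp.
have mfT := measurable_wrt_sub GM mf.
have ph w : p w <= `|h w| by rewrite ge_max ler_norm/=.
have mh' w : m w <= `|h w| by rewrite ge_max ler_normr lexx orbT/=.
have ifp : integ (fun w => f w * p w).
  apply: (integ_le _ (integrable_norm ifh)); first exact: measurable_funM.
  by move=> w /=; rewrite !normrM ler_wpM2l// (ger0_norm (p0 w)).
have ifm : integ (fun w => f w * m w).
  apply: (integ_le _ (integrable_norm ifh)); first exact: measurable_funM.
  by move=> w /=; rewrite !normrM ler_wpM2l// (ger0_norm (m0 w)).
have -> : (\int[P]_w (f w * h w)%:E = \int[P]_w (f w * p w)%:E - \int[P]_w (f w * m w)%:E)%E.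
  rewrite -integralB_EFin//; apply: eq_integral => w _.
  by rewrite hpm mulrBr EFinB.
rewrite sube_ge0; last by apply/orP; left; exact: integrable_fin_num.
by apply: (@ge0_le_integral_sub _ _ _ P P G) => //; exact/(cge0_posneg ih).
Qed.

Lemma measurable_wrt_indic A : G A -> measurable_wrt G (\1_A : T -> R).
Proof.
move=> GA; apply: (@measurable_indic _ (g_sigma_algebraType G)).
exact: sub_gen_smallest.
Qed.

Lemma cge0_mul f h : cge0 G h -> measurable_wrt G f ->
  (forall w, 0 <= f w) -> integ (fun w => f w * h w) -> cge0 G (fun w => f w * h w).
Proof.
move=> ch mf f0 ifh; split=> // A GA; have mA := GM GA.
rewrite integral_mkcond.
have -> : (EFin \o (fun w => f w * h w)) \_ A = EFin \o (fun w => (\1_A w * f w) * h w).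
  apply/funext => w; rewrite patchE /= indicE; case: ifP; rewrite ?mul1r ?mul0r//.
apply: cge0_integral_mul => //.
- exact: (@measurable_funM _ (g_sigma_algebraType G) _ _ _ _ (measurable_wrt_indic GA) mf).
- by move=> w; rewrite mulr_ge0.
- rewrite (_ : (fun w => _) = (fun w => \1_A w * (f w * h w))); last by apply/funext => w; rewrite mulrA.
  apply: (@integ_mul_bounded _ _ 1) => //.
  by move=> w; rewrite indicE ger0_norm// lern1 leq_b1.
Qed.

Lemma cge0_mul_bounded (M : R) f h : cge0 G h -> measurable_wrt G f ->
  (forall w, 0 <= f w <= M) -> cge0 G (fun w => f w * h w).
Proof.
move=> ch mf f0; apply: cge0_mul => //; first by move=> w; case/andP: (f0 w).
apply: (@integ_mul_bounded _ _ M); [exact: measurable_wrt_sub mf| |by case: ch].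
by move=> w; have /andP[? ?] := f0 w; rewrite ger0_norm.
Qed.

Lemma cge0Z (c : R) h : cge0 G h -> 0 <= c -> cge0 G (fun w => c * h w).
Proof.
move=> ch c0; apply: (@cge0_mul_bounded c) => //; first exact: measurable_cst.
by move=> w; rewrite c0/=.
Qed.

(** The set where [h] is negative belongs to [G]. *)
Lemma cge0_ae h : cge0 G h -> measurable_wrt G h -> {ae P, forall w, 0 <= h w}.
Proof.
move=> [ih h0] mh; have mhT := integ_measurable ih.
pose A := h @^-1` `]-oo, 0[.
have GA : G A by apply: measurable_wrt_preimage.
have mA := GM GA.
pose m w := Num.max (- h w) 0.
have m0 w : 0 <= m w by rewrite le_max lexx orbT.
have mm : measurable_fun setT m.
  by apply: measurable_maxr => //; exact: measurableT_comp.
have : (\int[P]_w (m w)%:E = 0)%E.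
  apply/eqP; rewrite eq_le integral_ge0 ?andbT//; last by move=> w _; rewrite lee_fin.
  have -> : (\int[P]_w (m w)%:E = - \int[P]_(w in A) (h w)%:E)%E.
    rewrite -integralN; last by apply: integrable_add_def => //; apply: integrableS ih.
    rewrite [RHS]integral_mkcond; apply: eq_integral => w _; rewrite patchE /m.
    case: ifPn => [|]; rewrite ?inE ?notin_setE /A/= in_itv/=.
      by move=> hw; rewrite max_l//; lra.
    by move=> /negP; rewrite -leNgt => hw; rewrite max_r//; lra.
  by rewrite oppe_le0 h0.
have -> : (\int[P]_w (m w)%:E = \int[P]_w `|(m w)%:E|)%E.
  by apply: eq_integral => w _; rewrite gee0_abs// lee_fin.
move/ae_eq_integral_abs => /(_ measurableT); have mm' : measurable_fun setT (EFin \o m) by exact/measurable_EFinP.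
move=> /(_ mm').
apply: filterS => w /(_ I) [] /= mw0; have : - h w <= m w by rewrite le_max lexx.
by rewrite mw0; lra.
Qed.
End fixed_sigma_algebra.
End conditionally_nonnegative.

(** * The standard normal distribution function *)

Section elementary_calculus.
Context (R : realType).

Lemma is_derive_continuous (f f' : R -> R) :
  (forall x : R, is_derive x 1 f (f' x)) -> continuous f.
Proof.
move=> df x; apply: differentiable_continuous.
by apply/derivable1_diffP; have [] := df x.
Qed.

Lemma is_derive_shift (f f' : R -> R) (l : R) :
  (forall x : R, is_derive x 1 f (f' x)) ->
  forall x : R, is_derive x 1 (fun y => f (y + l)) (f' (x + l)).
Proof.
move=> df x; have h : is_derive x 1 (+%R^~ l : R -> R) (1 : R).
  by apply: is_derive_eq; rewrite addr0.
have := @is_derive1_comp _ f (+%R^~ l) x _ 1 (df _) h.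
by rewrite mulr1.
Qed.

Lemma mvt_norm_le (f f' : R -> R) (k B : R) :
  (forall x : R, is_derive x 1 f (f' x)) ->
  (forall s, `|s| <= `|k| -> `|f' s| <= B) -> `|f k - f 0| <= B * `|k|.
Proof.
move=> df fB.
have cf := is_derive_continuous df.
have cfw a b : {within `[a, b], continuous f} by exact: continuous_subspaceT.
have [k0|k0|->] := ltgtP k 0; last by rewrite subrr !normr0 mulr0.
- have [c + e] := @MVT_segment R f f' k 0 (ltW k0) (fun x _ => df x) (cfw _ _).
  rewrite in_itv/= => /andP[c1 c2].
  rewrite distrC e normrM sub0r normrN ler_wpM2r// fB//.
  by rewrite !ler0_norm//; lra.
- have [c + e] := @MVT_segment R f f' 0 k (ltW k0) (fun x _ => df x) (cfw _ _).
  rewrite in_itv/= => /andP[c1 c2].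
  rewrite e normrM subr0 ler_wpM2r// fB//.
  by rewrite !ger0_norm//; lra.
Qed.

(** Raise [1 + y / (m + 1) <= expR (y / (m + 1))] to the power [m + 1]. *)
Lemma expR_ge_pow (m : nat) (y : R) : 0 <= y ->
  (1 + y) ^+ m.+1 <= m.+1%:R ^+ m.+1 * expR y.
Proof.
move=> y0; have m0 : (0 : R) < m.+1%:R by [].
have -> : expR y = expR (y / m.+1%:R) ^+ m.+1 by rewrite -expRM_natl mulrC divfK// gt_eqF.
rewrite -exprMn lerXn2r ?nnegrE ?mulr_ge0 ?expR_ge0 ?addr_ge0//.
apply: (@le_trans _ _ (m.+1%:R * (1 + y / m.+1%:R))).
  rewrite mulrDr mulr1 mulrCA divff ?gt_eqF// mulr1 lerD2r.
  by rewrite ler1n.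
by rewrite ler_wpM2l// expR_ge1Dx.
Qed.

End elementary_calculus.

Section gauss.
Context (R : realType).
Notation mu := (@lebesgue_measure R).
Notation Phi := (@std_normal_cdf R).

(** [normal_pdf 0 1] in the closed form that differentiation needs. *)
Definition gauss_density (x : R) : R :=
  (Num.sqrt (2 * pi))^-1 * expR (- (x ^+ 2) / 2).
Notation phi := gauss_density.

Lemma gauss_densityE : normal_pdf 0 1 = phi :> (R -> R).
Proof.
apply/funext => x; rewrite normal_pdfE ?oner_eq0// /normal_peak /normal_fun /phi.
by rewrite subr0 expr1n mul1r mulr_natl.
Qed.

Lemma sqrt_2pi_ge2 : 2 <= Num.sqrt (2 * pi) :> R.
Proof.
rewrite -[X in X <= _](@ger0_norm _ 2)// -sqrtr_sqr.
by rewrite ler_sqrt ?nnegrE ?expr2 ?mulr_ge0 ?pi_ge0// ler_wpM2l// pi_ge2.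
Qed.

Lemma gauss_density_ge0 x : 0 <= phi x.
Proof. by rewrite /phi mulr_ge0 ?expR_ge0// invr_ge0. Qed.

Lemma gauss_density_le_half_exp x : phi x <= 2^-1 * expR (- (x ^+ 2) / 2).
Proof.
rewrite /phi ler_wpM2r ?expR_ge0// lef_pV2 ?posrE//; first exact: sqrt_2pi_ge2.
by have := sqrt_2pi_ge2; lra.
Qed.

Lemma gauss_density_le_half x : phi x <= 2^-1.
Proof.
apply: (le_trans (gauss_density_le_half_exp x)).
have : expR (- (x ^+ 2) / 2) <= 1 by rewrite expR_le1; have := sqr_ge0 x; lra.
lra.
Qed.

Lemma gauss_densityN x : phi (- x) = phi x.
Proof. by rewrite /phi sqrrN. Qed.

(** The density absorbs every power of [2 + x^2]; the Taylor remainders of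
    [Phi] decay through this bound. *)
Lemma gauss_density_decay (m : nat) x :
  (2 + x ^+ 2) ^+ m.+1 * phi x <= 2 ^+ m * m.+1%:R ^+ m.+1.
Proof.
have x2 := sqr_ge0 x.
have -> : 2 + x ^+ 2 = 2 * (1 + x ^+ 2 / 2) by lra.
have h := @expR_ge_pow R m (x ^+ 2 / 2) ltac:(lra).
have p := gauss_density_le_half_exp x.
rewrite exprMn exprS.
have e : expR (- x ^+ 2 / 2) * expR (x ^+ 2 / 2) = 1.
  by rewrite -expRD -(expR0 R); congr expR; lra.
apply: (@le_trans _ _ (2 * 2 ^+ m * (m.+1%:R ^+ m.+1 * expR (x ^+ 2 / 2)) * (2^-1 * expR (- x ^+ 2 / 2)))).
  rewrite ler_pM ?gauss_density_ge0// ?mulr_ge0// ?exprn_ge0//; first lra.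
  by rewrite ler_wpM2l// mulr_ge0// exprn_ge0.
set a := 2 ^+ m; set b := _ ^+ m.+1; set u := expR (_ / 2) in e *; set v := expR (x ^+ 2 / 2) in e *.
have -> : 2 * a * (b * v) * (2^-1 * u) = a * b * (u * v) by field.
by rewrite e mulr1.
Qed.

Lemma is_derive_gauss_density (x : R) : is_derive x 1 phi (- x * phi x).
Proof.
rewrite /phi.
have : is_derive x 1 (fun x : R => (Num.sqrt (2 * pi))^-1 *: expR (- x ^+ 2 / 2)) ((Num.sqrt (2 * pi))^-1 *: (expR (- x ^+ 2 / 2) * (- x))).
  apply: is_deriveZ.
  apply: (@is_derive1_comp _ expR (fun x : R => - x ^+ 2 / 2)).
  rewrite (_ : (fun x : R => - x ^+ 2 / 2) = (fun x : R => (- 2^-1) *: (x ^+ 2))); last first.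
    by apply/funext => y; rewrite /GRing.scale/=; lra.
  apply: is_derive_eq; rewrite /GRing.scale/=; lra.
move=> h; apply: is_derive_eq; rewrite /GRing.scale/=; lra.
Qed.

Lemma measurable_gauss_density : measurable_fun setT phi.
Proof. by rewrite -gauss_densityE; exact: measurable_normal_pdf. Qed.

Lemma continuous_gauss_density : continuous phi.
Proof. by rewrite -gauss_densityE; apply: continuous_normal_pdf; rewrite oner_eq0. Qed.

Lemma integrable_gauss_density : mu.-integrable setT (EFin \o phi).
Proof. by have := integrable_normal_pdf (0 : R) 1; rewrite gauss_densityE. Qed.

Lemma integ_itv (A : set R) : measurable A -> mu.-integrable A (EFin \o phi).
Proof. by move=> mA; apply: integrableS integrable_gauss_density. Qed.

Lemma PhiE x : Phi x = \int[mu]_(t in `]-oo, x]) phi t.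
Proof.
rewrite /std_normal_cdf -RintegralZl//.
have c0 : (Num.sqrt (2 * pi : R)) != 0 by rewrite gt_eqF//; have := sqrt_2pi_ge2; lra.
rewrite (_ : _ \o _ = fun t => (Num.sqrt (2 * pi))%:E * (phi t)%:E)%E.
  by apply: integrableZl => //; exact: integ_itv.
by apply/funext => t /=; rewrite -EFinM /phi mulrA divff// mul1r.
Qed.

Lemma PhiEE x : (Phi x)%:E = (\int[mu]_(t in `]-oo, x]) (phi t)%:E)%E.
Proof. by rewrite PhiE /Rintegral fineK//; apply: integrable_fin_num => //; exact: integ_itv. Qed.

Lemma Phi_normal_prob x : (Phi x)%:E = normal_prob 0 1 `]-oo, x].
Proof. by rewrite PhiEE /normal_prob gauss_densityE. Qed.

Lemma Phi_ge0 x : 0 <= Phi x.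
Proof. by rewrite PhiE; apply: Rintegral_ge0 => t _; exact: gauss_density_ge0. Qed.

Lemma Phi_le1 x : Phi x <= 1.
Proof. by rewrite -lee_fin Phi_normal_prob probability_le1. Qed.

Lemma le_Phi x y : x <= y -> Phi x <= Phi y.
Proof.
move=> xy; rewrite -lee_fin !Phi_normal_prob le_measure ?inE//.
by apply: subset_itvl; rewrite bnd_simp.
Qed.

Lemma is_derive_Phi (x : R) : is_derive x 1 Phi (phi x).
Proof.
have [||||d1 d2] := @continuous_FTC1 R phi -oo%O x (x + 1).
- by rewrite ltrDl.
- exact: integ_itv.
- by rewrite ltNyr.
- exact: continuous_gauss_density.
rewrite (_ : Phi = fun x => \int[mu]_(t in `]-oo, x]) phi t); last by apply/funext => y; exact: PhiE.
by apply: DeriveDef; [exact: d1|rewrite -derive1E; exact: d2].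
Qed.

Lemma continuous_Phi : continuous Phi.
Proof.
exact: is_derive_continuous is_derive_Phi.
Qed.

Lemma normal_prob_itvy x : normal_prob 0 1 `[x, +oo[ = (1 - Phi x)%:E.
Proof.
rewrite -setCitvl probability_setC// EFinB Phi_normal_prob; congr (_ - _)%E.
transitivity (\int[mu]_(t in `]-oo, x[) (normal_pdf 0 1 t)%:E)%E; first by [].
rewrite integral_itv_bndo_bndc// gauss_densityE.
by apply: measurable_funTS; apply/measurable_EFinP; exact: measurable_gauss_density.
Qed.

Lemma PhiN x : Phi (- x) = 1 - Phi x.
Proof.
apply: EFin_inj; rewrite PhiEE ge0_integration_by_substitutionNy.
- rewrite -normal_prob_itvy /normal_prob gauss_densityE; apply: eq_integral => y _ /=.
  by rewrite gauss_densityN.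
- by apply: continuous_subspaceT; exact: continuous_gauss_density.
- by move=> y _; exact: gauss_density_ge0.
Qed.

Lemma cvg_Phi_pinfty : Phi x @[x --> +oo] --> (1 : R).
Proof.
pose idTR : measurableTypeR R -> R := idfun.
pose X : {mfun measurableTypeR R >-> R} := HB.pack idTR (@isMeasurableFun.Build _ _ _ _ idTR (@measurable_id _ _ setT)).
have := @cvg_cdfy1 _ _ _ (normal_prob 0 1) X.
rewrite (_ : cdf _ = EFin \o Phi); last first.
  by apply/funext => x; rewrite /= Phi_normal_prob.
by move/fine_cvg.
Qed.

Lemma integral_gauss_density_shift (l b : R) :
  (\int[mu]_(z in `[b, +oo[) (phi (z + l))%:E = (1 - Phi (b + l))%:E)%E.
Proof.
have dP := is_derive_shift l is_derive_Phi.
rewrite (@ge0_continuous_FTC2y R (fun z => phi (z + l)) (fun z => Phi (z + l)) b 1)//.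
- by move=> x _; exact: gauss_density_ge0.
- apply: continuous_subspaceT.
  exact: (is_derive_continuous (is_derive_shift l is_derive_gauss_density)).
- by apply: cvg_comp cvg_Phi_pinfty; exact: cvg_addrr.
- apply: cvg_at_right_filter; exact: (is_derive_continuous dP).
- by move=> x _; rewrite derive1E; have [] := dP x.
Qed.

(** Completing the square shifts the normal law by [l]. *)
Lemma gauss_laplace (l b : R) :
  (\int[normal_prob 0 1]_z (\1_`]b, +oo[ z * expR (- (l * (z - b))))%:E =
   (expR (l * b + l ^+ 2 / 2) * (1 - Phi (b + l)))%:E)%E.
Proof.
have mf : measurable_fun setT (fun z : R => \1_`]b, +oo[ z * expR (- (l * (z - b)))).
  apply: measurable_funM; first exact: measurable_indic.
  apply: measurableT_comp => //; apply: measurableT_comp => //.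
  by apply: measurable_funM => //; exact: measurable_funB.
rewrite (@ge0_integral_density _ _ _ mu _ phi)//; last 3 first.
- exact: measurable_gauss_density.
- by move=> x; exact: gauss_density_ge0.
- by move=> A mA; rewrite -gauss_densityE.
rewrite EFinM -integral_gauss_density_shift -ge0_integralZl//; first last.
- by move=> x _; rewrite lee_fin gauss_density_ge0.
- apply: measurable_funTS; apply/measurable_EFinP; apply: measurableT_comp; first exact: measurable_gauss_density.
  exact: measurable_funD.
rewrite -integral_itv_obnd_cbnd; last first.
  apply: measurable_funTS; apply: emeasurable_funM => //; apply/measurable_EFinP; apply: measurableT_comp; first exact: measurable_gauss_density.
  exact: measurable_funD.
rewrite [RHS]integral_mkcond; apply: eq_integral => x _; rewrite patchE indicE.
case: ifP => _; last by rewrite !mul0r.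
rewrite mul1r -EFinM; congr EFin; rewrite /phi mulrCA [RHS]mulrCA; congr (_ * _).
rewrite -!expRD; congr expR; lra.
Qed.
End gauss.

Section rational_taylor.
Context (R : realType).
Implicit Types y q h c r v z eta t : R.

Lemma sqr_normr (x : R) : `|x| ^+ 2 = x ^+ 2.
Proof. by rewrite real_normK// num_real. Qed.

Lemma norm_le_sqr (x : R) : `|x| <= 1 + x ^+ 2.
Proof.
have := sqr_ge0 (`|x| - 1); rewrite -(sqr_normr x) (_ : (_ - 1) ^+ 2 = `|x| ^+ 2 - 2 * `|x| + 1); last by ring.
by have := normr_ge0 x; lra.
Qed.

(** Multiplied by [y], the gap is [(y - 1)^4 (5 y^3 + 20 y^2 + 29 y + 16) /
    16]. *)
Lemma inv_sqrt_taylor_ge y q : 0 < y -> y ^+ 2 = 1 + q ->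
  1 - q / 2 + 3 * q ^+ 2 / 8 - 5 * q ^+ 3 / 16 <= y^-1.
Proof.
move=> y0 yq; have qE : q = y ^+ 2 - 1 by lra.
rewrite -(ler_pM2l y0) divff ?gt_eqF// qE -subr_ge0.
rewrite (_ : _ - _ = (y - 1) ^+ 2 ^+ 2 * (5 * y ^+ 3 + 20 * y ^+ 2 + 29 * y + 16) / 16); last by field.
apply: divr_ge0 => //; apply: mulr_ge0; first exact: sqr_ge0.
by rewrite !addr_ge0// ?mulr_ge0// ?exprn_ge0// ltW.
Qed.

Lemma inv_sqrt_taylor_le y q : 0 < y -> 0 <= q -> y ^+ 2 = 1 + q ->
  y^-1 <= 1 - q / 2 + 3 * q ^+ 2 / 8.
Proof.
move=> y0 q0 yq; have qE : q = y ^+ 2 - 1 by lra.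
have y0' := ltW y0.
have y1 : 1 <= y by rewrite -(ler_pXn2r (isT : (0 < 2)%N)) ?nnegrE// expr1n; lra.
rewrite -(ler_pM2l y0) divff ?gt_eqF// qE -subr_ge0.
rewrite (_ : _ - _ = (y - 1) ^+ 3 * (3 * y ^+ 2 + 9 * y + 8) / 8); last by field.
apply: divr_ge0 => //; apply: mulr_ge0; first by rewrite exprn_ge0// subr_ge0.
by rewrite !addr_ge0// ?mulr_ge0// ?exprn_ge0// ltW.
Qed.

(** The first terms of the generating function of the Legendre polynomials:
    [h] is the size of a step relative to the distance to the origin and [c]
    the cosine of its direction. *)
Lemma legendre_taylor y h c : 0 < y -> `|c| <= 1 -> y ^+ 2 = 1 + (h ^+ 2 - 2 * c * h) ->
  1 + c * h + h ^+ 2 / 2 * (3 * c ^+ 2 - 1) - 12 * `|h| ^+ 3 <= y^-1.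
Proof.
move=> y0 c1 yE; have h0 : 0 <= `|h| by [].
have c2 : c ^+ 2 <= 1 by rewrite -(sqr_normr c) expr_le1.
have hh : h ^+ 2 = `|h| ^+ 2 by rewrite sqr_normr.
have ch : `|c * h| <= `|h| by rewrite normrM ler_piMl.
have [hle|hgt] := leP `|h| 1.
  apply: le_trans (inv_sqrt_taylor_ge y0 yE).
  set q := h ^+ 2 - 2 * c * h.
  have qle : `|q| <= 3 * `|h|.
    rewrite /q; apply: (le_trans (ler_normB _ _)).
    rewrite normrX -mulrA normrM (@ger0_norm _ 2)//.
    have : `|h| ^+ 2 <= `|h| by rewrite expr2 ler_piMl.
    lra.
  have q3 : q ^+ 3 <= 27 * `|h| ^+ 3.
    rewrite (le_trans (ler_norm _))// normrX (_ : 27 * `|h| ^+ 3 = (3 * `|h|) ^+ 3); last by ring.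
    by rewrite lerXn2r ?nnegrE// mulr_ge0.
  have q2 : 3 * q ^+ 2 / 8 = 3 / 8 * h ^+ 4 - 3 / 2 * (c * h) * h ^+ 2 + 3 / 2 * c ^+ 2 * h ^+ 2 by rewrite /q; field.
  have h4 : 0 <= h ^+ 4 by rewrite (exprM h 2 2) sqr_ge0.
  have ch3 : (c * h) * h ^+ 2 <= `|h| ^+ 3.
    rewrite hh [_ ^+ 3]exprS ler_wpM2r ?exprn_ge0//.
    by rewrite (le_trans (ler_norm _)).
  have h3 : 0 <= `|h| ^+ 3 by rewrite exprn_ge0.
  rewrite q2 {1}/q; move: q3; set Q := q ^+ 3 => q3; lra.
apply: (@le_trans _ _ 0); last by rewrite invr_ge0 ltW.
have h1 : 1 <= `|h| by exact: ltW.
have k3 : `|h| <= `|h| ^+ 3 by rewrite exprS ler_peMr// exprn_ege1.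
have k2 : h ^+ 2 <= `|h| ^+ 3 by rewrite hh [leRHS]exprS ler_peMl// exprn_ge0.
have k1 : 1 <= `|h| ^+ 3 by rewrite exprn_ege1.
have k4 : c * h <= `|h| by rewrite (le_trans (ler_norm _)).
have k5 : h ^+ 2 / 2 * (3 * c ^+ 2 - 1) <= h ^+ 2.
  have h2 := sqr_ge0 h; have : h ^+ 2 * c ^+ 2 <= h ^+ 2 by rewrite ler_piMr.
  lra.
lra.
Qed.

Lemma inv_norm_space_taylor r r1 z eta t : 0 < t -> 0 < r -> 0 < r1 ->
  r ^+ 2 = 2 * t + z ^+ 2 -> r1 ^+ 2 = 2 * t + (z - eta) ^+ 2 ->
  r^-1 + eta * (z / r ^+ 3) + eta ^+ 2 * ((3 * z ^+ 2 / r ^+ 5 - (r ^+ 3)^-1) / 2)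
    - 12 * (`|eta| ^+ 3 / r ^+ 4) <= r1^-1.
Proof.
move=> t0 r0 r10 rE r1E; have rn0 : r != 0 by rewrite gt_eqF.
have c1 : `|z / r| <= 1.
  rewrite normrM normfV (gtr0_norm r0) ler_pdivrMr// mul1r.
  by rewrite -(ler_pXn2r (isT : (0 < 2)%N)) ?nnegrE// ?ltW// sqr_normr rE; lra.
have yE : (r1 / r) ^+ 2 = 1 + ((eta / r) ^+ 2 - 2 * (z / r) * (eta / r)).
  rewrite expr_div_n r1E; apply: (mulIf (expf_neq0 2 rn0)).
  rewrite divfK ?expf_neq0// rE.
  transitivity (r ^+ 2 + eta ^+ 2 - 2 * z * eta); first by rewrite rE; ring.
  by rewrite -rE; field.
have := @legendre_taylor (r1 / r) (eta / r) (z / r) (divr_gt0 r10 r0) c1 yE.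
rewrite invf_div normrM normfV (gtr0_norm r0) => h.
rewrite -(ler_pM2l r0); apply: le_trans h.
by rewrite le_eqVlt; apply/orP; left; apply/eqP; field.
Qed.

Lemma inv_norm_time_taylor r r1 z v t : 0 <= v -> 0 < r -> 0 < r1 ->
  r ^+ 2 = 2 * t + z ^+ 2 -> r1 ^+ 2 = 2 * (t + v) + z ^+ 2 ->
  r1^-1 <= r^-1 - v / r ^+ 3 + 2 * (v ^+ 2 / r ^+ 5).
Proof.
move=> v0 r0 r10 rE r1E; have rn0 : r != 0 by rewrite gt_eqF.
have yE : (r1 / r) ^+ 2 = 1 + 2 * v / r ^+ 2.
  rewrite expr_div_n r1E; apply: (mulIf (expf_neq0 2 rn0)).
  rewrite divfK ?expf_neq0// [in RHS]mulrDl [in RHS]divfK ?expf_neq0// rE; ring.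
have q0 : 0 <= 2 * v / r ^+ 2 by rewrite divr_ge0 ?sqr_ge0// mulr_ge0.
have := inv_sqrt_taylor_le (divr_gt0 r10 r0) q0 yE.
rewrite invf_div => h; rewrite -(ler_pM2l r0); apply: (le_trans h).
rewrite -subr_ge0.
rewrite (_ : _ - _ = 1/2 * (v ^+ 2 / r ^+ 4)); last by field.
by rewrite mulr_ge0// divr_ge0// ?sqr_ge0// exprn_ge0// ltW.
Qed.

End rational_taylor.

Section gauss_taylor.
Context (R : realType).
Notation Phi := (@std_normal_cdf R).
Notation phi := (@gauss_density R).
Implicit Types x w k : R.

Lemma is_derive_gauss_density2 x :
  is_derive x 1 (fun x : R => - x * phi x) ((x ^+ 2 - 1) * phi x).
Proof.
have h1 : is_derive x 1 (fun x : R => - x) (- 1) by apply: is_deriveNid.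
have := @is_deriveM _ _ _ _ x 1 _ _ h1 (is_derive_gauss_density x).
move=> h; apply: is_derive_eq; rewrite /GRing.scale/=; ring.
Qed.

Lemma Phi_taylor1 (w k B : R) :
  (forall s, `|s| <= `|k| -> `|w + s| * phi (w + s) <= B) ->
  `|Phi (w + k) - Phi w - k * phi w| <= B * k ^+ 2.
Proof.
move=> hB.
have d1 (s : R) : is_derive s 1 (fun s : R => phi (w + s)) (- (w + s) * phi (w + s)).
  rewrite (_ : (fun s : R => phi (w + s)) = (fun s : R => phi (s + w))); last by apply/funext => y; rewrite addrC.
  by rewrite (addrC w s); exact: (is_derive_shift w (@is_derive_gauss_density R)).
have d0 (s : R) : is_derive s 1 (fun s : R => Phi (w + s) - s * phi w) (phi (w + s) - phi w).
  rewrite (_ : (fun s : R => _) = (fun s : R => Phi (s + w) - phi w *: s)); last first.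
    by apply/funext => y; rewrite /GRing.scale/= (addrC w y) (mulrC y).
  rewrite (addrC w s).
  have h := (is_derive_shift w (@is_derive_Phi R) s).
  by apply: is_derive_eq; rewrite /GRing.scale/= mulr1.
have B0 : 0 <= B.
  apply: le_trans (hB 0 _); last by rewrite normr0.
  by rewrite mulr_ge0// gauss_density_ge0.
have b1 s : `|s| <= `|k| -> `|phi (w + s) - phi w| <= B * `|k|.
  move=> sk; have := @mvt_norm_le R (fun s => phi (w + s)) _ s B d1.
  rewrite addr0 => h; apply: le_trans (h _) _.
    move=> t ts; rewrite normrM normrN (ger0_norm (gauss_density_ge0 _)).
    by apply: hB; exact: le_trans sk.
  by rewrite ler_wpM2l.
have := @mvt_norm_le R _ _ k (B * `|k|) d0 b1.
by rewrite addr0 mul0r subr0 -mulrA -expr2 sqr_normr addrAC.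
Qed.

Lemma Phi_taylor2 (w k B : R) :
  (forall s, `|s| <= `|k| -> `|(w + s) ^+ 2 - 1| * phi (w + s) <= B) ->
  `|Phi (w + k) - Phi w - k * phi w + k ^+ 2 / 2 * (w * phi w)| <= B * `|k| ^+ 3.
Proof.
move=> hB.
have d2 (s : R) : is_derive s 1 (fun s : R => - (w + s) * phi (w + s)) (((w + s) ^+ 2 - 1) * phi (w + s)).
  rewrite (_ : (fun s : R => _) = (fun s : R => - (s + w) * phi (s + w))); last by apply/funext => y; rewrite addrC.
  by rewrite (addrC w s); exact: (is_derive_shift w is_derive_gauss_density2).
have d1 (s : R) : is_derive s 1 (fun s : R => phi (w + s) + s * (w * phi w)) (- (w + s) * phi (w + s) + w * phi w).
  rewrite (_ : (fun s : R => _) = (fun s : R => phi (s + w) + (w * phi w) *: s)); last first.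
    by apply/funext => y; rewrite /GRing.scale/= (addrC w y) (mulrC y).
  rewrite (addrC w s).
  have h := (is_derive_shift w (@is_derive_gauss_density R) s).
  by apply: is_derive_eq; rewrite /GRing.scale/= mulr1.
have d0 (s : R) : is_derive s 1 (fun s : R => Phi (w + s) - s * phi w + s ^+ 2 / 2 * (w * phi w)) (phi (w + s) - phi w + s * (w * phi w)).
  rewrite (_ : (fun s : R => _) = (fun s : R => Phi (s + w) - phi w *: s + (w * phi w / 2) *: (s ^+ 2))); last first.
    by apply/funext => y; rewrite /GRing.scale/= (addrC w y); ring.
  rewrite (addrC w s).
  have h := (is_derive_shift w (@is_derive_Phi R) s).
  by apply: is_derive_eq; rewrite /GRing.scale/= mulr1; field.
have B0 : 0 <= B.
  apply: le_trans (hB 0 _); last by rewrite normr0.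
  by rewrite mulr_ge0// gauss_density_ge0.
have b2 s : `|s| <= `|k| -> `|- (w + s) * phi (w + s) + w * phi w| <= B * `|k|.
  move=> sk; have := @mvt_norm_le R _ _ s B d2.
  rewrite addr0 [X in _ - X]mulNr opprK => h; apply: le_trans (h _) _.
    move=> t ts; rewrite normrM (ger0_norm (gauss_density_ge0 _)).
    by apply: hB; exact: le_trans sk.
  by rewrite ler_wpM2l.
have b1 s : `|s| <= `|k| -> `|phi (w + s) - phi w + s * (w * phi w)| <= B * `|k| * `|k|.
  move=> sk; have := @mvt_norm_le R _ _ s (B * `|k|) d1.
  rewrite addr0 mul0r addr0 addrAC => h; apply: le_trans (h _) _.
    by move=> t ts; apply: b2; exact: le_trans sk.
  by rewrite ler_wpM2l// mulr_ge0.
have := @mvt_norm_le R _ _ k (B * `|k| * `|k|) d0 b1.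
rewrite addr0 mul0r subr0 expr0n/= mul0r mul0r addr0 => h.
rewrite (_ : B * `|k| ^+ 3 = B * `|k| * `|k| * `|k|); last by ring.
by apply: le_trans h; rewrite le_eqVlt; apply/orP; left; apply/eqP; congr `|_|; ring.
Qed.

(** A step shorter than [rho / 4] stays at points whose distance [sqrt (2 +
    x^2)] is comparable to [rho], where the third derivative is at most [1000
    / rho^3]. For a longer step each term on the left is bounded by powers of
    [|k| / rho]. *)
Lemma Phi_space_taylor w k rho : 0 < rho -> rho ^+ 2 = 2 + w ^+ 2 ->
  `|Phi (w - k) - Phi w + k * phi w + k ^+ 2 / 2 * (w * phi w)| <=
    1000 * (`|k| / rho) ^+ 3.
Proof.
move=> r0 rE; have w2 := sqr_ge0 w.
have r1 : 1 <= rho.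
  have r0' := ltW r0.
  by rewrite -(ler_pXn2r (isT : (0 < 2)%N)) ?nnegrE// expr1n; lra.
have p0 := gauss_density_ge0 w.
have dec1 := @gauss_density_decay R 0 w; have dec2 := @gauss_density_decay R 1 w.
have [kle|kgt] := leP `|k| (rho / 4).
  suff H s : `|s| <= `|- k| -> `|(w + s) ^+ 2 - 1| * phi (w + s) <= 1000 / rho ^+ 3.
    have := Phi_taylor2 H; rewrite normrN sqrrN mulNr opprK => h; apply: (le_trans h).
    by rewrite expr_div_n le_eqVlt; apply/orP; left; apply/eqP; field; rewrite gt_eqF.
  rewrite normrN => sk.
  set x := w + s; have x2 := sqr_ge0 x.
  have wle : rho ^+ 2 <= 3 * (2 + x ^+ 2).
    have ws : `|w| <= `|x| + rho / 4.
      rewrite (_ : w = x - s); last by rewrite /x; ring.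
      by rewrite (le_trans (ler_normB _ _))// lerD2l (le_trans sk).
    have ww : w ^+ 2 <= (`|x| + rho / 4) ^+ 2.
      by rewrite -(sqr_normr w) lerXn2r ?nnegrE// addr_ge0// divr_ge0// ltW.
    have := sqr_ge0 (`|x| - rho / 4).
    have := sqr_normr x; move: ww rE; rewrite !expr2; set a := `|x|; nra.
  have dec3 := @gauss_density_decay R 2 x.
  have px := gauss_density_ge0 x.
  have e1 : `|x ^+ 2 - 1| <= 2 + x ^+ 2 by rewrite ler_norml; lra.
  have r3 : 0 < rho ^+ 3 by rewrite exprn_gt0.
  rewrite ler_pdivlMr//.
  apply: (@le_trans _ _ ((2 + x ^+ 2) * phi x * (9 * (2 + x ^+ 2) ^+ 2))).
    apply: ler_pM; rewrite ?mulr_ge0 ?exprn_ge0 ?(ltW r0)//.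
      by rewrite ler_wpM2r.
    apply: (@le_trans _ _ (rho ^+ 2 ^+ 2)).
      by rewrite -exprM ler_weXn2l.
    rewrite (_ : 9 * _ ^+ 2 = (3 * (2 + x ^+ 2)) ^+ 2); last by ring.
    by rewrite lerXn2r ?nnegrE ?sqr_ge0 ?mulr_ge0//; lra.
  rewrite (_ : _ * _ = 9 * ((2 + x ^+ 2) ^+ 3 * phi x)); last by ring.
  by move: dec3; lra.
have k0 : 0 <= `|k| by [].
set K := `|k| / rho.
have K4 : 1 <= 4 * K by rewrite /K mulrA ler_pdivlMr// mul1r; lra.
have kE : `|k| = K * rho by rewrite /K divfK// gt_eqF.
have K0 : 0 <= K by rewrite /K divr_ge0// ltW.
have t1 : `|Phi (w - k) - Phi w| <= 1.
  have := Phi_ge0 (w - k); have := Phi_le1 (w - k); have := Phi_ge0 w; have := Phi_le1 w.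
  by rewrite ler_norml; lra.
have rp : rho * phi w <= 1.
  move: dec1; rewrite expr1 -rE !expr1n !mulr1 expr0 => dec1.
  apply: le_trans dec1; rewrite ler_wpM2r// expr2 ler_peMl//; exact: ltW.
have rp2 : rho ^+ 2 * (`|w| * phi w) <= 8.
  move: dec2; rewrite -rE => dec2; apply: le_trans (_ : rho ^+ 2 ^+ 2 * phi w <= _); last by lra.
  rewrite mulrA ler_wpM2r// -exprM (exprD rho 2 2) ler_wpM2l ?sqr_ge0//.
  by rewrite rE; have := norm_le_sqr w; lra.
have t2 : `|k * phi w| <= K.
  by rewrite normrM (ger0_norm p0) kE -mulrA ler_piMr.
have t3 : `|k ^+ 2 / 2 * (w * phi w)| <= 4 * K ^+ 2.
  rewrite normrM normrM (@ger0_norm _ 2^-1) ?invr_ge0// normrX kE normrM (ger0_norm p0).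
  rewrite exprMn; have := sqr_ge0 K.
  move: rp2; set A := rho ^+ 2; set D := `|w| * phi w => h h'.
  rewrite (_ : _ / 2 * D = K ^+ 2 * (A * D) / 2); last by field.
  have : K ^+ 2 * (A * D) <= K ^+ 2 * 8 by rewrite ler_wpM2l.
  lra.
apply: (@le_trans _ _ (1 + K + 4 * K ^+ 2)).
  apply: (le_trans (ler_normD _ _)); apply: lerD => //.
  by apply: (le_trans (ler_normD _ _)); apply: lerD.
have K1 : K ^+ 2 <= 4 * K ^+ 3.
  by rewrite (_ : 4 * K ^+ 3 = K ^+ 2 * (4 * K)); [rewrite ler_peMr ?sqr_ge0|ring].
have K2 : K <= 4 * K ^+ 2 by rewrite expr2 mulrA ler_peMl.
lra.
Qed.

(** A change of time is the step [w * (b - 1)] in space, and [b - 1] is [- tau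
    / 2] up to [tau^2]. *)
Lemma Phi_time_taylor w b tau rho : 0 < rho -> rho ^+ 2 = 2 + w ^+ 2 ->
  0 <= tau <= 1 -> 0 < b -> b ^+ 2 * (1 + tau) = 1 ->
  `|Phi (w * b) - Phi w + tau / 2 * (w * phi w)| <= (4 * 100 ^+ 2) * (tau ^+ 2 / rho ^+ 4).
Proof.
move=> r0 rE /andP[t0 t1] b0 bE; have w2 := sqr_ge0 w; have bn : b != 0 by rewrite gt_eqF.
have yE : b^-1 ^+ 2 = 1 + tau.
  by apply: (mulfI (expf_neq0 2 bn)); rewrite bE -exprMn divff// expr1n.
have bi : 0 < b^-1 by rewrite invr_gt0.
have bu := inv_sqrt_taylor_le bi t0 yE; have bl := inv_sqrt_taylor_ge bi yE.
rewrite invrK in bu bl.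
have t2 : tau ^+ 2 <= tau by rewrite expr2 ler_piMl.
have t3 : tau ^+ 3 <= tau ^+ 2 by rewrite exprS ler_piMl// sqr_ge0.
have tt := sqr_ge0 tau.
have bh : 0 <= b - 1 + tau / 2 <= 3 * tau ^+ 2 / 8 by apply/andP; split; lra.
have bk : - (tau / 2) <= b - 1 <= 0 by apply/andP; split; lra.
pose k := w * (b - 1).
have kw : `|k| <= `|w| * (tau / 2) by rewrite normrM ler_wpM2l// ler_norml; lra.
have ww : 0 <= `|w| by [].
have r6 : 0 < rho ^+ 6 by rewrite exprn_gt0.
have h1 := @Phi_taylor1 w k (2 ^+ 17 / rho ^+ 6).
have {}h1 : `|Phi (w + k) - Phi w - k * phi w| <= 2 ^+ 17 / rho ^+ 6 * k ^+ 2.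
  apply: h1 => s sk; set x := w + s; have x2 := sqr_ge0 x.
  have wle : rho ^+ 2 <= 4 * (2 + x ^+ 2).
    have ws : `|w| <= 2 * `|x|.
      have : `|w| <= `|x| + `|s|.
        rewrite (_ : w = x - s); last by rewrite /x; ring.
        by rewrite (le_trans (ler_normB _ _)).
      have : `|w| * (tau / 2) <= `|w| / 2 by rewrite ler_wpM2l//; lra.
      lra.
    have : w ^+ 2 <= 4 * x ^+ 2.
      rewrite -(sqr_normr w) -(sqr_normr x) (_ : 4 * _ = (2 * `|x|) ^+ 2); last by ring.
      by rewrite lerXn2r ?nnegrE// mulr_ge0.
    lra.
  have dec4 := @gauss_density_decay R 3 x.
  have px := gauss_density_ge0 x.
  rewrite ler_pdivlMr//.
  apply: (@le_trans _ _ ((2 + x ^+ 2) * phi x * (64 * (2 + x ^+ 2) ^+ 3))).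
    apply: ler_pM; rewrite ?mulr_ge0 ?exprn_ge0 ?(ltW r0)//.
      rewrite ler_wpM2r//.
      by have := norm_le_sqr x; lra.
    rewrite (_ : 64 * _ ^+ 3 = (4 * (2 + x ^+ 2)) ^+ 3); last by ring.
    rewrite (exprM rho 2 3) lerXn2r ?nnegrE ?sqr_ge0 ?mulr_ge0//; lra.
  rewrite (_ : _ * _ = 64 * ((2 + x ^+ 2) ^+ 4 * phi x)); last by ring.
  by move: dec4; lra.
have h2 : `|w * (b - 1 + tau / 2) * phi w| <= 41 * (tau ^+ 2 / rho ^+ 4).
  have dec3 := @gauss_density_decay R 2 w.
  have pw := gauss_density_ge0 w.
  have r4 : 0 < rho ^+ 4 by rewrite exprn_gt0.
  rewrite mulrA ler_pdivlMr// normrM (ger0_norm pw) normrM.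
  rewrite (@ger0_norm _ (_ + tau / 2)); last by case/andP: bh.
  apply: (@le_trans _ _ (3 * tau ^+ 2 / 8 * (`|w| * (rho ^+ 4 * phi w)))).
    rewrite (_ : _ * rho ^+ 4 = (b - 1 + tau / 2) * (`|w| * (rho ^+ 4 * phi w))); last by ring.
    rewrite ler_wpM2r//; last by case/andP: bh.
    by rewrite !mulr_ge0// ltW.
  have : `|w| * (rho ^+ 4 * phi w) <= 108.
    apply: (@le_trans _ _ ((2 + w ^+ 2) ^+ 3 * phi w)); last by move: dec3; lra.
    rewrite mulrA ler_wpM2r// (exprM rho 2 2) rE [leRHS]exprS ler_wpM2r ?sqr_ge0//.
    by have := norm_le_sqr w; lra.
  move=> /(ler_wpM2l (_ : 0 <= 3 * tau ^+ 2 / 8)) h; apply: le_trans (h _) _; lra.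
have h3 : 2 ^+ 17 / rho ^+ 6 * k ^+ 2 <= 2 ^+ 15 * (tau ^+ 2 / rho ^+ 4).
  apply: (@le_trans _ _ (2 ^+ 17 / rho ^+ 6 * (rho ^+ 2 * (tau ^+ 2 / 4)))).
    rewrite ler_wpM2l ?divr_ge0 ?(ltW r6)//.
    apply: (@le_trans _ _ ((`|w| * (tau / 2)) ^+ 2)).
      by rewrite -(sqr_normr k) lerXn2r ?nnegrE// mulr_ge0//; lra.
    rewrite exprMn sqr_normr; have -> : (tau / 2) ^+ 2 = tau ^+ 2 / 4 by field.
    by rewrite ler_wpM2r ?rE; lra.
  by rewrite le_eqVlt; apply/orP; left; apply/eqP; field; rewrite gt_eqF.
rewrite (_ : w * b = w + k); last by rewrite /k; ring.
rewrite (_ : _ + _ = (Phi (w + k) - Phi w - k * phi w) + w * (b - 1 + tau / 2) * phi w); last by rewrite /k; ring.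
apply: (le_trans (ler_normD _ _)).
have : 0 <= tau ^+ 2 / rho ^+ 4 by rewrite divr_ge0// exprn_ge0// ltW.
lra.
Qed.

Lemma Phi_lip x y : `|Phi x - Phi y| <= `|x - y| / 2.
Proof.
have := @mvt_norm_le R _ _ (x - y) 2^-1 (is_derive_shift y (@is_derive_Phi R)).
rewrite subrK add0r mulrC; apply => s _.
by rewrite ger0_norm ?gauss_density_ge0// gauss_density_le_half.
Qed.

(** [c * phi c] is at most one, which makes [Phi] Lipschitz with respect to
    multiplicative changes of its argument. *)
Lemma Phi_scale y a : 1 <= a -> `|Phi (y / a) - Phi y| <= a - 1.
Proof.
move=> a1; have a0 : 0 < a by lra.
wlog y0 : y / 0 <= y.
  move=> H; have [/H//|y0] := leP 0 y.
  have := H (- y); rewrite mulNr !PhiN => /(_ _).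
  rewrite (_ : 1 - _ - _ = - (Phi (y / a) - Phi y)); last by ring.
  by rewrite normrN; apply; lra.
have ya : y / a <= y by rewrite ler_pdivrMr// ler_peMr.
have ya0 : 0 <= y / a by rewrite divr_ge0// ltW.
have [c] := @MVT_segment R Phi phi _ _ ya (fun x _ => is_derive_Phi x) (continuous_subspaceT (@continuous_Phi R)).
rewrite in_itv/= => /andP[c1 c2] e; rewrite distrC e ger0_norm; last first.
  by rewrite mulr_ge0 ?gauss_density_ge0// subr_ge0.
have pc := gauss_density_ge0 c; have := @gauss_density_decay R 0 c.
rewrite expr1 expr0 !mul1r expr1 => dec.
have -> : y - y / a = y / a * (a - 1) by field; rewrite gt_eqF.
rewrite mulrA ler_piMl ?subr_ge0//.
apply: le_trans dec; rewrite mulrC ler_wpM2r//.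
apply: (le_trans c1); have := sqr_ge0 (c - 1); rewrite !expr2; lra.
Qed.

End gauss_taylor.

Section gauss_tail.
Context (R : realType).
Notation Phi := (@std_normal_cdf R).
Notation phi := (@gauss_density R).
Notation mu := (@lebesgue_measure R).
Implicit Types x l b : R.

Lemma measurable_exp_tail (l b : R) :
  measurable_fun setT (fun z : R => \1_`]b, +oo[ z * expR (- (l * (z - b)))).
Proof.
apply: measurable_funM; first exact: measurable_indic.
apply: measurableT_comp => //; apply: measurableT_comp => //.
by apply: measurable_funM => //; exact: measurable_funB.
Qed.

Lemma exp_tail_bounds (l b : R) : 0 <= l -> forall z : R,
  0 <= \1_`]b, +oo[ z * expR (- (l * (z - b))) <= 1.
Proof.
move=> l0 z; rewrite mulr_ge0 ?expR_ge0//=.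
rewrite indicE; case: (boolP (z \in _)) => [|_]; last by rewrite mul0r.
rewrite inE/= in_itv/= andbT => bz; rewrite mul1r expR_le1 oppr_le0 mulr_ge0// subr_ge0; exact: ltW.
Qed.

Lemma gauss_laplace_le1 (l b : R) : 0 <= l ->
  expR (l * b + l ^+ 2 / 2) * (1 - Phi (b + l)) <= 1.
Proof.
move=> l0; rewrite -lee_fin -gauss_laplace.
apply: (@le_trans _ _ (\int[normal_prob 0 1]_(z in [set: R]) (cst 1 z))%E).
  apply: ge0_le_integral => //.
  - by apply/measurable_EFinP; exact: measurable_exp_tail.
  - by move=> z _; rewrite lee_fin; case/andP: (exp_tail_bounds b l0 z).
by rewrite integral_cst// mul1e; exact: probability_le1.
Qed.

Lemma gauss_tail_le (l : R) : 0 <= l -> 1 - Phi l <= expR (- (l ^+ 2 / 2)).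
Proof.
move=> l0; have := gauss_laplace_le1 0 l0.
rewrite mulr0 !add0r => h; rewrite expRN -[leRHS]mulr1.
by rewrite ler_pdivlMl ?expR_gt0.
Qed.

(** The density is at most one, and the exponential tail has integral [1 / l]. *)
Lemma gauss_laplace_le_inv (l b : R) : 0 < l ->
  expR (l * b + l ^+ 2 / 2) * (1 - Phi (b + l)) <= l^-1.
Proof.
move=> l0; rewrite -lee_fin -gauss_laplace.
rewrite (@ge0_integral_density _ _ _ mu _ phi)//; last 4 first.
- exact: measurable_gauss_density.
- by move=> x; exact: gauss_density_ge0.
- by move=> A mA; rewrite -gauss_densityE.
- exact: measurable_exp_tail.
have cE : continuous (fun z : R => expR (- (l * (z - b)))).
  move=> z; apply: continuous_comp; last exact: continuous_expR.
  apply: (@cvgN _ R^o); apply: (@cvgM R); first exact: cvg_cst.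
  by apply: (@cvgB _ R^o); [exact: cvg_id|exact: cvg_cst].
have mE : measurable_fun setT (fun z : R => expR (- (l * (z - b)))).
  exact: continuous_measurable_fun.
have dE (z : R) : is_derive z 1 (fun z : R => - l^-1 * expR (- (l * (z - b)))) (expR (- (l * (z - b)))).
  have h : is_derive z 1 (fun z : R => - (l * (z - b))) (- l).
    rewrite (_ : (fun z : R => _) = (fun z : R => (- l) *: (z - b))); last first.
      by apply/funext => y; rewrite /GRing.scale/= mulNr.
    by apply: is_derive_eq; rewrite /GRing.scale/= subr0 mulr1.
  have h2 := @is_derive1_comp _ expR (fun z : R => - (l * (z - b))) z _ _ (is_derive_expR _) h.
  have := @is_deriveZ _ _ _ _ (- l^-1) _ _ _ h2.
  move=> h3; apply: is_derive_eq; rewrite /GRing.scale/= mulrCA mulrNN mulVf ?mulr1//.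
  by rewrite gt_eqF.
have -> : (l^-1)%:E = (\int[mu]_(z in `[b, +oo[) (expR (- (l * (z - b))))%:E)%E.
  rewrite (@ge0_continuous_FTC2y R _ (fun z : R => - l^-1 * expR (- (l * (z - b)))) b 0)//.
  - by rewrite subrr mulr0 oppr0 expR0 mulr1 -EFinB sub0r opprK.
  - by apply: continuous_subspaceT.
  - rewrite -[X in _ --> X](mulr0 (- l^-1)); apply: cvgM; first exact: cvg_cst.
    apply: (@cvg_comp _ _ _ (fun z => l * (z - b)) (fun y => expR (- y)) _ +oo).
      apply: gt0_cvgMry => //; exact: cvg_addrr.
    exact: cvgr_expR.
  - by apply: cvg_at_right_filter; exact: (is_derive_continuous dE).
  - by move=> x _; rewrite derive1E; have [] := dE x.
rewrite [leRHS]integral_mkcond; apply: ge0_le_integral => //.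
- by move=> z _; rewrite lee_fin mulr_ge0 ?gauss_density_ge0// mulr_ge0// expR_ge0.
- apply/measurable_EFinP; apply: measurable_funM; first exact: measurable_exp_tail.
  exact: measurable_gauss_density.
- apply/(measurable_restrictT _ _).1 => //.
  by apply: measurable_funTS; apply/measurable_EFinP.
- move=> z _; rewrite patchE indicE.
  have p1 : phi z <= 1 by have := gauss_density_le_half z; lra.
  case: (boolP (z \in `]b, +oo[%classic)) => [|_].
    rewrite inE/= in_itv/= andbT => bz; rewrite mem_set/= ?in_itv/= ?andbT ?(ltW bz)//.
    by rewrite lee_fin mul1r ler_piMr// expR_ge0.
  by rewrite !mul0r; case: ifP => _ //; rewrite lee_fin expR_ge0.
Qed.

Lemma inv_sqrt_2pi_ge : 3^-1 <= (Num.sqrt (2 * pi))^-1 :> R.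
Proof.
have s0 := sqrt_2pi_ge2 R.
rewrite lef_pV2 ?posrE//; last lra.
rewrite -[X in _ <= X](@ger0_norm _ 3)// -sqrtr_sqr ler_sqrt ?sqr_ge0//.
by have := pihalf_lt2 R; rewrite expr2; lra.
Qed.

(** The factor 3 is for [1 / sqrt (2 pi) >= 1 / 3] and the exponent [3 / 2]
    for [(x + h)^2 <= x^2 + 3], where [h = 1 / (1 + x)]. *)
Definition mills_constant : R := 3 * expR (3 / 2).
Notation Cm := mills_constant.

Lemma mills_constant_gt0 : 0 < Cm.
Proof. by rewrite mulr_gt0// expR_gt0. Qed.

(** Keep the mass of the interval of length [1 / (1 + x)] that starts at [x]. *)
Lemma mills_lower (x : R) : 0 <= x -> expR (- (x ^+ 2 / 2)) <= Cm * (1 + x) * (1 - Phi x).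
Proof.
move=> x0; have x1 : 0 < 1 + x by lra.
pose h := (1 + x)^-1; have h0 : 0 < h by rewrite invr_gt0.
have h1 : h <= 1 by rewrite /h invf_le1//; lra.
have xh : x * h <= 1 by rewrite /h ler_pdivrMr//; lra.
have [c] := @MVT_segment R Phi phi x (x + h) (ltac:(lra)) (fun x _ => is_derive_Phi x) (continuous_subspaceT (@continuous_Phi R)).
rewrite in_itv/= => /andP[c1 c2] e.
have {e} e : h * phi c <= 1 - Phi x.
  by have := Phi_le1 (x + h); move: e; rewrite (addrC x) addrK mulrC; lra.
have pc : 3^-1 * expR (- (3 / 2) - x ^+ 2 / 2) <= phi c.
  rewrite /gauss_density ler_pM ?expR_ge0 ?invr_ge0 ?inv_sqrt_2pi_ge// ler_expR.
  have : c ^+ 2 <= (x + h) ^+ 2 by rewrite lerXn2r ?nnegrE; lra.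
  have : h ^+ 2 <= 1 by rewrite expr_le1// ltW.
  by rewrite !expr2; lra.
have E : expR (3 / 2) * expR (- (3 / 2) - x ^+ 2 / 2) = expR (- (x ^+ 2 / 2)) :> R.
  by rewrite -expRD; congr expR; ring.
apply: (@le_trans _ _ (Cm * (1 + x) * (h * phi c))).
  rewrite -E /Cm /h; have -> : 3 * expR (3 / 2) * (1 + x) * ((1 + x)^-1 * phi c) = expR (3 / 2) * (3 * phi c).
    by field; rewrite gt_eqF.
  by rewrite ler_wpM2l ?expR_ge0//; lra.
by rewrite ler_wpM2l// mulr_ge0//; [exact: (ltW mills_constant_gt0)|lra].
Qed.

Lemma Phi_lt1 (x : R) : 0 < 1 - Phi x.
Proof.
have H (y : R) : 0 <= y -> 0 < 1 - Phi y.
  move=> y0; have := mills_lower y0; have := expR_gt0 (- (y ^+ 2 / 2)) => h1 h2.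
  have := lt_le_trans h1 h2; rewrite pmulr_rgt0// mulr_gt0// ?mills_constant_gt0//; lra.
have [/H//|x0] := leP 0 x.
by have := H 0 (lexx _); have := le_Phi (ltW x0); lra.
Qed.

Lemma gauss_density_le_tail (x : R) : 0 <= x -> phi x <= Cm * (1 + x) * (1 - Phi x).
Proof.
move=> x0; apply: le_trans (mills_lower x0).
apply: (le_trans (gauss_density_le_half_exp x)).
by rewrite mulNr ler_piMl ?expR_ge0//; lra.
Qed.

(** By [gauss_density_le_tail] the logarithmic derivative of [1 - Phi] is at
    least [- Cm * (1 + b)] between [a] and [b]. *)
Lemma gauss_tail_ratio (a b : R) : 0 <= a -> a <= b ->
  1 - Phi a <= (1 - Phi b) * expR (Cm * (1 + b) * (b - a)).
Proof.
move=> a0 ab.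
have dl (x : R) : is_derive x 1 (fun x => ln (1 - Phi x)) (- (phi x / (1 - Phi x))).
  have h1 : is_derive x 1 (fun x => 1 - Phi x) (- phi x).
    have h := is_derive_Phi x; apply: is_derive_eq; ring.
  have := @is_derive1_comp _ (@ln R) (fun x => 1 - Phi x) x _ _ (is_derive1_ln (Phi_lt1 x)) h1.
  by move=> h; apply: is_derive_eq; rewrite mulrN mulrC.
have [c] := @MVT_segment R _ _ a b ab (fun x _ => dl x) (continuous_subspaceT (is_derive_continuous dl)).
rewrite in_itv/= => /andP[c1 c2] e.
have c0 : 0 <= c by lra.
have hc : phi c / (1 - Phi c) <= Cm * (1 + b).
  rewrite ler_pdivrMr ?Phi_lt1//; apply: (le_trans (gauss_density_le_tail c0)).
  rewrite ler_wpM2r ?(ltW (Phi_lt1 _))// ler_wpM2l ?(ltW mills_constant_gt0)//; lra.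
rewrite -(lnK (Phi_lt1 a : _ \is Num.pos)) -[X in _ <= X * _](lnK (Phi_lt1 b : _ \is Num.pos)).
rewrite -expRD ler_expR -lerBlDl.
have -> : ln (1 - Phi a) - ln (1 - Phi b) = phi c / (1 - Phi c) * (b - a) by lra.
by rewrite ler_wpM2r// subr_ge0.
Qed.

Lemma Phi_window (t : R) : 0 <= t <= 1 -> t / 6 <= Phi t - Phi 0.
Proof.
move=> /andP[t0 t1].
have [c] := @MVT_segment R Phi phi 0 t t0 (fun x _ => is_derive_Phi x) (continuous_subspaceT (@continuous_Phi R)).
rewrite in_itv/= => /andP[c1 c2] ->; rewrite subr0 mulrC ler_wpM2r//.
have : 3^-1 * 2^-1 <= phi c; last lra.
rewrite /gauss_density ler_pM ?inv_sqrt_2pi_ge//.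
apply: le_trans (expR_ge1Dx _).
have : c ^+ 2 <= 1 by rewrite expr_le1//; lra.
lra.
Qed.

End gauss_tail.

(** * Expectations of random variables *)

Section measurable_wrt_closure.
Context (d : measure_display) (T : measurableType d) (R : realType).
Variable G : set (set T).
Implicit Types f g : T -> R.
Notation mw := (measurable_wrt G).

Lemma mw_cst (c : R) : mw (fun _ => c).
Proof. exact: (@measurable_cst _ _ (g_sigma_algebraType G)). Qed.

Lemma mwD f g : mw f -> mw g -> mw (fun w => f w + g w).
Proof. exact: (@measurable_funD _ (g_sigma_algebraType G)). Qed.

Lemma mwB f g : mw f -> mw g -> mw (fun w => f w - g w).
Proof. exact: (@measurable_funB _ (g_sigma_algebraType G)). Qed.

Lemma mwM f g : mw f -> mw g -> mw (fun w => f w * g w).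
Proof. exact: (@measurable_funM _ (g_sigma_algebraType G)). Qed.

Lemma mwX f k : mw f -> mw (fun w => f w ^+ k).
Proof. exact: (@measurable_funX _ (g_sigma_algebraType G)). Qed.

Lemma mw_comp (h : R -> R) f : measurable_fun setT h -> mw f -> mw (fun w => h (f w)).
Proof. by move=> mh mf; apply: (measurableT_comp mh). Qed.

Lemma mwN f : mw f -> mw (fun w => - f w).
Proof. by apply: mw_comp; exact: oppr_measurable. Qed.

Lemma mw_norm f : mw f -> mw (fun w => `|f w|).
Proof. by apply: mw_comp; exact: normr_measurable. Qed.

Lemma mw_sqrt f : mw f -> mw (fun w => Num.sqrt (f w)).
Proof.
by apply: mw_comp; apply: continuous_measurable_fun; exact: sqrt_continuous.
Qed.

Lemma mwV f : mw f -> (forall w, 0 < f w) -> mw (fun w => (f w)^-1).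
Proof.
move=> mf f0; rewrite (_ : (fun w => _) = (fun w => f w `^ (-1))).
  exact: (mw_comp (measurable_powR (-1)) mf).
by apply/funext => w; rewrite powR_inv1// ltW.
Qed.

Lemma mw_max f g : mw f -> mw g -> mw (fun w => Num.max (f w) (g w)).
Proof. exact: (@measurable_maxr _ (g_sigma_algebraType G)). Qed.

Lemma mw_min f g : mw f -> mw g -> mw (fun w => Num.min (f w) (g w)).
Proof. exact: (@measurable_minr _ (g_sigma_algebraType G)). Qed.

Lemma mw_sum n (f : 'I_n -> T -> R) : (forall i, mw (f i)) ->
  mw (fun w => \sum_(i < n) f i w).
Proof.
by move=> mf; apply: (@measurable_sum _ (g_sigma_algebraType G)) => i; exact: mf.
Qed.

Lemma mw_prod n (f : 'I_n -> T -> R) : (forall i, mw (f i)) ->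
  mw (fun w => \prod_(i < n) f i w).
Proof.
by move=> mf; apply: (@measurable_prod _ (g_sigma_algebraType G)) => i _; exact: mf.
Qed.

End measurable_wrt_closure.

Section expectation.
Context (d : measure_display) (T : measurableType d) (R : realType).
Variable P : probability T R.
Implicit Types f g : T -> R.
Notation integ h := (P.-integrable setT (EFin \o h)).
Notation E f := (\int[P]_w f w).

Lemma Exp_le f g : integ f -> integ g -> (forall w, f w <= g w) -> E f <= E g.
Proof. by move=> *; apply: le_Rintegral. Qed.

Lemma Exp_cst (c : R) : E (fun _ => c) = c.
Proof.
rewrite Rintegral_cst//.
have -> : fine (P setT) = 1 by rewrite probability_setT.
by rewrite mulr1.
Qed.

Lemma Exp_EFin f : integ f -> (E f)%:E = (\int[P]_w (f w)%:E)%E.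
Proof. by move=> i; rewrite /Rintegral fineK//; exact: integrable_fin_num. Qed.

Lemma Exp_le_ae f g : integ f -> integ g -> {ae P, forall w, f w <= g w} -> E f <= E g.
Proof.
move=> i1 i2 fg; have m1 := integ_measurable i1; have m2 := integ_measurable i2.
pose h w := Num.min (f w) (g w).
have mh : measurable_fun setT h by exact: measurable_minr.
have ih : integ h.
  apply: (integ_le mh (integD (integrable_norm i1) (integrable_norm i2))) => w /=.
  have := normr_ge0 (f w); have := normr_ge0 (g w).
  by rewrite /h; case: (leP (f w) (g w)) => _; lra.
have -> : E f = E h.
  congr fine; apply: ae_eq_integral => //; [exact/measurable_EFinP|exact/measurable_EFinP|].
  by apply: filterS fg => w /= fgw _; rewrite /h min_l.
by apply: Exp_le => // w; rewrite /h ge_min lexx orbT.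
Qed.

Lemma Exp_sum n (f : 'I_n -> T -> R) : (forall i, integ (f i)) ->
  integ (fun w => \sum_(i < n) f i w) /\
  E (fun w => \sum_(i < n) f i w) = \sum_(i < n) E (f i).
Proof.
elim: n f => [|n IH] f fi.
  rewrite big_ord0 (_ : (fun w => _) = fun _ => 0); last by apply/funext => w; rewrite big_ord0.
  by rewrite Exp_cst; split => //; exact: integ_cst.
have [i1 e1] := IH (fun i => f (widen_ord (leqnSn n) i)) (fun i => fi _).
rewrite (_ : (fun w => _) = fun w => \sum_(i < n) f (widen_ord (leqnSn n) i) w + f ord_max w); last first.
  by apply/funext => w; rewrite big_ord_recr.
rewrite RintegralD// e1 big_ord_recr/=; split => //; exact: integD.
Qed.

Lemma Exp_indic (A : set T) : measurable A -> E (fun w => \1_A w) = fine (P A).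
Proof. by move=> mA; rewrite /Rintegral integral_indic// setIT. Qed.

Lemma integ_indic (A : set T) : measurable A -> integ (\1_A : T -> R).
Proof.
move=> mA; apply: (@integ_bounded _ _ _ _ _ 1); first exact: measurable_indic.
by move=> w; rewrite indicE ger0_norm// lern1 leq_b1.
Qed.

Lemma cge0_Exp (G : set (set T)) f : sigma_algebra setT G -> cge0 P G f -> 0 <= E f.
Proof.
move=> sG [_ f0]; rewrite /Rintegral fine_ge0// f0//.
by case: sG => G0 GC _; rewrite -(setD0 setT); exact: GC.
Qed.

End expectation.

(** * Third-order inequalities for one step *)

Section step_inequalities.
Context (R : realType).
Notation Phi := (@std_normal_cdf R).
Notation phi := (@gauss_density R).
Implicit Types r s t z eta v e om : R.

(** Let the time lose [v] while [z] moves by [eta]. The function [(2 t +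
    z^2)^(-1/2)] is a strict subsolution of the backward heat equation: the
    second-order terms in its increment add up to at least [v / (2 r^3)]. Half
    of this pays for the Taylor errors. *)
Lemma inv_norm_step r r0 r1 t z eta v e om G :
  0 < t -> 0 < r -> 0 < r0 -> 0 < r1 ->
  r ^+ 2 = 2 * t + z ^+ 2 -> r1 ^+ 2 = 2 * t + (z - eta) ^+ 2 ->
  r0 ^+ 2 = 2 * (t + v) + z ^+ 2 ->
  0 <= v <= e ^+ 2 -> 0 <= e -> 200 * e <= r -> 0 <= om <= 16^-1 ->
  G = (3 * z ^+ 2 / r ^+ 5 - (r ^+ 3)^-1) / 2 ->
  z / r ^+ 3 * eta + G * (eta ^+ 2 - v) + om * `|G| * v +
    12 / r ^+ 4 * (e * v - `|eta| ^+ 3) <= r1^-1 - r0^-1 - v / r ^+ 3 / 4.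
Proof.
move=> t0 rp r0p r1p rE r1E r0E vv e0 er omm GE.
have /andP[v0 ve] := vv; have /andP[om0 om1] := omm.
have h1 := inv_norm_space_taylor t0 rp r1p rE r1E.
have h0 := inv_norm_time_taylor v0 rp r0p rE r0E.
have rn : r != 0 by rewrite gt_eqF.
set X := (r ^+ 3)^-1.
have X0 : 0 <= X by rewrite invr_ge0 exprn_ge0// ltW.
have er' : e / r <= 200^-1 by rewrite ler_pdivrMr//; lra.
have er0 : 0 <= e / r by rewrite divr_ge0// ltW.
have Gl : - (X / 2) <= G.
  have : 0 <= 3 * z ^+ 2 / r ^+ 5.
    by apply: divr_ge0; [rewrite mulr_ge0 ?sqr_ge0|rewrite exprn_ge0// ltW].
  by rewrite GE -/X; lra.
have Gu : G <= X.
  have : 3 * z ^+ 2 / r ^+ 5 <= 3 * X.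
    rewrite /X ler_pdivrMr ?exprn_gt0// (_ : 3 * _ * _ = 3 * r ^+ 2); last by field.
    by rewrite rE; lra.
  by rewrite GE -/X; lra.
have Ga : `|G| <= X by rewrite ler_norml; lra.
have k1 : 12 / r ^+ 4 * (e * v) <= 12 / 200 * (v * X).
  rewrite (_ : 12 / r ^+ 4 * (e * v) = 12 * (e / r) * (v * X)); last by rewrite /X; field.
  by rewrite ler_wpM2r ?mulr_ge0//; lra.
have k2 : 2 * (v ^+ 2 / r ^+ 5) <= 1 / 100 * (v * X).
  rewrite (_ : v ^+ 2 / r ^+ 5 = v / r ^+ 2 * (v * X)); last by rewrite /X; field.
  rewrite mulrA ler_wpM2r ?mulr_ge0//.
  have : v / r ^+ 2 <= (e / r) ^+ 2 by rewrite expr_div_n ler_pM2r// invr_gt0 exprn_gt0.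
  have : (e / r) ^+ 2 <= 200^-1 by rewrite expr2; apply: le_trans (_ : 200^-1 * 1 <= _); [rewrite ler_pM//; lra|lra].
  lra.
have k3 : om * `|G| * v <= 16^-1 * (v * X).
  rewrite -mulrA ler_pM ?mulr_ge0//.
  by rewrite mulrC ler_wpM2l.
have k4 : - (G * v) <= 2^-1 * (v * X).
  have : - G * v <= X / 2 * v by rewrite ler_wpM2r//; lra.
  lra.
have vX : 0 <= v * X by rewrite mulr_ge0.
rewrite -/X -GE in h1 h0 *.
have e1 : z / r ^+ 3 * eta = eta * (z / r ^+ 3) by rewrite mulrC.
have e2 : G * (eta ^+ 2 - v) = eta ^+ 2 * G - G * v by ring.
have e3 : 12 / r ^+ 4 * (e * v - `|eta| ^+ 3) = 12 / r ^+ 4 * (e * v) - 12 * (`|eta| ^+ 3 / r ^+ 4) by field.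
rewrite e1 e2 e3; move: h1 h0 k1 k2 k3 k4 vX; rewrite -/X.
set q1 := eta * _; set q2 := eta ^+ 2 * G; set q3 := 12 * _; set q4 := 12 / _ * _; set q5 := 2 * _; set q6 := om * _ * v; set q7 := G * v; set q8 := v * X.
clearbody q1 q2 q3 q4 q5 q6 q7 q8; clear; lra.
Qed.

(** [Phi (z / sqrt t)] solves the backward heat equation, so that its
    second-order terms cancel; the cubic term and the defect [om] of the
    variance are left. *)
Lemma Phi_step r s s' z eta v e om :
  0 < s -> 0 < r -> 0 < s' -> r ^+ 2 = 2 * s ^+ 2 + z ^+ 2 -> s' ^+ 2 = s ^+ 2 + v ->
  0 <= v <= e ^+ 2 -> 0 <= e -> 200 * e <= s -> 0 <= om ->
  let H := - (phi (z / s) / s) in let G := - (z / s * phi (z / s) / (2 * s ^+ 2)) in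
  let D := Phi ((z - eta) / s) - Phi (z / s') in
  let E := 1200 * e * (v / r ^+ 3) + 4 * om * (v / r ^+ 2) in
  let h H G := H * eta + G * (eta ^+ 2 - v) + om * `|G| * v +
    1000 / r ^+ 3 * (e * v - `|eta| ^+ 3) in
  (h H G <= D + E /\ h (- H) (- G) <= - D + E) /\ (`|H| <= s^-1 /\ `|G| <= 4 / r ^+ 2).
Proof.
move=> s0 r0 s'0 rE s'E /andP[v0 ve] e0 es om0 H G D E h.
have s0' := ltW s0; have r0' := ltW r0.
have sn : s != 0 by rewrite gt_eqF.
have rn : r != 0 by rewrite gt_eqF.
set w := z / s in H G *.
have rhoE : (r / s) ^+ 2 = 2 + w ^+ 2.
  by rewrite /w !expr_div_n rE mulrDl mulfK ?expf_neq0.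
have rho0 : 0 < r / s by rewrite divr_gt0.
have h1 := Phi_space_taylor (eta / s) rho0 rhoE.
have s2 : 0 < s ^+ 2 by rewrite exprn_gt0.
have vs : v <= s ^+ 2.
  apply: (le_trans ve); rewrite lerXn2r ?nnegrE//; move: es s0' e0; clear; lra.
have tau01 : 0 <= v / s ^+ 2 <= 1 by rewrite divr_ge0 ?(ltW s2)//= ler_pdivrMr// mul1r.
have b0 : 0 < s / s' by rewrite divr_gt0.
have bE : (s / s') ^+ 2 * (1 + v / s ^+ 2) = 1.
  rewrite expr_div_n s'E; field; rewrite sn/= gt_eqF//.
  by rewrite ltr_wpDr.
have h2 := Phi_time_taylor rho0 rhoE tau01 b0 bE.
have wE : w * (s / s') = z / s' by rewrite /w mulrA divfK.
rewrite wE in h2.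
have wk : w - eta / s = (z - eta) / s by rewrite /w mulrBl.
rewrite wk in h1.
have pw := gauss_density_ge0 w.
have wp : `|w| * phi w * (r / s) ^+ 2 <= 8.
  have := @gauss_density_decay R 1 w; rewrite -rhoE => dec.
  apply: le_trans (_ : (r / s) ^+ 2 ^+ 2 * phi w <= _); last by move: dec; clear; lra.
  rewrite mulrAC ler_wpM2r// [leRHS]expr2 ler_wpM2r ?sqr_ge0// rhoE.
  by have := norm_le_sqr w; clear; lra.
have Gle : `|G| <= 4 / r ^+ 2.
  rewrite /G normrN normrM normrM (ger0_norm pw) (@ger0_norm _ _^-1) ?invr_ge0 ?mulr_ge0 ?sqr_ge0//.
  rewrite ler_pdivlMr ?exprn_gt0//.
  move: wp; set A := `|w| * phi w => wp.
  rewrite (_ : _ * _ = A * (r / s) ^+ 2 / 2); last by field.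
  clearbody A; move: wp; clear; lra.
have Hle : `|H| <= s^-1.
  rewrite /H normrN normrM (ger0_norm pw) (@ger0_norm _ _^-1) ?invr_ge0 ?(ltW s0)//.
  by rewrite ler_piMl ?invr_ge0//; have := gauss_density_le_half w; clear; lra.
split=> //.
have er : e / r <= 200^-1.
  rewrite ler_pdivrMr//; apply: le_trans (_ : s / 200 <= _); first by move: es; clear; lra.
  rewrite mulrC ler_wpM2l//.
  rewrite -(ler_pXn2r (isT : (0 < 2)%N)) ?nnegrE ?(ltW s0) ?(ltW r0)// rE.
  by have := sqr_ge0 z; have := sqr_ge0 s; clear; lra.
have R2 : 4 * 100 ^+ 2 * ((v / s ^+ 2) ^+ 2 / (r / s) ^+ 4) <= 200 * e * (v / r ^+ 3).
  rewrite (_ : (v / s ^+ 2) ^+ 2 / (r / s) ^+ 4 = v / r * (v / r ^+ 3)); last by field; rewrite sn rn.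
  have vr : 0 <= v / r ^+ 3 by rewrite divr_ge0// exprn_ge0// ltW.
  rewrite mulrA ler_wpM2r//.
  have : v / r <= e * 200^-1.
    apply: le_trans (_ : e * (e / r) <= _); last by rewrite ler_wpM2l.
    by rewrite mulrA -expr2 ler_wpM2r// invr_ge0 ltW.
  clear; lra.
have R1 : 1000 * (`|eta / s| / (r / s)) ^+ 3 = 1000 / r ^+ 3 * `|eta| ^+ 3.
  rewrite normrM (@ger0_norm _ s^-1) ?invr_ge0 ?(ltW s0)//; field; rewrite sn rn//.
have G1 : om * `|G| * v <= 4 * om * (v / r ^+ 2).
  rewrite (_ : 4 * om * _ = om * (4 / r ^+ 2) * v); last by field.
  by rewrite ler_wpM2r// ler_wpM2l.
rewrite R1 in h1; move: h1 h2; rewrite !ler_norml => /andP[a1 a2] /andP[b1 b2].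
have e1 : eta / s * phi w = - (H * eta) by rewrite /H; field.
have e2 : (eta / s) ^+ 2 / 2 * (w * phi w) = - (G * eta ^+ 2) by rewrite /G; field.
have e3 : v / s ^+ 2 / 2 * (w * phi w) = - (G * v) by rewrite /G; field.
rewrite e1 e2 in a1 a2; rewrite e3 in b1 b2.
have e4 : 1000 / r ^+ 3 * (e * v - `|eta| ^+ 3) = 1000 * e * (v / r ^+ 3) - 1000 / r ^+ 3 * `|eta| ^+ 3 by field.
clearbody H G; rewrite /h e4 /E /D normrN.
move: R2 a1 a2 b1 b2 G1; set q1 := 1000 / _ * _; set q2 := 4 * 100 ^+ 2 * _; set q3 := om * _ * v; set q4 := 4 * om * _.
rewrite !mulrBr !mulNr; set q5 := H * eta; set q6 := G * eta ^+ 2; set q7 := G * v.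
set q8 := v / _.
clearbody q1 q2 q3 q4 q5 q6 q7 q8; clear => ? ? ? ? ? ?; split; lra.
Qed.
End step_inequalities.

(** * Lindeberg sums along a martingale *)

Lemma norm_le_sum_ge0 (R : realType) (p q : R) :
  0 <= - p + q -> 0 <= p + q -> `|p| <= q.
Proof. by move=> h1 h2; rewrite ler_norml; apply/andP; split; lra. Qed.

Lemma lerD_shuffle (R : realType) (a b c c' x y : R) :
  x <= b + c' -> y <= a + c -> x + y <= a + b + (c + c').
Proof. lra. Qed.

Definition partial (T : Type) (R : realType) (x : nat -> T -> R) k w : R :=
  \sum_(i < k) x i w.

Lemma partialS (T : Type) (R : realType) (x : nat -> T -> R) k w :
  partial x k.+1 w = partial x k w + x k w.
Proof. by rewrite /partial big_ord_recr. Qed.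

(** Martingale differences [eta] whose conditional variance is [v] up to a
    factor [1 + om] or [1 - om] and whose conditional third absolute moment is
    at most [e * v]. *)
Record small_step_martingale (d : measure_display) (T : measurableType d)
  (R : realType) (Q : probability T R) (F : nat -> set (set T))
  (eta v : nat -> T -> R) (e om B : R) : Prop := SmallStepMartingale {
  ssm_sigma : forall i, sigma_algebra [set: T] (F i) ;
  ssm_sub : forall i, F i `<=` measurable ;
  ssm_mono : forall i, F i `<=` F i.+1 ;
  ssm_adapted : forall i, measurable_wrt (F i.+1) (eta i) ;
  ssm_predictable : forall i, measurable_wrt (F i) (v i) ;
  ssm_e : 0 <= e ;
  ssm_om : 0 <= om <= 16^-1 ;
  ssm_v : forall i w, 0 <= v i w <= e ^+ 2 ;
  ssm_mean_ge : forall i, cge0 Q (F i) (eta i) ;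
  ssm_mean_le : forall i, cge0 Q (F i) (fun w => - eta i w) ;
  ssm_var_le : forall i,
    cge0 Q (F i) (fun w => (1 + om) * v i w - eta i w ^+ 2) ;
  ssm_var_ge : forall i,
    cge0 Q (F i) (fun w => eta i w ^+ 2 - (1 - om) * v i w) ;
  ssm_cube : forall i,
    cge0 Q (F i) (fun w => e * v i w - `|eta i w| ^+ 3) ;
  ssm_total : forall k w, partial v k w <= B }.

Section lindeberg.
Context (d : measure_display) (T : measurableType d) (R : realType).
Variables (Q : probability T R) (F : nat -> set (set T)).
Variables (eta v : nat -> T -> R) (e om B : R).
Notation Phi := (@std_normal_cdf R).
Notation phi := (@gauss_density R).
Notation integ h := (Q.-integrable setT (EFin \o h)).
Notation Exp f := (\int[Q]_w f w).
Notation S := (partial v).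
Notation Y := (partial eta).

Hypothesis ssm : small_step_martingale Q F eta v e om B.
Let sF := ssm_sigma ssm.
Let FM := ssm_sub ssm.
Let F_le := ssm_mono ssm.
Let meta := ssm_adapted ssm.
Let mv := ssm_predictable ssm.
Let e0 := ssm_e ssm.
Let om01 := ssm_om ssm.
Let v01 := ssm_v ssm.
Let eta_mean := ssm_mean_ge ssm.
Let eta_mean' := ssm_mean_le ssm.
Let eta_var_le := ssm_var_le ssm.
Let eta_var_ge := ssm_var_ge ssm.
Let eta_cube := ssm_cube ssm.
Let S_le := ssm_total ssm.

Let mw_le i j (f : T -> R) : (i <= j)%N ->
  measurable_wrt (F i) f -> measurable_wrt (F j) f.
Proof. exact: measurable_wrt_le. Qed.

Lemma measurable_Y k : measurable_wrt (F k) (Y k).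
Proof. by apply: mw_sum => i; apply: (@mw_le i.+1 k (eta i)) => //; exact: meta. Qed.

Lemma measurable_S k : measurable_wrt (F k) (S k.+1).
Proof. by apply: mw_sum => i; apply: (@mw_le i k (v i)); [rewrite -ltnS|exact: mv]. Qed.

Lemma measurableT_wrt k (f : T -> R) : measurable_wrt (F k) f -> measurable_fun setT f.
Proof. exact: measurable_wrt_sub. Qed.

(** Remaining variance, with [a] the variance of the final smoothing. *)
Definition rem_var (a : R) k w := a + B - S k w.
Notation A := rem_var.

Lemma rem_var_ge a k w : a <= A a k w.
Proof. by rewrite /A -addrA ler_wpDr// subr_ge0. Qed.

Lemma rem_varS a k w : A a k w = A a k.+1 w + v k w.
Proof. by rewrite /A partialS; ring. Qed.

Lemma measurable_rem_var a k : measurable_wrt (F k) (A a k.+1).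
Proof. by apply: mwB; [exact: mw_cst|exact: measurable_S]. Qed.

Lemma measurable_rem_varT a k : measurable_fun setT (A a k).
Proof.
case: k => [|k]; last exact: (@measurableT_wrt k _ (@measurable_rem_var a k)).
rewrite (_ : A a 0 = fun=> a + B); first exact: measurable_cst.
by apply/funext => w; rewrite /A /partial big_ord0 subr0.
Qed.

(** A coefficient of either sign on [eta] or on [eta^2 - v] is split into its
    two parts, so that both halves of each two-sided hypothesis serve; the
    defect [om] of the variance is paid by [om * |G| * v]. *)
Lemma cge0_quadratic k (H G N : T -> R) (M : R) :
  measurable_wrt (F k) H -> measurable_wrt (F k) G -> measurable_wrt (F k) N ->
  (forall w, `|H w| <= M) -> (forall w, `|G w| <= M) -> (forall w, 0 <= N w <= M) ->
  cge0 Q (F k) (fun w => H w * eta k w + G w * (eta k w ^+ 2 - v k w) +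
    om * `|G w| * v k w + N w * (e * v k w - `|eta k w| ^+ 3)).
Proof.
move=> mH mG mN HM GM NM.
pose pos (f : T -> R) w := Num.max (f w) 0.
pose neg (f : T -> R) w := Num.max (- f w) 0.
have mp f : measurable_wrt (F k) f -> measurable_wrt (F k) (pos f).
  by move=> mf; apply: mw_max => //; exact: mw_cst.
have mn f : measurable_wrt (F k) f -> measurable_wrt (F k) (neg f).
  by move=> mf; apply: mw_max; [exact: mwN|exact: mw_cst].
have bp f w : `|f w| <= M -> 0 <= pos f w <= M.
  by rewrite ler_norml /pos => /andP[? ?]; case: (leP (f w) 0) => ?; lra.
have bn f w : `|f w| <= M -> 0 <= neg f w <= M.
  by rewrite ler_norml /neg => /andP[? ?]; case: (leP (- f w) 0) => ?; lra.
have fE f w : f w = pos f w - neg f w.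
  by rewrite /pos /neg; case: (leP (f w) 0) => ?; case: (leP (- f w) 0) => ?; lra.
have aE f w : `|f w| = pos f w + neg f w.
  rewrite /pos /neg; case: (leP (f w) 0) => h1; case: (leP (- f w) 0) => h2; try lra.
  - by rewrite ler0_norm//; lra.
  - by rewrite ler0_norm//; lra.
  - by rewrite gtr0_norm//; lra.
rewrite (_ : (fun w => _) = fun w => pos H w * eta k w + neg H w * (- eta k w) +
   (pos G w * (eta k w ^+ 2 - (1 - om) * v k w) + neg G w * ((1 + om) * v k w - eta k w ^+ 2)) + N w * (e * v k w - `|eta k w| ^+ 3)); last first.
  apply/funext => w; rewrite (aE G) [in G w * _](fE G) {1}(fE H); ring.
have cm f h : cge0 Q (F k) h -> measurable_wrt (F k) f -> (forall w, 0 <= f w <= M) ->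
    cge0 Q (F k) (fun w => f w * h w).
  by move=> ch mf bf; apply: (@cge0_mul_bounded _ _ _ _ _ (sF k) (@FM k) M).
apply: (cge0D (@FM k)); [apply: (cge0D (@FM k)); apply: (cge0D (@FM k))|]; apply: cm => //.
- exact: mp.
- by move=> w; exact: bp.
- exact: mn.
- by move=> w; exact: bn.
- exact: mp.
- by move=> w; exact: bp.
- exact: mn.
- by move=> w; exact: bn.
Qed.

Variables (a y : R).
Hypothesis a0 : 0 < a.
Hypothesis ea : 200 * e <= Num.sqrt a.

Let z k w := y - Y k w.
(** The parabolic distance to the origin from time [A (k + 1)] and position [z
    k]: the time after the next step is already known before that step is
    made. *)
Definition pdist k w := Num.sqrt (2 * A a k.+1 w + z k w ^+ 2).
Definition inv_norm k w := (Num.sqrt (2 * A a k w + z k w ^+ 2))^-1.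
Definition smooth_cdf k w := Phi (z k w / Num.sqrt (A a k w)).

Let A_gt0 k w : 0 < A a k w. Proof. exact: lt_le_trans a0 (rem_var_ge _ _ _). Qed.
Let z2_ge0 k w : 0 <= z k w ^+ 2. Proof. exact: sqr_ge0. Qed.
Let sa_gt0 : 0 < Num.sqrt a. Proof. by rewrite sqrtr_gt0. Qed.

Lemma pdist_gt0 k w : 0 < pdist k w.
Proof. by rewrite sqrtr_gt0; have := A_gt0 k.+1 w; have := z2_ge0 k w; lra. Qed.

Lemma pdistE k w : pdist k w ^+ 2 = 2 * A a k.+1 w + z k w ^+ 2.
Proof. by rewrite sqr_sqrtr//; have := A_gt0 k.+1 w; have := z2_ge0 k w; lra. Qed.

Lemma sqrt_le_pdist k w : Num.sqrt a <= pdist k w.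
Proof.
rewrite ler_sqrt; first by have := rem_var_ge a k.+1 w; have := A_gt0 k.+1 w; have := z2_ge0 k w; lra.
by have := A_gt0 k.+1 w; have := z2_ge0 k w; rewrite ?nnegrE; lra.
Qed.

Lemma measurable_z k : measurable_wrt (F k) (z k).
Proof. by apply: mwB; [exact: mw_cst|exact: measurable_Y]. Qed.

Lemma measurable_pdist k : measurable_wrt (F k) (pdist k).
Proof.
apply: mw_sqrt; apply: mwD.
  by apply: mwM; [exact: mw_cst|exact: measurable_rem_var].
by apply: mwX; exact: measurable_z.
Qed.

Lemma measurable_inv_norm k : measurable_fun setT (inv_norm k).
Proof.
apply: (@measurable_wrt_sub _ _ _ measurable) => //.
apply: mwV; last first.
  by move=> w; rewrite sqrtr_gt0; have := A_gt0 k w; have := z2_ge0 k w; lra.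
apply: mw_sqrt; apply: mwD.
  apply: mwM; first exact: mw_cst.
  by apply: measurable_wrt_measurable; exact: measurable_rem_varT.
by apply: mwX; apply: measurable_wrt_measurable; exact: (@measurableT_wrt k _ (@measurable_z k)).
Qed.

Lemma measurable_smooth_cdf k : measurable_fun setT (smooth_cdf k).
Proof.
apply: (@measurable_wrt_sub _ _ _ measurable) => //.
apply: mw_comp; first by apply: continuous_measurable_fun; exact: continuous_Phi.
apply: mwM.
  by apply: measurable_wrt_measurable; exact: (@measurableT_wrt k _ (@measurable_z k)).
apply: mwV; last by move=> w; rewrite sqrtr_gt0.
by apply: mw_sqrt; apply: measurable_wrt_measurable; exact: measurable_rem_varT.
Qed.

Lemma inv_norm_bound k w : `|inv_norm k w| <= (Num.sqrt a)^-1.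
Proof.
have h : 0 < Num.sqrt (2 * A a k w + z k w ^+ 2).
  by rewrite sqrtr_gt0; have := A_gt0 k w; have := z2_ge0 k w; lra.
rewrite ger0_norm ?invr_ge0 ?(ltW h)// lef_pV2 ?posrE//.
rewrite ler_sqrt; first by have := rem_var_ge a k w; have := A_gt0 k w; have := z2_ge0 k w; lra.
by have := A_gt0 k w; have := z2_ge0 k w; rewrite ?nnegrE; lra.
Qed.

Lemma integ_inv_norm k : integ (inv_norm k).
Proof. exact: integ_bounded (measurable_inv_norm k) (inv_norm_bound k). Qed.

Lemma integ_smooth_cdf k : integ (smooth_cdf k).
Proof.
apply: (@integ_bounded _ _ _ _ _ 1); first exact: measurable_smooth_cdf.
by move=> w; rewrite ger0_norm ?Phi_ge0 ?Phi_le1.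
Qed.

Lemma inv_pdist_bound k m w : 0 <= (pdist k w ^+ m)^-1 <= ((Num.sqrt a)^-1) ^+ m.
Proof.
have p0 := pdist_gt0 k w.
rewrite invr_ge0 exprn_ge0 ?(ltW p0)//= -exprVn lerXn2r ?nnegrE ?invr_ge0 ?(ltW p0)//.
by rewrite lef_pV2 ?posrE// sqrt_le_pdist.
Qed.

Lemma measurable_inv_pdist k m : measurable_wrt (F k) (fun w => (pdist k w ^+ m)^-1).
Proof.
apply: mwV; last by move=> w; rewrite exprn_gt0// pdist_gt0.
by apply: mwX; exact: measurable_pdist.
Qed.

Lemma integ_v_pdist k m : integ (fun w => v k w / pdist k w ^+ m).
Proof.
apply: (@integ_bounded _ _ _ _ _ (e ^+ 2 * ((Num.sqrt a)^-1) ^+ m)).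
  by apply: measurableT_wrt; apply: mwM; [exact: mv|exact: measurable_inv_pdist].
move=> w; have /andP[i0 i1] := inv_pdist_bound k m w; have /andP[w0 w1] := v01 k w.
by rewrite ger0_norm ?mulr_ge0// ler_pM.
Qed.

Lemma inv_norm_drift k :
  Exp (fun w => v k w / pdist k w ^+ 3) <= 4 * (Exp (inv_norm k.+1) - Exp (inv_norm k)).
Proof.
pose G w := (3 * z k w ^+ 2 / pdist k w ^+ 5 - (pdist k w ^+ 3)^-1) / 2.
have mG : measurable_wrt (F k) G.
  apply: mwM; last exact: mw_cst; apply: mwB; last exact: measurable_inv_pdist.
  apply: mwM; last exact: measurable_inv_pdist.
  by apply: mwM; [exact: mw_cst|apply: mwX; exact: measurable_z].
have mH : measurable_wrt (F k) (fun w => z k w / pdist k w ^+ 3).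
  by apply: mwM; [exact: measurable_z|exact: measurable_inv_pdist].
have mN : measurable_wrt (F k) (fun w => 12 / pdist k w ^+ 4).
  by apply: mwM; [exact: mw_cst|exact: measurable_inv_pdist].
set b := (Num.sqrt a)^-1.
have b0 : 0 <= b by rewrite invr_ge0 ltW.
pose M := b ^+ 2 + 3 * b ^+ 3 + 12 * b ^+ 4.
have b2 : 0 <= b ^+ 2 by rewrite exprn_ge0.
have b3 : 0 <= b ^+ 3 by rewrite exprn_ge0.
have b4 : 0 <= b ^+ 4 by rewrite exprn_ge0.
have HM w : `|z k w / pdist k w ^+ 3| <= M.
  have p0 := pdist_gt0 k w.
  have := inv_pdist_bound k 2 w; rewrite -/b => /andP[i0 i1].
  have zp : `|z k w| <= pdist k w.
    rewrite -(ler_pXn2r (isT : (0 < 2)%N)) ?nnegrE ?(ltW p0)// sqr_normr pdistE.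
    by have := A_gt0 k.+1 w; lra.
  rewrite normrM normfV (@ger0_norm _ (_ ^+ 3)) ?exprn_ge0 ?(ltW p0)//.
  apply: (@le_trans _ _ (pdist k w ^+ 2)^-1).
    rewrite ler_pdivrMr ?exprn_gt0// (exprD _ 2 1) mulrA mulVf ?mul1r ?expr1//.
    by rewrite expf_neq0// gt_eqF.
  by apply: (le_trans i1); rewrite /M; lra.
have GM w : `|G w| <= M.
  have p0 := pdist_gt0 k w; have pn : pdist k w != 0 by rewrite gt_eqF.
  have := inv_pdist_bound k 3 w; rewrite -/b => /andP[i0 i1].
  have : 3 * z k w ^+ 2 / pdist k w ^+ 5 <= 3 * (pdist k w ^+ 3)^-1.
    rewrite ler_pdivrMr ?exprn_gt0// (_ : 3 * _ * _ = 3 * pdist k w ^+ 2); last by field.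
    by rewrite pdistE; have := A_gt0 k.+1 w; lra.
  have : 0 <= 3 * z k w ^+ 2 / pdist k w ^+ 5.
    by apply: divr_ge0; [rewrite mulr_ge0|rewrite exprn_ge0// ltW].
  by rewrite ler_norml /G /M => h1 h2; lra.
have NM w : 0 <= 12 / pdist k w ^+ 4 <= M.
  have := inv_pdist_bound k 4 w; rewrite -/b => /andP[i0 i1].
  by rewrite mulr_ge0//= /M; lra.
have c := cge0_quadratic mH mG mN HM GM NM.
have iE : integ (fun w => inv_norm k.+1 w - inv_norm k w - v k w / pdist k w ^+ 3 / 4).
  apply: integB; first by apply: integB; exact: integ_inv_norm.
  rewrite (_ : (fun w => _) = fun w => 4^-1 * (v k w / pdist k w ^+ 3)); last first.
    by apply/funext => w; rewrite mulrC.
  by apply: integZ; exact: integ_v_pdist.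
have {}c : cge0 Q (F k) (fun w => inv_norm k.+1 w - inv_norm k w - v k w / pdist k w ^+ 3 / 4).
  apply: (cge0_le (@FM k) c iE) => w.
  apply: (@inv_norm_step _ (pdist k w) _ _ (A a k.+1 w) (z k w) _ _ _ _ _) => //.
  - exact: pdist_gt0.
  - by rewrite sqrtr_gt0; have := A_gt0 k w; have := z2_ge0 k w; lra.
  - by rewrite sqrtr_gt0; have := A_gt0 k.+1 w; have := z2_ge0 k.+1 w; lra.
  - exact: pdistE.
  - rewrite sqr_sqrtr; first by rewrite /z partialS opprD addrA.
    by have := A_gt0 k.+1 w; have := z2_ge0 k.+1 w; lra.
  - rewrite sqr_sqrtr; first by rewrite -rem_varS.
    by have := A_gt0 k w; have := z2_ge0 k w; lra.
  - by apply: (le_trans ea); exact: sqrt_le_pdist.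
have := cge0_Exp (sF k) c.
rewrite RintegralB//; first last.
- rewrite (_ : (fun w => _) = fun w => 4^-1 * (v k w / pdist k w ^+ 3)); last first.
    by apply/funext => w; rewrite mulrC.
  by apply: integZ; exact: integ_v_pdist.
- by apply: integB; exact: integ_inv_norm.
rewrite RintegralB ?RintegralZr//; [|exact: integ_v_pdist|exact: integ_inv_norm|exact: integ_inv_norm].
lra.
Qed.

(** By telescoping, the final value of [inv_norm] pays for all the third-order
    errors. *)
Lemma inv_norm_sum n :
  \sum_(k < n) Exp (fun w => v k w / pdist k w ^+ 3) <= 4 * Exp (inv_norm n).
Proof.
have H m : \sum_(k < m) Exp (fun w => v k w / pdist k w ^+ 3) <= 4 * (Exp (inv_norm m) - Exp (inv_norm 0)).
  elim: m => [|m IH]; first by rewrite big_ord0 subrr mulr0.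
  by rewrite big_ord_recr/=; have := inv_norm_drift m; lra.
apply: (le_trans (H n)); rewrite ler_wpM2l// gerBl.
by apply: Rintegral_ge0 => w _; rewrite invr_ge0.
Qed.

Lemma smooth_cdf_drift k :
  `|Exp (smooth_cdf k.+1) - Exp (smooth_cdf k)| <=
   1200 * e * Exp (fun w => v k w / pdist k w ^+ 3) +
   4 * om * Exp (fun w => v k w / pdist k w ^+ 2).
Proof.
pose s w := Num.sqrt (A a k.+1 w).
have s0 w : 0 < s w by rewrite sqrtr_gt0.
have sas w : Num.sqrt a <= s w by rewrite ler_sqrt ?nnegrE ?(ltW (A_gt0 _ _))// rem_var_ge.
have ms : measurable_wrt (F k) s by apply: mw_sqrt; exact: measurable_rem_var.
have mz := @measurable_z k.
have mphi : measurable_wrt (F k) (fun w => phi (z k w / s w)).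
  apply: mw_comp; first exact: measurable_gauss_density.
  by apply: mwM => //; exact: mwV.
pose H w := - (phi (z k w / s w) / s w).
pose G w := - (z k w / s w * phi (z k w / s w) / (2 * s w ^+ 2)).
have mH : measurable_wrt (F k) H by apply: mwN; apply: mwM => //; exact: mwV.
have mG : measurable_wrt (F k) G.
  apply: mwN; apply: mwM; first by apply: mwM => //; apply: mwM => //; exact: mwV.
  apply: mwV; last by move=> w; rewrite mulr_gt0// exprn_gt0.
  by apply: mwM; [exact: mw_cst|exact: mwX].
have mN : measurable_wrt (F k) (fun w => 1000 / pdist k w ^+ 3).
  by apply: mwM; [exact: mw_cst|exact: measurable_inv_pdist].
pose D w := smooth_cdf k.+1 w - smooth_cdf k w.
pose E w := 1200 * e * (v k w / pdist k w ^+ 3) + 4 * om * (v k w / pdist k w ^+ 2).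
set b := (Num.sqrt a)^-1.
have b0 : 0 <= b by rewrite invr_ge0 ltW.
pose M := b + 4 * b ^+ 2 + 1000 * b ^+ 3.
have b2 : 0 <= b ^+ 2 by rewrite exprn_ge0.
have b3 : 0 <= b ^+ 3 by rewrite exprn_ge0.
have M1 : b <= M by rewrite /M; lra.
have M2 : 4 * b ^+ 2 <= M by rewrite /M; lra.
have M3 : 1000 * b ^+ 3 <= M by rewrite /M; lra.
have step w := @Phi_step R (pdist k w) (s w) (Num.sqrt (A a k w)) (z k w) (eta k w) (v k w) e om
  (s0 w) (pdist_gt0 k w) (ltac:(by rewrite sqrtr_gt0)).
have {}step w := step w (ltac:(by rewrite pdistE sqr_sqrtr ?(ltW (A_gt0 _ _)))) (ltac:(by rewrite !sqr_sqrtr ?(ltW (A_gt0 _ _))// rem_varS)) (v01 k w) e0 (le_trans ea (sas w)) (ltac:(by case/andP: om01)).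
have HM w : `|H w| <= M.
  have [_ [h _]] := step w; apply: (le_trans h).
  apply: (@le_trans _ _ b) => //.
  by rewrite lef_pV2 ?posrE.
have GM w : `|G w| <= M.
  have [_ [_ h]] := step w; apply: (le_trans h).
  have := inv_pdist_bound k 2 w; rewrite -/b => /andP[i0 i1].
  by apply: le_trans M2; exact: (ler_wpM2l (ler0n _ _) i1).
have NM w : 0 <= 1000 / pdist k w ^+ 3 <= M.
  have := inv_pdist_bound k 3 w; rewrite -/b => /andP[i0 i1].
  apply/andP; split; first exact: (mulr_ge0 (ler0n _ _) i0).
  by apply: le_trans M3; exact: (ler_wpM2l (ler0n _ _) i1).
have iD : integ D by apply: integB; exact: integ_smooth_cdf.
have i3 : integ (fun w => 1200 * e * (v k w / pdist k w ^+ 3)) by apply: integZ; exact: integ_v_pdist.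
have i2 : integ (fun w => 4 * om * (v k w / pdist k w ^+ 2)) by apply: integZ; exact: integ_v_pdist.
have iE : integ E by exact: integD.
have ExpE : Exp E = 1200 * e * Exp (fun w => v k w / pdist k w ^+ 3) + 4 * om * Exp (fun w => v k w / pdist k w ^+ 2).
  by rewrite RintegralD// !RintegralZl//; exact: integ_v_pdist.
have ExpD : Exp D = Exp (smooth_cdf k.+1) - Exp (smooth_cdf k).
  by rewrite RintegralB//; exact: integ_smooth_cdf.
have DE w : Phi ((z k w - eta k w) / s w) - Phi (z k w / Num.sqrt (A a k w)) = D w.
  by rewrite /D /smooth_cdf /z partialS opprD addrA.
have c1 := cge0_quadratic mH mG mN HM GM NM.
have {}c1 : cge0 Q (F k) (fun w => D w + E w).
  apply: (cge0_le (@FM k) c1); first exact: integD.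
  by move=> w; have [[h _] _] := step w; rewrite -DE.
have c2 := @cge0_quadratic k (fun w => - H w) (fun w => - G w) _ M (mwN mH) (mwN mG) mN (fun w => ltac:(by rewrite normrN)) (fun w => ltac:(by rewrite normrN)) NM.
have {}c2 : cge0 Q (F k) (fun w => - D w + E w).
  apply: (cge0_le (@FM k) c2); first by apply: integD => //; exact: integN.
  by move=> w; have [[_ h] _] := step w; rewrite -DE.
have := cge0_Exp (sF k) c1; have := cge0_Exp (sF k) c2.
rewrite -ExpD -ExpE (RintegralD _ iD iE)// (RintegralD _ (integN iD) iE)//.
have -> : Exp (fun w => - D w) = - Exp D.
  by rewrite -mulN1r -RintegralZl//; congr fine; apply: eq_integral => w _; rewrite mulN1r.
exact: norm_le_sum_ge0.
Qed.

Lemma smooth_cdf_sum n :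
  `|Exp (smooth_cdf n) - Phi (y / Num.sqrt (a + B))| <=
  1200 * e * (\sum_(k < n) Exp (fun w => v k w / pdist k w ^+ 3)) +
  4 * om * (\sum_(k < n) Exp (fun w => v k w / pdist k w ^+ 2)).
Proof.
have -> : Phi (y / Num.sqrt (a + B)) = Exp (smooth_cdf 0).
  transitivity (Exp (fun=> Phi (y / Num.sqrt (a + B)))); first by rewrite Exp_cst.
  by apply: eq_Rintegral => w _; rewrite /smooth_cdf /z /A /partial !big_ord0 !subr0.
elim: n => [|m IH]; first by rewrite !big_ord0 subrr normr0 !mulr0 addr0.
rewrite !big_ord_recr/= !mulrDr.
apply: (le_trans (ler_distD (Exp (smooth_cdf m)) _ _)).
by apply: lerD_shuffle => //; exact: smooth_cdf_drift.
Qed.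

End lindeberg.

(** * The Berry-Esseen bound by self-improvement *)

Section dyadic.
Context (R : realType).

(** The scale [2^-j] just above [r] contributes at least a multiple of [1 /
    r^2]. With [P] the squared distance before smoothing, this reduces
    second-order errors to third-order ones at every dyadic amount of
    smoothing. *)
Lemma dyadic_inv_sq (P r : R) J : 0 <= P -> 0 < r -> P <= r ^+ 2 -> 2^-1 ^+ J <= r ->
  (r ^+ 2)^-1 <= 32 * (1 + \sum_(j < J) 2^-1 ^+ j / Num.sqrt (2 * (2^-1 ^+ j) ^+ 2 + P) ^+ 3).
Proof.
move=> P0 r0 Pr.
have sum0 m : 0 <= \sum_(j < m) 2^-1 ^+ j / Num.sqrt (2 * (2^-1 ^+ j) ^+ 2 + P) ^+ 3 :> R.
  by apply: sumr_ge0 => i _; rewrite divr_ge0 ?exprn_ge0 ?invr_ge0// sqrtr_ge0.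
elim: J => [|J IH] hJ.
  rewrite big_ord0 addr0 mulr1; rewrite expr0 in hJ.
  apply: (@le_trans _ _ 1); last lra.
  by rewrite invf_le1 ?exprn_gt0// exprn_ege1.
have [|hlt] := leP (2^-1 ^+ J) r.
  move=> /IH /le_trans; apply; rewrite big_ord_recr/= ler_wpM2l// lerD2l lerDl.
  by rewrite divr_ge0 ?exprn_ge0 ?invr_ge0// sqrtr_ge0.
rewrite big_ord_recr/=.
set h := 2^-1 ^+ J in hlt *; have h0 : 0 < h by rewrite exprn_gt0// invr_gt0.
have hr : h / 2 <= r by move: hJ; rewrite exprS -/h; lra.
set s := Num.sqrt _.
have s2 : s ^+ 2 = 2 * h ^+ 2 + P.
  by rewrite sqr_sqrtr// addr_ge0// mulr_ge0// sqr_ge0.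
have h2 : 0 < h ^+ 2 by rewrite exprn_gt0.
have s0 : 0 < s by rewrite sqrtr_gt0; lra.
have sh : s <= 2 * h.
  rewrite -(ler_pXn2r (isT : (0 < 2)%N)) ?nnegrE ?mulr_ge0 ?(ltW s0) ?(ltW h0)// s2.
  have : r ^+ 2 <= h ^+ 2 by rewrite lerXn2r ?nnegrE ?(ltW r0) ?(ltW h0)// ltW.
  by rewrite exprMn; lra.
have t1 : (8 * h ^+ 2)^-1 <= h / s ^+ 3.
  rewrite ler_pdivlMr ?exprn_gt0// ler_pdivrMl ?mulr_gt0//.
  rewrite (_ : 8 * h ^+ 2 * h = (2 * h) ^+ 3); last by ring.
  by rewrite lerXn2r ?nnegrE ?mulr_ge0 ?(ltW s0) ?(ltW h0).
have t2 : (r ^+ 2)^-1 <= 32 * (8 * h ^+ 2)^-1.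
  rewrite (_ : 32 * _ = ((h / 2) ^+ 2)^-1); last by field; rewrite gt_eqF.
  rewrite lef_pV2 ?posrE ?exprn_gt0 ?divr_gt0//.
  by rewrite lerXn2r ?nnegrE ?divr_ge0 ?(ltW h0) ?(ltW r0).
by have := sum0 J; lra.
Qed.

Lemma sum_pow2 k : \sum_(j < k) 2 ^+ j = 2 ^+ k - 1 :> R.
Proof.
elim: k => [|k IHk]; first by rewrite big_ord0 subrr.
by rewrite big_ord_recr/= IHk exprS; ring.
Qed.

(** If [U] lies between [2^j] and [2^(j + 1)], the indicators up to [j] are
    all one and the sum is at least [2^(j + 1) - 1]. *)
Lemma dyadic_inv_norm (U z : R) m : 0 <= U -> U * `|z| <= 1 -> U <= 2 ^+ m ->
  U <= 1 + \sum_(j < m) 2 ^+ j * (`|z| < 2^-1 ^+ j)%R%:R.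
Proof.
move=> U0 Uz; elim: m => [|m IH] hm.
  by rewrite big_ord0 addr0.
have [/IH h|hlt] := leP U (2 ^+ m).
  by rewrite big_ord_recr/=; apply: (le_trans h); rewrite lerD2l lerDl mulr_ge0// exprn_ge0.
have -> : \sum_(j < m.+1) 2 ^+ j * (`|z| < 2^-1 ^+ j)%R%:R = \sum_(j < m.+1) 2 ^+ j :> R.
  apply: eq_bigr => j _.
  have jm : (2 ^+ j : R) <= 2 ^+ m by rewrite ler_weXn2l ?ler1n// -ltnS.
  have Up : 0 < U by apply: lt_trans hlt; rewrite exprn_gt0.
  suff -> : `|z| < 2^-1 ^+ j by rewrite mulr1.
  rewrite exprVn -[ltRHS]mul1r ltr_pdivlMr ?exprn_gt0//.
  have [z0|z0] := eqVneq z 0; first by rewrite z0 normr0 mul0r.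
  apply: lt_le_trans Uz; rewrite mulrC ltr_pM2r ?normr_gt0//.
  exact: le_lt_trans hlt.
by rewrite sum_pow2; lra.
Qed.

Lemma dyadic_arith_sum J : \sum_(j < J) 2^-1 ^+ j * (1 + j%:R) <= 4 :> R.
Proof.
suff -> : \sum_(j < J) 2^-1 ^+ j * (1 + j%:R) = 4 - (2 * J%:R + 4) * 2^-1 ^+ J :> R.
  by rewrite lerBlDr lerDl mulr_ge0 ?exprn_ge0// addr_ge0// mulr_ge0.
elim: J => [|J IH]; first by rewrite big_ord0 mulr0 add0r mulr1 subrr.
by rewrite big_ord_recr/= IH exprS -natr1; field.
Qed.

End dyadic.

Section normal_approximation.
Context (d : measure_display) (T : measurableType d) (R : realType).
Variable P : probability T R.
Notation Phi := (@std_normal_cdf R).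
Notation integ h := (P.-integrable setT (EFin \o h)).
Notation Exp f := (\int[P]_w f w).

(** What a Kolmogorov distance at most [K] gives for half-lines and bounded
    intervals, in a form stable under [X |-> - X]. *)
Definition near_normal (X : T -> R) (K : R) :=
  (forall b, `|fine (P [set w | b < X w]) - (1 - Phi b)| <= 2 * K) /\
  (forall b c, b < c ->
    `|fine (P [set w | b < X w < c]) - (Phi c - Phi b)| <= 2 * K).

Variable X : T -> R.
Hypothesis mX : measurable_fun setT X.

Let mle y : measurable [set w | X w <= y]. Proof. exact: measurable_le_set. Qed.
Let mlt y : measurable [set w | X w < y]. Proof. exact: measurable_lt_set. Qed.

Let fine_le A B : measurable A -> measurable B -> A `<=` B -> fine (P A) <= fine (P B).
Proof. by move=> mA mB AB; rewrite fine_le ?fin_num_measure// le_measure ?inE. Qed.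

Let fineC A : measurable A -> fine (P (~` A)) = 1 - fine (P A).
Proof. by move=> mA; rewrite probability_setC// fineB ?fin_num_measure. Qed.

Let fineD A B : measurable A -> measurable B -> B `<=` A -> fine (P (A `\` B)) = fine (P A) - fine (P B).
Proof.
move=> mA mB BA; rewrite measureD// ?fineB ?fin_num_measure//.
- by rewrite setIidr.
- exact: measurableI.
- by rewrite -ge0_fin_numE// fin_num_measure.
Qed.

Variable K : R.
Hypothesis hK : forall y, `|fine (P [set w | X w <= y]) - Phi y| <= K.

Lemma cdf_lt_bound y : `|fine (P [set w | X w < y]) - Phi y| <= K.
Proof.
rewrite ler_norml; apply/andP; split; last first.
  have := hK y; rewrite ler_norml => /andP[_ h]; apply: le_trans h; rewrite lerD2r.
  by apply: fine_le => // w /=; exact: ltW.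
apply/ler_addgt0Pr => eps eps0.
have := hK (y - eps); rewrite ler_norml => /andP[h _].
have l := @Phi_lip R y (y - eps).
have : fine (P [set w | X w <= y - eps]) <= fine (P [set w | X w < y]).
  by apply: fine_le => // w /= h1; apply: (le_lt_trans h1); lra.
move: l; rewrite (_ : y - (y - eps) = eps); last by ring.
by rewrite (gtr0_norm eps0) ler_norml => /andP[_ l]; lra.
Qed.

Lemma gt_setE b : [set w | b < X w] = ~` [set w | X w <= b].
Proof. by apply/seteqP; split => w /=; [rewrite ltNge => /negP|move=> /negP; rewrite -ltNge]. Qed.

Lemma near_normal_kolmogorov : near_normal X K.
Proof.
have K0 : 0 <= K by apply: le_trans (hK 0).
split=> [b|b c bc].
  rewrite gt_setE fineC//; have := hK b; rewrite !ler_norml; lra.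
have -> : [set w | b < X w < c] = [set w | X w < c] `\` [set w | X w <= b].
  apply/seteqP; split => w /=.
    by move=> /andP[h1 h2]; split => //; apply/negP; rewrite -ltNge.
  by move=> [h1 /negP]; rewrite -ltNge => -> /=.
rewrite fineD//; last by move=> w /= h; exact: le_lt_trans bc.
by have := hK b; have := cdf_lt_bound c; rewrite !ler_norml; lra.
Qed.

Lemma near_normal_kolmogorovN : near_normal (fun w => - X w) K.
Proof.
have K0 : 0 <= K by apply: le_trans (hK 0).
split=> [b|b c bc].
  rewrite (_ : [set w | _] = [set w | X w < - b]); last by apply/seteqP; split => w /=; rewrite ltrNr.
  by have := cdf_lt_bound (- b); rewrite PhiN !ler_norml; lra.
have -> : [set w | b < - X w < c] = [set w | X w < - b] `\` [set w | X w <= - c].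
  apply/seteqP; split => w /=.
    by move=> /andP[h1 h2]; rewrite ltrNr; split => //; apply/negP; rewrite -ltNge ltrNl.
  by move=> [h1 /negP]; rewrite -ltNge ltrNl => ->; rewrite andbT ltrNr.
rewrite fineD//; last by move=> w /= h; apply: (le_lt_trans h); rewrite ltrN2.
by have := hK (- c); have := cdf_lt_bound (- b); rewrite !PhiN !ler_norml; lra.
Qed.

Lemma near_normal_ball y h : 0 < h ->
  fine (P [set w | `|y - X w| < h]) <= h + 2 * K.
Proof.
move=> h0; have [_ H] := near_normal_kolmogorov.
rewrite (_ : [set w | _] = [set w | y - h < X w < y + h]); last first.
  apply/seteqP; split => w /=; rewrite ltr_norml.
    by move=> /andP[h1 h2]; apply/andP; split; lra.
  by move=> /andP[h1 h2]; apply/andP; split; lra.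
have := H (y - h) (y + h) ltac:(lra); have := @Phi_lip R (y + h) (y - h).
rewrite (_ : y + h - (y - h) = 2 * h); last by ring.
by rewrite (gtr0_norm (_ : 0 < 2 * h)) ?mulr_gt0// !ler_norml; lra.
Qed.

End normal_approximation.

Section exponential_transfer.
Context (R : realType).
Notation Phi := (@std_normal_cdf R).
Notation mu := (@lebesgue_measure R).

Definition exp_tail (l b x : R) : R := \1_`]b, +oo[ x * expR (- (l * (x - b))).

Lemma exp_tailE l b x : exp_tail l b x = if b < x then expR (- (l * (x - b))) else 0.
Proof.
rewrite /exp_tail indicE; case: ifPn => h.
  by rewrite mem_set ?mul1r//= in_itv/= h.
by rewrite memNset ?mul0r//= in_itv/= (negbTE h).
Qed.

Lemma exp_tail_level l b r : 0 <= l -> 0 <= r < 1 ->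
  (forall x, (r < exp_tail l b x) = (b < x)) \/
  (exists2 c, b < c & forall x, (r < exp_tail l b x) = (b < x < c)).
Proof.
move=> l0 /andP[r0 r1].
have [l00|lp] := eqVneq l 0.
  left => x; rewrite exp_tailE l00 mul0r oppr0 expR0.
  by case: ifP => // _; rewrite ltNge r0.
have {l0 lp} lp : 0 < l by rewrite lt_neqAle eq_sym lp.
have [r00|rp] := eqVneq r 0.
  left => x; rewrite exp_tailE r00.
  by case: ifP => _; rewrite ?expR_gt0 ?ltxx.
have {r0 rp} rp : 0 < r by rewrite lt_neqAle eq_sym rp.
have lr : ln r < 0 by rewrite ln_lt0// rp.
right; exists (b - ln r / l).
  by rewrite ltrDl oppr_gt0 ltr_pdivrMr// mul0r.
move=> x; rewrite exp_tailE; case: ifP => /= bx; last by apply/negbTE; rewrite -leNgt ltW.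
rewrite -{1}(lnK (rp : r \is Num.pos)) ltr_expR ltrNr.
by rewrite mulrC -ltr_pdivlMr// ltrBlDl mulNr.
Qed.

Lemma probability_leD (d1 d2 : measure_display) (T1 : measurableType d1)
    (T2 : measurableType d2) (P1 : probability T1 R) (P2 : probability T2 R)
    (A1 : set T1) (A2 : set T2) (c : R) : measurable A1 -> measurable A2 ->
  fine (P1 A1) <= fine (P2 A2) + c -> (P1 A1 <= P2 A2 + c%:E)%E.
Proof.
move=> mA1 mA2 h; rewrite -(fineK (fin_num_measure P1 _ mA1)).
by rewrite -(fineK (fin_num_measure P2 _ mA2)) -EFinD lee_fin.
Qed.

(** The superlevel sets of [exp_tail] are half-lines or bounded intervals, and
    its levels lie between zero and one: the layer-cake formula integrates the
    discrepancy of these probabilities. *)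
Lemma exp_tail_compare (d1 d2 : measure_display) (T1 : measurableType d1)
    (T2 : measurableType d2) (P1 : probability T1 R) (P2 : probability T2 R)
    (X1 : T1 -> R) (X2 : T2 -> R) (K1 K2 l b : R) :
  measurable_fun setT X1 -> measurable_fun setT X2 ->
  near_normal P1 X1 K1 -> near_normal P2 X2 K2 -> 0 <= l ->
  (\int[P1]_w (exp_tail l b (X1 w))%:E <=
   \int[P2]_w (exp_tail l b (X2 w))%:E + (2 * (K1 + K2))%:E)%E.
Proof.
move=> m1 m2 [n1 n1'] [n2 n2'] l0.
have K10 : 0 <= 2 * K1 by apply: le_trans (n1 0).
have K20 : 0 <= 2 * K2 by apply: le_trans (n2 0).
have mg : measurable_fun setT (exp_tail l b) by exact: measurable_exp_tail.
have mg1 : measurable_fun setT (exp_tail l b \o X1) by exact: measurableT_comp.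
have mg2 : measurable_fun setT (exp_tail l b \o X2) by exact: measurableT_comp.
pose Z1 : {mfun T1 >-> R} := HB.pack (exp_tail l b \o X1) (@isMeasurableFun.Build _ _ _ _ _ mg1).
pose Z2 : {mfun T2 >-> R} := HB.pack (exp_tail l b \o X2) (@isMeasurableFun.Build _ _ _ _ _ mg2).
have g0 x : 0 <= exp_tail l b x by case/andP: (exp_tail_bounds b l0 x).
have := @ge0_expectation_ccdf _ _ R P1 Z1 (fun w => g0 _).
have := @ge0_expectation_ccdf _ _ R P2 Z2 (fun w => g0 _).
rewrite !expectation_def /= => -> ->.
pose k (r : R) : \bar R := (2 * (K1 + K2) * \1_`[0, 1] r)%:E.
have mk : measurable_fun setT k.
  by apply/measurable_EFinP; apply: measurable_funM => //; exact: measurable_indic.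
have k0 r : (0 <= k r)%E by rewrite lee_fin mulr_ge0//; lra.
have ik : (\int[mu]_(r in `[0%R, +oo[) k r = (2 * (K1 + K2))%:E)%E.
  under eq_integral do rewrite /k EFinM.
  rewrite ge0_integralZl//; last 2 first.
  - by apply: measurable_funTS; apply/measurable_EFinP; exact: measurable_indic.
  - by rewrite lee_fin; lra.
  rewrite integral_indic//= (_ : _ `&` _ = `[0%R, 1%R]%classic); last first.
    apply/seteqP; split => r /=; rewrite !in_itv/= ?andbT; first by case.
    by move=> h; split=> //; case/andP: h.
  by rewrite lebesgue_measure_itv/= lte01 oppr0 adde0 mule1.
rewrite -ik -ge0_integralD//; last 2 first.
- by apply: measurable_funTS; exact: ccdf_measurable.
- by apply: measurable_funTS.
apply: ge0_le_integral => //.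
- by apply: measurable_funTS; exact: ccdf_measurable.
- by apply: emeasurable_funD; apply: measurable_funTS => //; exact: ccdf_measurable.
move=> r; rewrite /= in_itv/= andbT => r0.
rewrite /ccdf /distribution /pushforward.
have E (dd : measure_display) (T : measurableType dd) (X : T -> R) :
  (exp_tail l b \o X) @^-1` `]r, +oo[ = [set w | r < exp_tail l b (X w)].
  by apply/seteqP; split => w /=; rewrite in_itv/= andbT.
rewrite !E.
have mE (dd : measure_display) (T : measurableType dd) (X : T -> R) :
    measurable_fun setT X -> measurable [set w | r < exp_tail l b (X w)].
  move=> mX; rewrite -E -[X in measurable X]setTI.
  by apply: measurableT_comp mX _ _ _ => //.
have [r1|r1] := leP 1 r.
  rewrite (_ : [set w | r < exp_tail l b (X1 w)] = set0).
    by rewrite measure0 adde_ge0.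
  apply/seteqP; split => w //=; rewrite ltNge (le_trans _ r1)//.
  by case/andP: (exp_tail_bounds b l0 (X1 w)).
rewrite /k indicE mem_set/= ?in_itv/= ?r0 ?(ltW r1)// mulr1.
have r01 : 0 <= r < 1 by rewrite r0.
have [H|[c bc H]] := exp_tail_level b l0 r01; (apply: probability_leD; [exact: mE|exact: mE|]).
- have EE (dd : measure_display) (T : measurableType dd) (X : T -> R) :
      [set w | r < exp_tail l b (X w)] = [set w | b < X w].
    by apply/seteqP; split => w /=; rewrite H.
  by rewrite !EE; have := n1 b; have := n2 b; rewrite !ler_norml; lra.
- have EE (dd : measure_display) (T : measurableType dd) (X : T -> R) :
      [set w | r < exp_tail l b (X w)] = [set w | b < X w < c].
    by apply/seteqP; split => w /=; rewrite H.
  by rewrite !EE; have := n1' b c bc; have := n2' b c bc; rewrite !ler_norml; lra.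
Qed.

Lemma near_normal_gauss : near_normal (normal_prob 0 1) (idfun : R -> R) 0.
Proof.
apply: near_normal_kolmogorov; first exact: measurable_id.
move=> y; rewrite (_ : [set w | _] = `]-oo, y]%classic); last first.
  by apply/seteqP; split => w /=; rewrite in_itv.
rewrite [fine _](_ : _ = Phi y) ?subrr ?normr0//.
exact: (congr1 fine (esym (Phi_normal_prob y))).
Qed.

(** [exp_tail_compare] in both directions with the normal law, for which
    [gauss_laplace] gives the value. *)
Lemma exp_transfer (d : measure_display) (T : measurableType d)
    (P : probability T R) (X : T -> R) (K l b : R) :
  measurable_fun setT X -> near_normal P X K -> 0 <= l ->
  `|\int[P]_w exp_tail l b (X w) - expR (l * b + l ^+ 2 / 2) * (1 - Phi (b + l))| <= 2 * K.
Proof.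
move=> mX nX l0.
have mg : measurable_fun setT (exp_tail l b) by exact: measurable_exp_tail.
have iX : P.-integrable setT (EFin \o (fun w => exp_tail l b (X w))).
  apply: (@integ_bounded _ _ _ _ _ 1); first exact: measurableT_comp.
  move=> w; have /andP[h1 h2] := exp_tail_bounds b l0 (X w).
  by rewrite ger0_norm.
have mid : measurable_fun [set: measurableTypeR R] (idfun : measurableTypeR R -> R) by exact: measurable_id.
have h1 := exp_tail_compare b mX mid nX near_normal_gauss l0.
have h2 := exp_tail_compare b mid mX near_normal_gauss nX l0.
move: h1 h2; rewrite gauss_laplace -(Exp_EFin iX) -!EFinD !lee_fin.
by rewrite add0r addr0 ler_norml; set p := Rintegral _ _ _; set q := _ * (1 - _); lra.
Qed.

End exponential_transfer.

Lemma smooth_bound_arith (R : realType) (e om K j p s1 s2 U : R) :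
  0 <= e -> 0 <= om -> 0 <= K -> s1 <= 4 * U -> U <= 1 + j + 2 * K * p ->
  s2 <= 32 * (2 + 4 * (4 + 2 * K * j)) -> e * p <= (2 ^+ 17)^-1 ->
  om * j <= (2 ^+ 13)^-1 ->
  1200 * e * s1 + 4 * om * s2 <= 4800 * (e * (1 + j)) + 2304 * om + K / 4.
Proof.
move=> e0 om0 K0 h1 h2 h3 ep oj.
have k1 := ler_wpM2l K0 ep; have k2 := ler_wpM2l K0 oj.
have k3 : e * s1 <= e * (4 * (1 + j + 2 * K * p)).
  by apply: ler_wpM2l => //; apply: (le_trans h1); lra.
have k4 := ler_wpM2l om0 h3.
lra.
Qed.

Section berry_esseen_step.
Context (d : measure_display) (T : measurableType d) (R : realType).
Variables (Q : probability T R) (F : nat -> set (set T)).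
Variables (eta v : nat -> T -> R) (e om delta : R) (n : nat).
Notation Phi := (@std_normal_cdf R).
Notation integ h := (Q.-integrable setT (EFin \o h)).
Notation Exp f := (\int[Q]_w f w).
Notation S := (partial v).
Notation Y := (partial eta).
Notation B := (1 + delta ^+ 2).

Hypothesis ssm : small_step_martingale Q F eta v e om B.
Hypothesis S_ge : {ae Q, forall w, 1 - delta ^+ 2 <= S n w}.
(* [u] is the standard deviation of the final smoothing, and [2^-J] its
   dyadic size. *)
Variables (u : R) (J : nat).
Hypothesis u01 : 0 < u <= 1.
Hypothesis delta_u : 0 <= delta <= u.
Hypothesis e_u : 2 ^+ 18 * e <= u.
Hypothesis J_u : 1 <= 2 ^+ J * u <= 2.
Hypothesis omJ : om * J%:R <= (2 ^+ 13)^-1.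
Variable K : R.
Hypothesis hK : forall y, `|fine (Q [set w | Y n w <= y]) - Phi y| <= K.

Let u0 : 0 < u. Proof. by case/andP: u01. Qed.
Let u1 : u <= 1. Proof. by case/andP: u01. Qed.
Let e0 : 0 <= e := ssm_e ssm.
Let om0 : 0 <= om. Proof. by case/andP: (ssm_om ssm). Qed.
Let K0 : 0 <= K. Proof. by apply: le_trans (hK 0). Qed.
Let mY : measurable_fun setT (Y n).
Proof. by apply: (measurableT_wrt ssm (k := n)); apply: measurable_Y ssm n. Qed.
Let d2 : delta ^+ 2 <= 1.
Proof. by rewrite expr_le1//; case/andP: delta_u => // _ h; exact: le_trans u1. Qed.

(** At the last step [inv_norm] is at most [1 / |y - Y n|]. Its mean is thus a
    sum over dyadic scales of the probabilities that [Y n] is close to [y],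
    each of them Gaussian up to [2 * K]. *)
Lemma Exp_inv_norm_le (y w : R) m : 0 < w -> 2^-1 ^+ m <= w ->
  Exp (inv_norm eta v B (w ^+ 2) y n) <= 1 + m%:R + 2 * K * 2 ^+ m.
Proof.
move=> w0 mw; have w20 : 0 < w ^+ 2 by rewrite exprn_gt0.
pose A (j : nat) := [set x | `|y - Y n x| < 2^-1 ^+ j].
have mA j : measurable (A j).
  by apply: measurable_lt_set; apply: measurableT_comp => //; exact: measurable_funB.
pose g (x : T) : R := 1 + \sum_(j < m) 2 ^+ j * \1_(A j) x.
have iA (j : 'I_m) : integ (fun x => 2 ^+ j * \1_(A j) x).
  by apply: integZ; exact: integ_indic.
have [ig1 eg1] := Exp_sum iA.
have ig : integ g by apply: integD => //; exact: integ_cst.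
apply: (@le_trans _ _ (Exp g)).
  apply: Exp_le => //; first exact: (integ_inv_norm ssm).
  move=> x; rewrite /g.
  have -> : \sum_(j < m) 2 ^+ j * \1_(A j) x = \sum_(j < m) 2 ^+ j * (`|y - Y n x| < 2^-1 ^+ j)%R%:R :> R.
    apply: eq_bigr => j _; congr (_ * _); rewrite indicE.
    by rewrite (_ : (x \in A j) = (`|y - Y n x| < 2^-1 ^+ j)%R)//; apply/idP/idP; rewrite inE.
  have q0 : 0 < 2 * rem_var v B (w ^+ 2) n x + (y - Y n x) ^+ 2.
    have := rem_var_ge ssm (w ^+ 2) n x; have := sqr_ge0 (y - Y n x); lra.
  apply: dyadic_inv_norm.
  - by rewrite invr_ge0 sqrtr_ge0.
  - rewrite ler_pdivrMl ?sqrtr_gt0// mulr1 -sqrtr_sqr ler_sqrt ?(ltW q0)//.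
    by have := rem_var_ge ssm (w ^+ 2) n x; lra.
  - apply: (@le_trans _ _ w^-1); last first.
      by rewrite -[leRHS]invrK -exprVn lef_pV2 ?posrE ?exprn_gt0 ?invr_gt0.
    have := @inv_norm_bound _ _ _ _ _ _ _ _ _ _ ssm (w ^+ 2) y w20 n x.
    rewrite ger0_norm ?invr_ge0 ?sqrtr_ge0// => /le_trans; apply.
    by rewrite sqrtr_sqr gtr0_norm.
rewrite RintegralD//; last exact: integ_cst.
rewrite Exp_cst eg1 -addrA lerD2l.
apply: (@le_trans _ _ (\sum_(j < m) (1 + 2 * K * 2 ^+ j))).
  apply: ler_sum => j _; rewrite RintegralZl//; last exact: integ_indic.
  rewrite Exp_indic//.
  have p0 : 0 < (2^-1 : R) ^+ j by rewrite exprn_gt0// invr_gt0.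
  have := near_normal_ball mY hK y p0; rewrite -/(A j) => h.
  apply: (@le_trans _ _ (2 ^+ j * (2^-1 ^+ j + 2 * K))).
    by rewrite ler_wpM2l// exprn_ge0.
  by rewrite mulrDr exprVn divff ?expf_neq0// lerD2l mulrC.
rewrite big_split/= sumr_const card_ord -mulr_sumr sum_pow2.
have : 0 <= 2 * K by rewrite mulr_ge0.
by rewrite mulrBr mulr1; set q := 2 * K * _; lra.
Qed.

(** [dyadic_inv_sq] replaces this sum by the third-order ones at [J] levels
    [2^-j] of smoothing. The weight [2^-j] balances the factor [2^j] of [K] in
    [Exp_inv_norm_le], so that [K] is only multiplied by [J]. *)
Lemma Exp_pdist_sq_le (y : R) :
  \sum_(k < n) Exp (fun x => v k x / pdist eta v B (u ^+ 2) y k x ^+ 2) <=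
  32 * (2 + 4 * (4 + 2 * K * J%:R)).
Proof.
pose w (j : nat) : R := 2^-1 ^+ j.
have w0 j : 0 < w j by rewrite exprn_gt0// invr_gt0.
have u20 : 0 < u ^+ 2 by rewrite exprn_gt0.
have wu (j : 'I_J) : u <= w j.
  have /andP[_ h] := J_u; have jJ : (j.+1 <= J)%N by [].
  have h2 : 2 ^+ j.+1 <= 2 ^+ J :> R by rewrite ler_weXn2l ?ler1n.
  have h3 : 2 ^+ j.+1 * u <= 2 by apply: le_trans h; rewrite ler_wpM2r ?(ltW u0).
  by rewrite /w exprVn -[leRHS]mul1r ler_pdivlMr ?exprn_gt0//; move: h3; rewrite exprS; lra.
have ew (j : 'I_J) : 200 * e <= Num.sqrt (w j ^+ 2).
  rewrite sqrtr_sqr gtr0_norm//; apply: le_trans (wu j); apply: le_trans e_u.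
  by rewrite ler_wpM2r//; lra.
pose D k b m x := v k x / pdist eta v B b y k x ^+ m.
have iD k (j : 'I_J) : integ (D k (w j ^+ 2) 3).
  by apply: (integ_v_pdist ssm); rewrite exprn_gt0.
have iv k : integ (v k).
  apply: (@integ_bounded _ _ _ _ _ (e ^+ 2)).
    by apply: (measurableT_wrt ssm (k := k)); exact: ssm_predictable ssm k.
  by move=> x; have /andP[h1 h2] := ssm_v ssm k x; rewrite ger0_norm.
have step k : Exp (D k (u ^+ 2) 2%N) <= 32 * (Exp (v k) + \sum_(j < J) w j * Exp (D k (w j ^+ 2) 3)).
  have iwD (j : 'I_J) : integ (fun x => w j * D k (w j ^+ 2) 3 x) by apply: integZ.
  have [is1 es1] := Exp_sum iwD.
  apply: (@le_trans _ _ (Exp (fun x => 32 * (v k x + \sum_(j < J) w j * D k (w j ^+ 2) 3 x)))).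
    apply: Exp_le; first exact: (integ_v_pdist ssm).
      by apply: integZ; exact: integD.
    move=> x; rewrite /D.
    have P0 : 0 <= 2 * rem_var v B 0 k.+1 x + (y - Y k x) ^+ 2.
      by have := rem_var_ge ssm 0 k.+1 x; have := sqr_ge0 (y - Y k x); lra.
    have pE b : pdist eta v B b y k x = Num.sqrt (2 * b + (2 * rem_var v B 0 k.+1 x + (y - Y k x) ^+ 2)).
      by rewrite /pdist /rem_var; congr Num.sqrt; ring.
    have p0 : 0 < pdist eta v B (u ^+ 2) y k x by apply: (pdist_gt0 ssm).
    have pu : 2^-1 ^+ J <= pdist eta v B (u ^+ 2) y k x.
      apply: (@le_trans _ _ u).
        have /andP[h _] := J_u.
        by rewrite exprVn -[leLHS]mul1r ler_pdivrMr ?exprn_gt0// mulrC.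
      have := sqrt_le_pdist ssm y u20 k x; by rewrite sqrtr_sqr gtr0_norm.
    have p2 : 2 * rem_var v B 0 k.+1 x + (y - Y k x) ^+ 2 <= pdist eta v B (u ^+ 2) y k x ^+ 2.
      rewrite pE sqr_sqrtr; first by rewrite lerDr mulr_ge0// ltW.
      by rewrite addr_ge0// mulr_ge0// ltW.
    have := dyadic_inv_sq P0 p0 p2 pu.
    have /andP[v0 _] := ssm_v ssm k x.
    move=> /(ler_wpM2l v0) /le_trans; apply.
    rewrite mulrCA ler_wpM2l// mulrDr mulr1 lerD2l mulr_sumr.
    apply: ler_sum => j _; rewrite -/(w j) -pE.
    by rewrite mulrCA.
  rewrite RintegralZl//; last exact: integD.
  rewrite RintegralD// es1; apply: ler_wpM2l => //; rewrite lerD2l.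
  by apply: ler_sum => j _; rewrite RintegralZl.
apply: (@le_trans _ _ (\sum_(k < n) 32 * (Exp (v k) + \sum_(j < J) w j * Exp (D k (w j ^+ 2) 3)))).
  by apply: ler_sum => k _; exact: step.
rewrite -mulr_sumr ler_wpM2l// big_split/= lerD//.
  have [is2 <-] := Exp_sum (fun k : 'I_n => iv k).
  rewrite -[leRHS](Exp_cst Q); apply: Exp_le => //; first exact: integ_cst.
  by move=> x; apply: (le_trans (ssm_total ssm n x)); rewrite -lerBrDl; apply: (le_trans d2); lra.
rewrite exchange_big/=.
apply: (@le_trans _ _ (\sum_(j < J) (4 * (w j * (1 + j%:R)) + 4 * (2 * K)))).
  apply: ler_sum => j _; rewrite -mulr_sumr.
  have h1 := inv_norm_sum ssm y (exprn_gt0 2 (w0 j)) (ew j) n.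
  have h2 := Exp_inv_norm_le y (w0 j) (lexx _).
  apply: (@le_trans _ _ (w j * (4 * (1 + j%:R + 2 * K * 2 ^+ j)))).
    rewrite ler_wpM2l ?(ltW (w0 j))//; apply: (le_trans h1); exact: ler_wpM2l.
  rewrite (_ : w j * _ = 4 * (w j * (1 + j%:R)) + 4 * (2 * K) * (w j * 2 ^+ j)); last by ring.
  by rewrite /w exprVn mulVf ?expf_neq0// mulr1.
rewrite big_split/= -mulr_sumr sumr_const card_ord -(mulr_natr (4 * _)).
by have := @dyadic_arith_sum R J; rewrite -/w; lra.
Qed.

(** The coefficient of [K] is small because [e] is at most [2^-18 * u] and [om
    * J] at most [2^-13]. *)
Lemma smooth_cdf_bound (y : R) :
  `|Exp (smooth_cdf eta v B (u ^+ 2) y n) - Phi (y / Num.sqrt (u ^+ 2 + B))| <=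
  4800 * (e * (1 + J%:R)) + 2304 * om + K / 4.
Proof.
have u20 : 0 < u ^+ 2 by rewrite exprn_gt0.
have eu : 200 * e <= Num.sqrt (u ^+ 2).
  rewrite sqrtr_sqr gtr0_norm//; apply: le_trans e_u.
  by rewrite ler_wpM2r//; lra.
apply: (le_trans (smooth_cdf_sum ssm y u20 eu n)).
have h1 := inv_norm_sum ssm y u20 eu n.
have ju : 2^-1 ^+ J <= u.
  have /andP[h _] := J_u.
  by rewrite exprVn -[leLHS]mul1r ler_pdivrMr ?exprn_gt0// mulrC.
have h2 := Exp_inv_norm_le y u0 ju.
have h3 := Exp_pdist_sq_le y.
have eJ : e * 2 ^+ J <= (2 ^+ 17)^-1.
  have /andP[_ h] := J_u.
  have : 2 ^+ 18 * e * 2 ^+ J <= 2 by apply: le_trans h; rewrite mulrC ler_wpM2l// exprn_ge0.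
  lra.
exact: smooth_bound_arith h1 h2 h3 eJ omJ.
Qed.


Let sqrt_total : Num.sqrt (u ^+ 2 + B) <= 1 + u /\ 1 <= Num.sqrt (u ^+ 2 + B).
Proof.
have /andP[d0 du] := delta_u.
have dd : delta ^+ 2 <= u ^+ 2 by rewrite lerXn2r ?nnegrE ?(ltW u0).
have u2 : u ^+ 2 <= u by rewrite expr2 ler_piMl ?(ltW u0).
have dd0 := sqr_ge0 delta; have uu0 := sqr_ge0 u.
split.
  rewrite -[leRHS](@ger0_norm _ (1 + u)); last by have := u0; lra.
  rewrite -sqrtr_sqr ler_sqrt ?sqr_ge0// sqrrD expr1n mul1r; lra.
by rewrite -[leLHS](@sqrtr1 R) ler_sqrt; lra.
Qed.

Let rem_var_final : {ae Q, forall x, Num.sqrt (rem_var v B (u ^+ 2) n x) <= 2 * u}.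
Proof.
have /andP[d0 du] := delta_u.
have dd : delta ^+ 2 <= u ^+ 2 by rewrite lerXn2r ?nnegrE ?(ltW u0).
apply: filterS S_ge => x hx.
rewrite -[leRHS]ger0_norm ?mulr_ge0 ?(ltW u0)// -sqrtr_sqr ler_sqrt ?sqr_ge0//.
by rewrite /rem_var exprMn; have := sqr_ge0 u; lra.
Qed.

(* Gaussian mass beyond [4 + s / 2], compared with [exp (- s)]. *)
Let gauss_far (A D s : R) : 0 < A -> A <= 2 * u -> 0 <= s -> u * (8 + s) <= D ->
  1 - Phi (D / A) <= 48^-1 * expR (- 1) * expR (- s).
Proof.
move=> A0 Au s0 hD.
have h : 4 + s / 2 <= D / A.
  rewrite ler_pdivlMr//; apply: le_trans hD.
  have : (4 + s / 2) * A <= (4 + s / 2) * (2 * u) by rewrite ler_wpM2l//; lra.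
  lra.
have DA0 : 0 <= D / A by lra.
apply: (le_trans (gauss_tail_le DA0)).
have e7 : 48 <= expR 7 :> R.
  by apply: le_trans (@expR_ge1Dxn R 7 2 _) => //; rewrite !factS fact0; lra.
apply: (@le_trans _ _ (expR (- 7) * expR (- 1) * expR (- s))); last first.
  rewrite ler_wpM2r ?expR_ge0// ler_wpM2r ?expR_ge0//.
  by rewrite expRN lef_pV2 ?posrE// expR_gt0.
rewrite -!expRD ler_expR.
have : (4 + s / 2) ^+ 2 <= (D / A) ^+ 2 by rewrite lerXn2r ?nnegrE; lra.
have := sqr_ge0 s; set q := (D / A) ^+ 2; rewrite !expr2; lra.
Qed.

Let Exp_tail_le (X : T -> R) b : measurable_fun setT X -> near_normal Q X K ->
  Exp (fun x => exp_tail u^-1 b (X x)) <= 2 * K + u.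
Proof.
move=> mX nX; have ui : 0 < u^-1 by rewrite invr_gt0.
have := exp_transfer b mX nX (ltW ui); have := gauss_laplace_le_inv b ui.
by rewrite invrK ler_norml; lra.
Qed.

Let integ_tail (X : T -> R) b : measurable_fun setT X ->
  integ (fun x => exp_tail u^-1 b (X x)).
Proof.
move=> mX; apply: (@integ_bounded _ _ _ _ _ 1).
  by apply: measurableT_comp mX; exact: measurable_exp_tail.
have ui : 0 <= u^-1 by rewrite invr_ge0 ltW.
by move=> x; have /andP[h1 h2] := exp_tail_bounds b ui (X x); rewrite ger0_norm.
Qed.

Let smooth_at y : Exp (smooth_cdf eta v B (u ^+ 2) y n) <= Phi y + u +
    (4800 * (e * (1 + J%:R)) + 2304 * om + K / 4) /\
  Phi y - u - (4800 * (e * (1 + J%:R)) + 2304 * om + K / 4) <=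
    Exp (smooth_cdf eta v B (u ^+ 2) y n).
Proof.
have := smooth_cdf_bound y; have [h1 h2] := sqrt_total.
have := Phi_scale y h2; rewrite !ler_norml.
set p := Exp _; set q := Phi (y / _); set m := _ + K / 4.
by move=> /andP[a1 a2] /andP[a3 a4]; split; lra.
Qed.

Let mset y : measurable [set x | Y n x <= y]. Proof. exact: measurable_le_set. Qed.

Let Exp_le_indic y : Exp (\1_[set x | Y n x <= y]) = fine (Q [set x | Y n x <= y]).
Proof. exact: Exp_indic. Qed.

(** Shifted by [8 * u], the smoothed distribution function bounds the true one
    up to an exponential tail of [Y n] at scale [u], whose mean is at most [2
    * K + u]. *)
Lemma kolmogorov_improve y : `|fine (Q [set x | Y n x <= y]) - Phi y| <=
  K / 2 + (4800 * (e * (1 + J%:R)) + 2304 * om + 6 * u).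
Proof.
have nY := near_normal_kolmogorov mY hK.
have nY' := near_normal_kolmogorovN mY hK.
have mY' : measurable_fun setT (fun x => - Y n x) by exact: measurableT_comp.
have u20 : 0 < u ^+ 2 by rewrite exprn_gt0.
have i1 := integ_indic Q (mset y).
have is_ z := integ_smooth_cdf ssm z u20 n.
rewrite -Exp_le_indic ler_norml; apply/andP; split.
- have [h1 h2] := smooth_at (y - 8 * u).
  have it := integ_tail y mY.
  have : Exp (smooth_cdf eta v B (u ^+ 2) (y - 8 * u) n) <=
    Exp (\1_[set x | Y n x <= y]) + 48^-1 * (2 * K + u).
    apply: (@le_trans _ _ (Exp (fun x => \1_[set x | Y n x <= y] x + 48^-1 * exp_tail u^-1 y (Y n x)))).
      apply: Exp_le_ae => //; first by apply: integD => //; exact: integZ.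
      apply: filterS rem_var_final => x hx.
      have A0 : 0 < Num.sqrt (rem_var v B (u ^+ 2) n x).
        by rewrite sqrtr_gt0; apply: lt_le_trans u20 (rem_var_ge ssm _ _ _).
      rewrite /smooth_cdf indicE exp_tailE.
      have [yx|yx] := leP (Y n x) y.
        by rewrite mem_set//= mulr0 addr0 Phi_le1.
      rewrite memNset/= ?add0r; last by apply/negP; rewrite -ltNge.
      rewrite (_ : y - 8 * u - Y n x = - (Y n x - y + 8 * u)); last by ring.
      rewrite mulNr PhiN.
      have s0 : 0 <= u^-1 * (Y n x - y) by rewrite mulr_ge0 ?invr_ge0 ?(ltW u0)//; lra.
      apply: (le_trans (gauss_far A0 hx s0 _)).
        by rewrite mulrDr mulrA divff ?gt_eqF// mul1r; lra.
      rewrite -mulrA ler_wpM2l// ler_piMl ?expR_ge0// expR_le1; lra.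
    rewrite RintegralD//; last exact: integZ.
    rewrite [X in _ + X <= _]RintegralZl// lerD2l ler_wpM2l//; exact: Exp_tail_le.
  have := @Phi_lip R y (y - 8 * u); rewrite (_ : y - (y - 8 * u) = 8 * u); last by ring.
  rewrite (gtr0_norm (_ : 0 < 8 * u)) ?mulr_gt0// ler_norml => /andP[l1 l2].
  move: h2 l2; set p := Exp _; set q := Exp _; set m := e * _.
  by have := u0; have := K0; lra.
- have [h1 h2] := smooth_at (y + 8 * u).
  have it := integ_tail (- y - u) mY'.
  have : Exp (\1_[set x | Y n x <= y]) <=
     Exp (smooth_cdf eta v B (u ^+ 2) (y + 8 * u) n) + 48^-1 * (2 * K + u).
    apply: (@le_trans _ _ (Exp (fun x => smooth_cdf eta v B (u ^+ 2) (y + 8 * u) n x + 48^-1 * exp_tail u^-1 (- y - u) (- Y n x)))).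
      apply: Exp_le_ae => //; first by apply: integD => //; exact: integZ.
      apply: filterS rem_var_final => x hx.
      have A0 : 0 < Num.sqrt (rem_var v B (u ^+ 2) n x).
        by rewrite sqrtr_gt0; apply: lt_le_trans u20 (rem_var_ge ssm _ _ _).
      have ui : 0 <= u^-1 by rewrite invr_ge0 ltW.
      rewrite indicE; have [yx|yx] := leP (Y n x) y; last first.
        rewrite memNset/=; last by apply/negP; rewrite -ltNge.
        rewrite addr_ge0// ?Phi_ge0// mulr_ge0//.
        by case/andP: (exp_tail_bounds (- y - u) ui (- Y n x)).
      rewrite mem_set//= exp_tailE ifT; last by have := u0; lra.
      rewrite /smooth_cdf.
      have s0 : 0 <= u^-1 * (y - Y n x) by rewrite mulr_ge0//; lra.
      have := @gauss_far _ (y + 8 * u - Y n x) _ A0 hx s0.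
      rewrite mulrDr mulrA divff ?gt_eqF// mul1r => /(_ ltac:(lra)).
      rewrite -mulrA -expRD.
      have -> : - 1 - u^-1 * (y - Y n x) = - (u^-1 * (- Y n x - (- y - u))).
        by field; rewrite gt_eqF.
      set p := expR _; lra.
    rewrite RintegralD//; last exact: integZ.
    rewrite [X in _ + X <= _]RintegralZl// lerD2l ler_wpM2l//; exact: Exp_tail_le.
  have := @Phi_lip R (y + 8 * u) y; rewrite (_ : y + 8 * u - y = 8 * u); last by ring.
  rewrite (gtr0_norm (_ : 0 < 8 * u)) ?mulr_gt0// ler_norml => /andP[l1 l2].
  move: h1 l2; set p := Exp _; set q := Exp _; set m := e * _.
  by have := u0; have := K0; lra.
Qed.

End berry_esseen_step.

(** An affine self-improvement with slope 1/2 pins down a supremum. *)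
Lemma self_improving_bound (R : realType) (D : R -> R) (c : R) :
  (forall y, 0 <= D y <= 1) ->
  (forall K, (forall y, D y <= K) -> forall y, D y <= K / 2 + c) ->
  forall y, D y <= 2 * c.
Proof.
move=> D01 H y; pose K := sup (range D).
have hs : has_sup (range D).
  split; first by exists (D 0), 0.
  by exists 1 => _ [z _ <-]; case/andP: (D01 z).
have ub z : D z <= K by apply: (sup_ubound (proj2 hs)); exists z.
have : K <= K / 2 + c.
  by apply: ge_sup; [case: hs|move=> _ [z _ <-]; exact: H].
by have := ub y; lra.
Qed.

Section logarithm_bounds.
Context (R : realType).

Lemma ln2_ge_half : 2^-1 <= ln 2 :> R.
Proof.
rewrite -ler_expR lnK ?posrE//.
have h := @expR_ge1Dx R (- 2^-1).
have : expR (2^-1) * 2^-1 <= 1 :> R.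
  apply: (@le_trans _ _ (expR (2^-1) * expR (- 2^-1))).
    by rewrite ler_wpM2l ?expR_ge0//; lra.
  by rewrite -expRD subrr expR0.
lra.
Qed.

Lemma abs_ln_ge_half (x : R) : 0 < x <= 2^-1 -> 2^-1 <= `|ln x|.
Proof.
move=> /andP[x0 x1].
have : ln x <= ln 2^-1 by rewrite ler_ln ?posrE.
rewrite lnV ?posrE// => h; have := ln2_ge_half => h2.
by rewrite ler0_norm; lra.
Qed.

Lemma le_mul_abs_ln (x : R) : 0 < x <= 2^-1 -> x <= 2 * (x * `|ln x|).
Proof.
move=> hx; have := abs_ln_ge_half hx; case/andP: hx => x0 _ h.
have : x * 2^-1 <= x * `|ln x| by rewrite ler_wpM2l// ltW.
lra.
Qed.

Lemma dyadic_scale (u : R) : 0 < u <= 1 -> exists J : nat, 1 <= 2 ^+ J * u <= 2.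
Proof.
move=> /andP[u0 u1].
have ex : exists J, 1 <= 2 ^+ J * u.
  have [m hm] : exists m : nat, u^-1 < m%:R.
    by exists (Num.bound u^-1); apply: archi_boundP; rewrite invr_ge0 ltW.
  exists m; rewrite -ler_pdivrMr// mul1r; apply: (le_trans (ltW hm)).
  elim: (m) => [|k IH]; first by rewrite expr0.
  have : 1 <= 2 ^+ k :> R by rewrite exprn_ege1// ler1n.
  by rewrite exprS -natr1; lra.
case: (ex_minnP ex) => J h1 hmin; exists J; rewrite h1/=.
case: J h1 hmin => [|J] _ hmin; first by rewrite expr0 mul1r; lra.
rewrite leNgt; apply/negP => h; have := hmin J; rewrite ltnn => hh.
by have : false by apply: hh; move: h; rewrite exprS; lra.
Qed.

Lemma dyadic_count (J : nat) (eps u : R) : 0 < eps <= 2^-1 -> eps <= u ->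
  2 ^+ J * u <= 2 -> J%:R <= 4 * `|ln eps|.
Proof.
move=> heps eu hJ; have lh := abs_ln_ge_half heps; case/andP: heps => eps0 eps1.
have h2 : 2 ^+ J <= 2 / eps.
  rewrite ler_pdivlMr//; apply: le_trans hJ; rewrite ler_wpM2l ?exprn_ge0//.
have : ln (2 ^+ J) <= ln (2 / eps).
  by rewrite ler_ln ?posrE ?exprn_gt0// divr_gt0.
rewrite lnXn// lnM ?posrE ?invr_gt0// lnV ?posrE// -[_ *+ J]mulr_natl.
have k1 := ln2_ge_half => k2.
have lE : - ln eps <= `|ln eps| by rewrite -normrN ler_norm.
have [J1|J1] := leP 1 (J%:R : R); last by lra.
have : (J%:R - 1) * 2^-1 <= (J%:R - 1) * ln 2 :> R.
  by apply: ler_wpM2l => //; lra.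
lra.
Qed.

End logarithm_bounds.

(** The smoothing scale [u] is a large multiple of [eps + delta]: it has to
    dominate the size of the steps, for the Taylor bounds, and the uncertainty
    of the total variance. Above it there are at most [4 * |ln eps|] dyadic
    scales, which explains the logarithm. *)
Theorem berry_esseen (R : realType) (L : R) : 1 <= L ->
  exists2 C : R, 0 < C & exists2 kappa : R, 0 < kappa &
  forall (d : measure_display) (T : measurableType d) (Q : probability T R)
    (F : nat -> set (set T)) (eta v : nat -> T -> R) (eps om delta : R) (n : nat),
    0 < eps <= 2^-1 -> 0 <= delta <= 2^-1 ->
    small_step_martingale Q F eta v (L * eps) om (1 + delta ^+ 2) ->
    {ae Q, forall w, 1 - delta ^+ 2 <= partial v n w} ->
    om * `|ln eps| <= kappa ->
    forall y, `|fine (Q [set w | partial eta n w <= y]) - std_normal_cdf y| <=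
      C * (eps * `|ln eps| + delta + om).
Proof.
move=> L1.
have [c0 c01 c0E] : exists2 c0 : R, 1 <= c0 & forall x, 2 ^+ 18 * (L * x) = c0 * x.
  by exists (2 ^+ 18 * L) => [|x]; [lra|rewrite mulrA].
have [C C0 CE] : exists2 C : R, 0 < C & forall x delta om, 0 <= x -> 0 <= delta -> 0 <= om ->
    2 * (4800 * (6 * L) * x + 2304 * om + 6 * (c0 * (2 * x + delta))) <= C * (x + delta + om) /\
    x <= 2 * (4800 * (6 * L) * x + 2304 * om + 6 * (c0 * (2 * x + delta))) - c0 * (2 * x + delta).
  exists (2 * (4800 * (6 * L) + 2304 + 12 * c0)) => [|x del om x0 del0 om0]; first by lra.
  have k1 : 0 <= c0 * del by rewrite mulr_ge0//; lra.
  have k2 : 0 <= L * del by rewrite mulr_ge0//; lra.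
  have k3 : 0 <= L * om by rewrite mulr_ge0//; lra.
  have k4 : 0 <= c0 * om by rewrite mulr_ge0//; lra.
  have k5 : x <= L * x by rewrite ler_peMl.
  have k6 : 0 <= c0 * x by rewrite mulr_ge0//; lra.
  by split; lra.
exists C => //.
exists (2 ^+ 15)^-1; first by rewrite invr_gt0 exprn_gt0.
move=> d T Q F eta v eps om delta n heps hdelta ssm hge hom y.
have /andP[eps0 eps1] := heps; have /andP[del0 del1] := hdelta.
have /andP[om0 om1] := ssm_om ssm.
have le1 := le_mul_abs_ln heps; have lh := abs_ln_ge_half heps.
set l := `|ln eps| in le1 lh hom *.
have l0 : 0 <= l by rewrite /l normr_ge0.
have el0 : 0 <= eps * l by apply: mulr_ge0 => //; exact: ltW.
have mY : measurable_fun setT (partial eta n).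
  by apply: (measurableT_wrt ssm (k := n)); apply: measurable_Y ssm n.
pose D z := `|fine (Q [set w | partial eta n w <= z]) - std_normal_cdf z|.
have D01 z : 0 <= D z <= 1.
  rewrite normr_ge0/= ler_norml.
  have := Phi_ge0 z; have := Phi_le1 z.
  have : 0 <= fine (Q [set w | partial eta n w <= z]) by rewrite fine_ge0.
  have mz := measurable_le_set z mY.
  have : fine (Q [set w | partial eta n w <= z]) <= 1.
    by rewrite -lee_fin fineK ?fin_num_measure//; exact: probability_le1.
  clear; lra.
pose u := c0 * (eps + delta).
have uD : u <= c0 * (2 * (eps * l) + delta).
  by apply: ler_wpM2l; [exact: le_trans c01|rewrite lerD2r].
have [CD CD'] := CE _ _ _ el0 del0 om0.
apply: le_trans CD.
have [u1|u1] := leP u 1; last first.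
  have /andP[_ h] := D01 y; apply: (le_trans h).
  by apply: (le_trans (ltW u1)); apply: (le_trans uD); rewrite -subr_ge0; exact: le_trans CD'.
have c00 : 0 < c0 by exact: lt_le_trans c01.
have u0 : 0 < u by apply: mulr_gt0 => //; exact: ltr_wpDr.
have u01 : 0 < u <= 1 by rewrite u0 u1.
have [J hJ] := dyadic_scale u01.
have ueps : eps + delta <= u by apply: ler_peMl => //; rewrite addr_ge0// ltW.
have J4 : J%:R <= 4 * l.
  have /andP[_ h] := hJ; apply: dyadic_count h => //.
  by apply: le_trans ueps; rewrite lerDl.
have omJ : om * J%:R <= (2 ^+ 13)^-1.
  apply: le_trans (_ : om * (4 * l) <= _); first by rewrite ler_wpM2l.
  by move: hom; clear; set x := om * l => h; rewrite mulrCA -/x; lra.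
have delta_u : 0 <= delta <= u.
  by rewrite del0/=; apply: le_trans ueps; rewrite lerDr ltW.
have e_u : 2 ^+ 18 * (L * eps) <= u.
  by rewrite c0E ler_wpM2l ?(ltW c00)// lerDl.
have key : D y <= 2 * (4800 * (L * eps * (1 + J%:R)) + 2304 * om + 6 * u).
  apply: self_improving_bound D01 _ _ => K hK z.
  exact: (kolmogorov_improve ssm hge u01 delta_u e_u hJ omJ hK z).
apply: (le_trans key); rewrite ler_wpM2l//.
have k : L * eps * (1 + J%:R) <= L * eps * (6 * l).
  apply: ler_wpM2l; first by rewrite mulr_ge0 ?(ltW eps0)// (le_trans _ L1).
  by move: J4 lh; clear; set j := J%:R; lra.
apply: lerD; last exact: ler_wpM2l.
rewrite lerD2r (_ : 4800 * (6 * L) * (eps * l) = 4800 * (L * eps * (6 * l))); last by ring.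
exact: (ler_wpM2l (ler0n _ _) k).
Qed.

(** * Cramer's change of measure *)

Section exponential_remainders.
Context (R : realType).
Implicit Types y t u : R.

Lemma expR_taylor0 y : `|expR y - 1| <= `|y| * expR `|y|.
Proof.
have := @mvt_norm_le R _ _ y (expR `|y|) (fun x => is_derive_expR x).
rewrite expR0 mulrC; apply=> s sy.
by rewrite ger0_norm ?expR_ge0// ler_expR (le_trans (ler_norm s)).
Qed.

Lemma expR_taylor1 y : `|expR y - 1 - y| <= `|y| ^+ 2 * expR `|y|.
Proof.
have d (x : R) : is_derive x 1 (fun x => expR x - x) (expR x - 1).
  by apply: is_derive_eq.
have h s : `|s| <= `|y| -> `|expR s - 1| <= expR `|y| * `|y|.
  move=> sy; apply: (le_trans (expR_taylor0 s)); rewrite mulrC.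
  by rewrite ler_pM ?expR_ge0// ler_expR.
have := @mvt_norm_le R _ _ y _ d h.
by rewrite expR0 subr0 addrAC -mulrA -expr2 mulrC.
Qed.

Lemma expR_taylor2 y : `|expR y - 1 - y - y ^+ 2 / 2| <= `|y| ^+ 3 * expR `|y|.
Proof.
have d (x : R) : is_derive x 1 (fun x : R => expR x - x - x ^+ 2 / 2) (expR x - 1 - x).
  rewrite (_ : (fun x : R => _) = (fun x : R => expR x - x - 2^-1 *: x ^+ 2)); last first.
    by apply/funext => z; rewrite /GRing.scale/= mulrC.
  by apply: is_derive_eq; rewrite /GRing.scale/=; field.
have h s : `|s| <= `|y| -> `|expR s - 1 - s| <= expR `|y| * `|y| ^+ 2.
  move=> sy; apply: (le_trans (expR_taylor1 s)); rewrite mulrC.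
  by rewrite ler_pM ?expR_ge0 ?ler_expR ?lerXn2r ?nnegrE.
have := @mvt_norm_le R _ _ y _ d h.
rewrite expR0 expr0n/= mul0r !subr0.
rewrite (_ : expR y - y - y ^+ 2 / 2 - 1 = expR y - 1 - y - y ^+ 2 / 2); last by ring.
by rewrite (_ : expR `|y| * `|y| ^+ 2 * `|y| = `|y| ^+ 3 * expR `|y|); [|ring].
Qed.

(** [cosh (u / 2) - 1], whose conditional mean carries all that is used of the
    moment condition. *)
Definition cosh1 u := (expR (u / 2) + expR (- (u / 2))) / 2 - 1.

Lemma cosh1N u : cosh1 (- u) = cosh1 u.
Proof. by rewrite /cosh1 mulNr opprK (addrC (expR (- _))). Qed.

Lemma cosh1_norm u : cosh1 `|u| = cosh1 u.
Proof. by case: (leP 0 u) => h; [rewrite ger0_norm|rewrite ltr0_norm// cosh1N]. Qed.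

Lemma cosh1_ge0 u : 0 <= cosh1 u.
Proof.
have a := expR_gt0 (u / 2); have e : expR (u / 2) * expR (- (u / 2)) = 1 by rewrite -expRD subrr expR0.
have := sqr_ge0 (expR (u / 2) - 1); rewrite /cosh1; set p := expR (u / 2) in a e *; set q := expR _ in e *.
have b : 0 < q by exact: expR_gt0.
have : (p - 1) ^+ 2 * q = p * (p * q) - 2 * (p * q) + q by ring.
rewrite e => h1 h2; have : 0 <= (p - 1) ^+ 2 * q by rewrite mulr_ge0// ltW.
rewrite h1; lra.
Qed.

Lemma expR_le_cosh1 t u : `|t| <= 2^-1 -> expR (t * u) <= 2 * (1 + cosh1 u).
Proof.
move=> t1; apply: (@le_trans _ _ (expR `|u / 2|)).
  rewrite ler_expR (le_trans (ler_norm _))// !normrM (@ger0_norm _ 2^-1)// mulrC.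
  by rewrite ler_wpM2l.
have a := expR_gt0 (u / 2); have b := expR_gt0 (- (u / 2)).
by case: (leP 0 (u / 2)) => h; [rewrite ger0_norm|rewrite ltr0_norm]; rewrite /cosh1; lra.
Qed.

(** With [y = |u| / 2] one has [cosh y - 1 >= expR y * y^2 / (2 * (1 + y)^2)],
    and [expR (7 * y / 8)] absorbs the powers of [1 + y]. *)
Lemma cube_le_cosh1 u :
  `|u| ^+ 3 * expR (`|u| / 16) <= 700 * cosh1 u /\
  `|u| ^+ 2 * expR (`|u| / 16) <= 700 * cosh1 u.
Proof.
rewrite -(cosh1_norm u); have : 0 <= `|u| by [].
move: `|u| => {}u u0; pose y := u / 2; have y0 : 0 <= y by rewrite divr_ge0.
have uE : u = 2 * y by rewrite /y; field.
have uE2 : u / 2 = y by [].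
clearbody y.
have y1 : 0 < 1 + y by lra.
have E := expR_gt0 y; have E' := expR_gt0 (- y).
have ee : expR y * expR (- y) = 1 by rewrite -expRD subrr expR0.
have low : y / (1 + y) <= 1 - expR (- y).
  rewrite ler_pdivrMr//; have := expR_ge1Dx y => h.
  have : (1 + y) * expR (- y) <= expR y * expR (- y) by rewrite ler_wpM2r// ltW.
  rewrite ee; lra.
have cE : cosh1 u = expR y * (1 - expR (- y)) ^+ 2 / 2.
  rewrite /cosh1 uE2 (_ : expR y * _ ^+ 2 = expR y - 2 * (expR y * expR (- y)) + expR y * expR (- y) * expR (- y)); last by ring.
  by rewrite ee; field.
have cl : expR y * (y / (1 + y)) ^+ 2 / 2 <= cosh1 u.
  rewrite cE ler_wpM2r// ler_wpM2l ?expR_ge0// lerXn2r ?nnegrE//.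
    by rewrite divr_ge0// ltW.
  by apply: le_trans low; rewrite divr_ge0// ltW.
pose z := 7 * y / 8.
have h3 : (1 + y) ^+ 3 <= 41 * expR z.
  have := @expR_ge_pow R 2 z (ltac:(by rewrite /z; lra)) => h.
  have : (1 + y) ^+ 3 <= (8 / 7 * (1 + z)) ^+ 3 by rewrite lerXn2r ?nnegrE /z; lra.
  have := expR_gt0 z; rewrite exprMn; lra.
have yz : expR y = expR z * expR (u / 16) by rewrite -expRD; congr expR; rewrite /z uE; field.
have G := expR_gt0 (u / 16).
have key (c p : R) : 0 <= p -> p * (1 + y) ^+ 2 <= c * expR z -> y ^+ 2 * p * expR (u / 16) <= 2 * c * cosh1 u.
  move=> p0 hp; apply: (@le_trans _ _ (2 * (expR y * (y / (1 + y)) ^+ 2 / 2) * c)); last first.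
    have c0 : 0 <= c.
      by rewrite -(pmulr_lge0 _ (expR_gt0 z)); apply: le_trans hp; rewrite mulr_ge0// sqr_ge0.
    by rewrite mulrAC ler_wpM2l// mulr_ge0.
  rewrite yz expr_div_n.
  rewrite (_ : _ * c = (y ^+ 2 * expR (u / 16)) * (c * expR z / (1 + y) ^+ 2)); last by field; rewrite gt_eqF.
  rewrite mulrAC ler_wpM2l ?mulr_ge0 ?sqr_ge0 ?(ltW G)//.
  by rewrite ler_pdivlMr ?exprn_gt0.
have y13 : (1 + y) ^+ 2 <= (1 + y) ^+ 3 by rewrite ler_weXn2l//; lra.
split.
- have := @key 328 (8 * y) ltac:(lra).
  rewrite (_ : u ^+ 3 = y ^+ 2 * (8 * y)); last by rewrite uE; ring.
  move=> /(_ _) h; apply: le_trans (h _) _.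
    have : (1 + y) ^+ 3 = (1 + y) ^+ 2 + y * (1 + y) ^+ 2 by ring.
    have := sqr_ge0 (1 + y); move: h3; set a := (1 + y) ^+ 2; set b := (1 + y) ^+ 3; set g := expR z; lra.
  by have := cosh1_ge0 u; lra.
- have := @key 328 4 ltac:(lra).
  rewrite (_ : u ^+ 2 = y ^+ 2 * 4); last by rewrite uE; ring.
  move=> /(_ _) h; apply: le_trans (h _) _.
    by have := sqr_ge0 (1 + y); move: h3 y13; set a := (1 + y) ^+ 2; set b := (1 + y) ^+ 3; set g := expR z; lra.
  by have := cosh1_ge0 u; lra.
Qed.

Section small_tilt.
Variables (t u : R).
Hypothesis t01 : 0 <= t <= 16^-1.
Notation psi := (cosh1 u).

Let t0 : 0 <= t. Proof. by case/andP: t01. Qed.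
Let tu : `|t * u| = t * `|u|. Proof. by rewrite normrM ger0_norm. Qed.
Let etu : expR `|t * u| <= expR (`|u| / 16).
Proof. by rewrite tu ler_expR mulrC ler_wpM2l//; case/andP: t01. Qed.

(** Taylor remainders of the exponential at [t * u], with the growth in [u]
    collected in [cosh1 u]. *)
Lemma tilt_exp1 : `|expR (t * u) - 1 - t * u| <= 700 * t ^+ 2 * psi.
Proof.
apply: (le_trans (expR_taylor1 _)); rewrite tu exprMn -tu.
have [_ h] := cube_le_cosh1 u.
apply: (@le_trans _ _ (t ^+ 2 * (`|u| ^+ 2 * expR (`|u| / 16)))).
  by rewrite -mulrA ler_wpM2l ?sqr_ge0// ler_wpM2l// sqr_ge0.
by rewrite (mulrC 700) -[leRHS]mulrA ler_wpM2l ?sqr_ge0.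
Qed.

Lemma tilt_exp2 : `|expR (t * u) - 1 - t * u - (t * u) ^+ 2 / 2| <= 700 * t ^+ 3 * psi.
Proof.
apply: (le_trans (expR_taylor2 _)); rewrite tu exprMn -tu.
have [h _] := cube_le_cosh1 u.
apply: (@le_trans _ _ (t ^+ 3 * (`|u| ^+ 3 * expR (`|u| / 16)))).
  by rewrite -mulrA ler_wpM2l ?exprn_ge0// ler_wpM2l// exprn_ge0.
by rewrite (mulrC 700) -[leRHS]mulrA ler_wpM2l ?exprn_ge0.
Qed.

Lemma tilt_mean : `|u * expR (t * u) - u - t * u ^+ 2| <= 700 * t ^+ 2 * psi.
Proof.
rewrite (_ : _ - _ - _ = u * (expR (t * u) - 1 - t * u)); last by ring.
rewrite normrM; apply: (@le_trans _ _ (`|u| * (`|t * u| ^+ 2 * expR (`|u| / 16)))).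
  rewrite ler_wpM2l//; apply: (le_trans (expR_taylor1 _)).
  by rewrite ler_wpM2l ?sqr_ge0.
have [h _] := cube_le_cosh1 u.
rewrite tu exprMn (_ : `|u| * _ = t ^+ 2 * (`|u| ^+ 3 * expR (`|u| / 16))); last by ring.
by rewrite (mulrC 700) -[leRHS]mulrA ler_wpM2l ?sqr_ge0.
Qed.

Lemma tilt_square : `|u ^+ 2 * expR (t * u) - u ^+ 2| <= 700 * t * psi.
Proof.
rewrite (_ : _ - _ = u ^+ 2 * (expR (t * u) - 1)); last by ring.
rewrite normrM; apply: (@le_trans _ _ (`|u ^+ 2| * (`|t * u| * expR (`|u| / 16)))).
  by rewrite ler_wpM2l//; apply: (le_trans (expR_taylor0 _)); rewrite ler_wpM2l.
have [h _] := cube_le_cosh1 u.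
rewrite tu normrX (_ : `|u| ^+ 2 * _ = t * (`|u| ^+ 3 * expR (`|u| / 16))); last by ring.
by rewrite (mulrC 700) -[leRHS]mulrA ler_wpM2l.
Qed.

Lemma tilt_cube : `|u| ^+ 3 * expR (t * u) <= 700 * psi.
Proof.
have [h _] := cube_le_cosh1 u; apply: le_trans h.
rewrite ler_wpM2l ?exprn_ge0//; apply: le_trans etu.
by rewrite ler_expR ler_norm.
Qed.

End small_tilt.
End exponential_remainders.

Record is_density (d : measure_display) (T : measurableType d) (R : realType)
  (P : probability T R) (W : T -> R) : Prop := IsDensity {
  density_measurable : measurable_fun setT W ;
  density_ge0 : forall w, 0 <= W w ;
  density_mass : (\int[P]_w (W w)%:E = 1)%E }.

Definition tilted (d : measure_display) (T : measurableType d) (R : realType)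
  (P : probability T R) (W : T -> R) (hW : is_density P W) : set T -> \bar R :=
  fun A => (\int[P]_(w in A) (W w)%:E)%E.

Section tilted_probability.
Context (d : measure_display) (T : measurableType d) (R : realType).
Variables (P : probability T R) (W : T -> R) (hW : is_density P W).
Local Notation nu := (tilted hW).

Let nu0 : nu set0 = 0%E. Proof. by rewrite /tilted integral_set0. Qed.

Let nu_ge0 A : (0 <= nu A)%E.
Proof. by apply: integral_ge0 => w _; rewrite lee_fin; exact: (density_ge0 hW). Qed.

Let nu_sigma_additive : semi_sigma_additive nu.
Proof.
apply: (@semi_sigma_additive_nng_induced _ _ _ P (EFin \o W)).
  by apply/measurable_EFinP; case: hW.
by move=> w; rewrite lee_fin; exact: (density_ge0 hW).
Qed.

HB.instance Definition _ := isMeasure.Build _ _ _ nu nu0 nu_ge0 nu_sigma_additive.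

Let nuT : nu setT = 1%E. Proof. exact: density_mass. Qed.

HB.instance Definition _ := @Measure_isProbability.Build _ _ R nu nuT.

Definition tilted_prob : probability T R := nu.

Lemma integral_tilted (f : T -> R) : measurable_fun setT f -> (forall w, 0 <= f w) ->
  (\int[tilted_prob]_w (f w)%:E = \int[P]_w (f w * W w)%:E)%E.
Proof.
move=> mf f0; apply: (@ge0_integral_density _ _ _ P tilted_prob W f) => //; first by case: hW.
exact: (density_ge0 hW).
Qed.

End tilted_probability.

(** Martingale differences [x] with conditional variances [v], under the
    moment condition in the form in which it is used, which is symmetric in
    [x]. The bounds on [v] hold everywhere, and everything vanishes from [n]
    on, so that the filtration is indexed by all of [nat]. *)
Record bernstein_martingale (d : measure_display) (T : measurableType d)
  (R : realType) (P : probability T R) (F : nat -> set (set T))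
  (x v : nat -> T -> R) (n : nat) (eps B : R) : Prop := BernsteinMartingale {
  bm_sigma : forall i, sigma_algebra [set: T] (F i) ;
  bm_sub : forall i, F i `<=` measurable ;
  bm_mono : forall i, F i `<=` F i.+1 ;
  bm_adapted : forall i, measurable_wrt (F i.+1) (x i) ;
  bm_predictable : forall i, measurable_wrt (F i) (v i) ;
  bm_eps : 0 < eps ;
  bm_v : forall i w, 0 <= v i w <= 12 * eps ^+ 2 ;
  bm_total : forall k w, partial v k w <= B ;
  bm_mean_ge : forall i, cge0 P (F i) (x i) ;
  bm_mean_le : forall i, cge0 P (F i) (fun w => - x i w) ;
  bm_var_le : forall i, cge0 P (F i) (fun w => v i w - x i w ^+ 2) ;
  bm_var_ge : forall i, cge0 P (F i) (fun w => x i w ^+ 2 - v i w) ;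
  bm_cosh : forall i,
    cge0 P (F i) (fun w => v i w / (6 * eps ^+ 2) - cosh1 (x i w / eps)) ;
  bm_stop : forall i w, (n <= i)%N -> x i w = 0 /\ v i w = 0 }.

Section weights.
Context (d : measure_display) (T : measurableType d) (R : realType).
Variables (P : probability T R) (F : nat -> set (set T)).
Variables (x v m : nat -> T -> R) (n : nat) (eps B lam : R).
Notation integ h := (P.-integrable setT (EFin \o h)).
Notation psi i := (fun w => cosh1 (x i w / eps)).

Hypothesis bm : bernstein_martingale P F x v n eps B.
Hypothesis lam_small : 0 <= lam * eps <= 16^-1.
(* [m i] plays the conditional mean of [expR (lam * x i)]. *)
Hypothesis mm : forall i, measurable_wrt (F i) (m i).
Hypothesis m1 : forall i w, 1 <= m i w.
Hypothesis m_ge : forall i, cge0 P (F i) (fun w => m i w - expR (lam * x i w)).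
Hypothesis m_le : forall i, cge0 P (F i) (fun w => expR (lam * x i w) - m i w).
Hypothesis m_stop : forall i w, (n <= i)%N -> m i w = 1.

Let m_gt0 i w : 0 < m i w. Proof. exact: lt_le_trans (m1 i w). Qed.

Definition weight k w := \prod_(i < k) (expR (lam * x i w) / m i w).
Notation W := weight.

Lemma weightS k w : W k.+1 w = W k w * (expR (lam * x k w) / m k w).
Proof. by rewrite /weight big_ord_recr. Qed.

Lemma weight_gt0 k w : 0 < W k w.
Proof. by apply: prodr_gt0 => i _; rewrite divr_gt0 ?expR_gt0. Qed.

Lemma weight_stop N w : (n <= N)%N -> W N w = W n w.
Proof.
elim: N => [|N IH]; first by rewrite leqn0 => /eqP ->.
rewrite leq_eqVlt => /predU1P[->//|]; rewrite ltnS => nN.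
rewrite weightS IH// m_stop//; have [-> _] := bm_stop bm w nN.
by rewrite mulr0 expR0 divr1 mulr1.
Qed.

Let mw_le i j (f : T -> R) : (i <= j)%N -> measurable_wrt (F i) f -> measurable_wrt (F j) f.
Proof. by apply: measurable_wrt_le; exact: (bm_mono bm). Qed.

Let mexp i : measurable_wrt (F i.+1) (fun w => expR (lam * x i w)).
Proof.
by apply: mw_comp => //; apply: mwM; [exact: mw_cst|exact: (bm_adapted bm)].
Qed.

Let mT i (f : T -> R) : measurable_wrt (F i) f -> measurable_fun setT f.
Proof. by apply: measurable_wrt_sub; exact: (bm_sub bm). Qed.

Lemma measurable_weight k : measurable_wrt (F k) (W k).
Proof.
apply: mw_prod => i; apply: mwM.
  by apply: (@mw_le i.+1 k) => //; exact: mexp.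
by apply: mwV => //; apply: (@mw_le i k); [exact: ltnW|exact: mm].
Qed.

Let prev k w := W k w / m k w.
Let prev_ge0 k w : 0 <= prev k w.
Proof. by rewrite divr_ge0// ltW// weight_gt0. Qed.
Let mprev k : measurable_wrt (F k) (prev k).
Proof. by apply: mwM; [exact: measurable_weight|apply: mwV => //; exact: mm]. Qed.

Let set_le i (f g : T -> R) : integ f -> integ g -> cge0 P (F i) (fun w => g w - f w) ->
  forall A, F i A -> (\int[P]_(w in A) (f w)%:E <= \int[P]_(w in A) (g w)%:E)%E.
Proof. by move=> iF ig; rewrite cge0B//; exact: (bm_sub bm). Qed.

Lemma integ_psi i : integ (psi i).
Proof.
have iv : integ (fun w => v i w / (6 * eps ^+ 2)).
  apply: (@integ_bounded _ _ _ _ _ 2).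
    by apply: (@mT i); apply: mwM; [exact: (bm_predictable bm)|exact: mw_cst].
  move=> w; have /andP[v0 v1] := bm_v bm i w; have e0 := bm_eps bm.
  have e2 : 0 < 6 * eps ^+ 2 by rewrite mulr_gt0// exprn_gt0.
  by rewrite ger0_norm ?divr_ge0 ?(ltW e2)// ler_pdivrMr//; lra.
have [ic _] := bm_cosh bm i.
have := integB iv ic; congr (integ _); apply/funext => w; ring.
Qed.

Let mpsi i : measurable_wrt (F i.+1) (psi i).
Proof.
apply: (@mw_comp _ _ _ _ (@cosh1 R) (fun w => x i w / eps)).
  apply: measurable_funB => //; apply: measurable_funM => //.
  apply: measurable_funD; apply: measurableT_comp => //.
    by apply: measurable_funM.
  by apply: measurableT_comp => //; apply: measurable_funM.
by apply: mwM; [exact: (bm_adapted bm)|exact: mw_cst].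
Qed.

Lemma exp_tilt_le i w : expR (lam * x i w) <= 2 * (1 + cosh1 (x i w / eps)).
Proof.
have e0 := bm_eps bm.
rewrite (_ : lam * x i w = (lam * eps) * (x i w / eps)); last by field; rewrite gt_eqF.
apply: expR_le_cosh1; rewrite ger0_norm; case/andP: lam_small => // _; lra.
Qed.

Lemma integ_exp i : integ (fun w => expR (lam * x i w)).
Proof.
apply: (@integ_le _ _ _ _ _ (fun w => 2 * (1 + psi i w))).
- exact: (mT (@mexp i)).
- by apply: integZ; apply: integD; [exact: integ_cst|exact: integ_psi].
- by move=> w; rewrite ger0_norm ?expR_ge0// exp_tilt_le.
Qed.

Let integ_m i : integ (m i).
Proof.
have [ic _] := m_ge i; have := integD ic (integ_exp i); congr (integ _).
by apply/funext => w; rewrite subrK.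
Qed.

(** The new factor of the weight has conditional mean one. *)
Lemma integral_weightS k (g : T -> R) : measurable_wrt (F k) g -> (forall w, 0 <= g w) ->
  (\int[P]_w (g w * W k.+1 w)%:E = \int[P]_w (g w * W k w)%:E)%E.
Proof.
move=> mg g0; pose f w := g w * prev k w.
have mf : measurable_wrt (F k) f by exact: mwM.
have f0 w : 0 <= f w by rewrite mulr_ge0.
transitivity (\int[P]_w (f w * expR (lam * x k w))%:E)%E.
  by apply: eq_integral => w _; congr EFin; rewrite weightS /f /prev; ring.
transitivity (\int[P]_w (f w * m k w)%:E)%E; last first.
  by apply: eq_integral => w _; congr EFin; rewrite /f /prev -mulrA divfK// gt_eqF.
have me := mT (@mexp k); have mmk := mT (@mm k).
have e0 w : 0 <= expR (lam * x k w) by exact: expR_ge0.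
have mk0 w : 0 <= m k w by exact: ltW.
apply/eqP; rewrite eq_le; apply/andP; split.
- apply: (ge0_le_integral_sub (bm_sigma bm k) (@bm_sub _ _ _ _ _ _ _ _ _ _ bm k)) => //.
  by apply: set_le => //; exact: integ_exp.
- apply: (ge0_le_integral_sub (bm_sigma bm k) (@bm_sub _ _ _ _ _ _ _ _ _ _ bm k)) => //.
  by apply: set_le => //; exact: integ_exp.
Qed.

Lemma integral_weight k N (g : T -> R) : (k <= N)%N -> measurable_wrt (F k) g ->
  (forall w, 0 <= g w) ->
  (\int[P]_w (g w * W N w)%:E = \int[P]_w (g w * W k w)%:E)%E.
Proof.
move=> kN mg g0; elim: N kN => [|N IH]; first by rewrite leqn0 => /eqP <-.
rewrite leq_eqVlt => /predU1P[<-//|]; rewrite ltnS => kN.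
by rewrite integral_weightS ?IH//; exact: (mw_le kN mg).
Qed.

Lemma weight_density k : is_density P (W k).
Proof.
split; first exact: (mT (@measurable_weight k)).
  by move=> w; exact: ltW (weight_gt0 k w).
have := @integral_weight 0 k (fun=> 1) (leq0n k) (@mw_cst _ _ _ _ 1) (fun=> ler01).
under eq_integral do rewrite mul1r.
move=> ->; under eq_integral do rewrite /weight big_ord0 mulr1.
by have := @integral_cst _ _ _ P _ measurableT 1%:E; rewrite /= probability_setT mule1.
Qed.

Definition tilt : probability T R := tilted_prob (weight_density n).

Lemma integral_tilt k (g : T -> R) : measurable_wrt (F k) g -> (forall w, 0 <= g w) ->
  (\int[tilt]_w (g w)%:E = \int[P]_w (g w * W k w)%:E)%E.
Proof.
move=> mg g0; rewrite integral_tilted//; last exact: mT mg.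
transitivity (\int[P]_w (g w * W (maxn n k) w)%:E)%E.
  by apply: eq_integral => w _; rewrite (weight_stop w (leq_maxl n k)).
by apply: integral_weight => //; exact: leq_maxr.
Qed.

(** Conditionally on the past, the [k]-th step of the tilted law is that of
    [P] reweighted by [expR (lam * x k)] alone. *)
Lemma cge0_tilt k (h : T -> R) (c : R) : measurable_wrt (F k.+1) h ->
  (forall w, `|h w| * expR (lam * x k w) <= c * (1 + psi k w)) ->
  cge0 P (F k) (fun w => h w * expR (lam * x k w)) -> cge0 tilt (F k) h.
Proof.
move=> mh hc ch; have FMk := @bm_sub _ _ _ _ _ _ _ _ _ _ bm k.
have sFk := bm_sigma bm k.
have step (g : T -> R) (f : T -> R) : measurable_wrt (F k.+1) g -> (forall w, 0 <= g w) ->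
    measurable_wrt (F k) f -> (forall w, 0 <= f w) ->
    (\int[tilt]_w (f w * g w)%:E = \int[P]_w ((f w * prev k w) * (g w * expR (lam * x k w)))%:E)%E.
  move=> mg g0 mf f0; rewrite (@integral_tilt k.+1).
  - by apply: eq_integral => w _; congr EFin; rewrite weightS /prev; ring.
  - by apply: mwM => //; exact: (mw_le (leqnSn k) mf).
  - by move=> w; rewrite mulr_ge0.
have e0 := bm_eps bm.
have hE w : 0 <= expR (lam * x k w) by exact: expR_ge0.
have int_h : tilt.-integrable setT (EFin \o h).
  apply/integrableP; split; first by apply/measurable_EFinP; exact: mT mh.
  have -> : (\int[tilt]_w `|(EFin \o h) w| = \int[tilt]_w (1 * `|h w|)%:E)%E.
    by apply: eq_integral => w _; rewrite mul1r.
  rewrite (step (fun w => `|h w|) (fun=> 1))//; [|exact: mw_norm|exact: mw_cst].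
  apply: (@le_lt_trans _ _ (\int[P]_w ((c * prev k w) * (1 + psi k w))%:E)%E).
    apply: ge0_le_integral => //.
    - by move=> w _; rewrite lee_fin mul1r mulr_ge0// mulr_ge0.
    - apply/measurable_EFinP; apply: (@mT k.+1); apply: mwM.
        by apply: mwM; [exact: mw_cst|exact: (mw_le (leqnSn k) (@mprev k))].
      by apply: mwM; [exact: mw_norm|exact: mexp].
    - apply/measurable_EFinP; apply: (@mT k.+1); apply: mwM.
        by apply: mwM; [exact: mw_cst|exact: (mw_le (leqnSn k) (@mprev k))].
      by apply: mwD; [exact: mw_cst|exact: mpsi].
    - move=> w _; rewrite lee_fin mul1r (mulrC c) -[leRHS]mulrA.
      by rewrite ler_wpM2l.
  have c0 : 0 <= c.
    have p := cosh1_ge0 (x k point / eps).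
    rewrite -(@pmulr_lge0 _ (1 + psi k point)); last lra.
    by apply: le_trans (hc point); rewrite mulr_ge0.
  apply: (@le_lt_trans _ _ (\int[P]_w ((c * prev k w) * (1 + v k w / (6 * eps ^+ 2)))%:E)%E).
    apply: (ge0_le_integral_sub sFk FMk).
    - by apply: (@mT k.+1); apply: mwD; [exact: mw_cst|exact: mpsi].
    - by apply: (@mT k); apply: mwD; [exact: mw_cst|apply: mwM; [exact: (bm_predictable bm)|exact: mw_cst]].
    - by move=> w; have := cosh1_ge0 (x k w / eps); lra.
    - by move=> w; have /andP[v0 _] := bm_v bm k w; rewrite addr_ge0// divr_ge0// mulr_ge0// sqr_ge0.
    - apply: set_le.
      + by apply: integD; [exact: integ_cst|exact: integ_psi].
      + apply: integD; first exact: integ_cst.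
        have [ic _] := bm_cosh bm k; have := integD ic (integ_psi k); congr (integ _).
        by apply/funext => w; rewrite subrK.
      + have := bm_cosh bm k; congr (cge0 _ _ _); apply/funext => w; ring.
    - by apply: mwM; [exact: mw_cst|exact: mprev].
    - by move=> w; rewrite mulr_ge0.
  apply: (@le_lt_trans _ _ (\int[P]_w ((3 * c)%:E * (W k w)%:E))%E).
    apply: ge0_le_integral => //.
    - move=> w _; rewrite lee_fin mulr_ge0//; first by rewrite mulr_ge0.
      by have /andP[v0 _] := bm_v bm k w; rewrite addr_ge0// divr_ge0// mulr_ge0// sqr_ge0.
    - apply/measurable_EFinP; apply: (@mT k); apply: mwM.
        by apply: mwM; [exact: mw_cst|exact: mprev].
      by apply: mwD; [exact: mw_cst|apply: mwM; [exact: (bm_predictable bm)|exact: mw_cst]].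
    - apply/measurable_EFinP; apply: (@mT k); apply: mwM; first exact: mw_cst.
      exact: measurable_weight.
    - move=> w _; rewrite -EFinM lee_fin.
      have /andP[v0 v1] := bm_v bm k w.
      have e2 : 0 < 6 * eps ^+ 2 by rewrite mulr_gt0// exprn_gt0.
      have h3 : 1 + v k w / (6 * eps ^+ 2) <= 3.
        have : v k w / (6 * eps ^+ 2) <= 2 by rewrite ler_pdivrMr//; lra.
        lra.
      apply: (@le_trans _ _ (c * prev k w * 3)).
        by rewrite ler_wpM2l// mulr_ge0.
      rewrite (_ : _ * 3 = 3 * c * prev k w); last by ring.
      rewrite ler_wpM2l ?mulr_ge0//.
      by rewrite /prev ler_pdivrMr// ler_peMr// ltW// weight_gt0.
  rewrite ge0_integralZl//.
  - by rewrite (density_mass (weight_density k)) mule1 ltry.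
  - by apply/measurable_EFinP; exact: (mT (@measurable_weight k)).
  - by move=> w _; rewrite lee_fin; exact: ltW (weight_gt0 k w).
  - by rewrite lee_fin mulr_ge0.
have [ich _] := ch.
apply/(cge0_posneg FMk int_h) => A FA; have mA := FMk A FA.
have ind (g : T -> R) : measurable_wrt (F k.+1) g -> (forall w, 0 <= g w) ->
   (\int[tilt]_(w in A) (g w)%:E = \int[P]_w ((\1_A w * prev k w) * (g w * expR (lam * x k w)))%:E)%E.
  move=> mg g0; rewrite -step//; last exact: measurable_wrt_indic.
  rewrite integral_mkcond; apply: eq_integral => w _; rewrite patchE indicE /=.
  by case: ifP => _; rewrite ?mul1r ?mul0r.
have mmax (g : T -> R) : measurable_wrt (F k.+1) g -> measurable_wrt (F k.+1) (fun w => Num.max (g w) 0).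
  by move=> mg; apply: mw_max => //; exact: mw_cst.
have max0 (a : R) : 0 <= Num.max a 0 by rewrite le_max lexx orbT.
have maxM (a b : R) : 0 <= b -> Num.max a 0 * b = Num.max (a * b) 0.
  by move=> b0; rewrite maxr_pMl// mul0r.
rewrite !ind//; [|exact: mmax|by apply: mmax; exact: mwN].
have mmax' (g : T -> R) : measurable_wrt (F k.+1) g -> measurable_fun setT (fun w => Num.max (g w) 0 * expR (lam * x k w)).
  by move=> mg; apply: (@mT k.+1); apply: mwM => //; exact: mmax.
apply: (ge0_le_integral_sub sFk FMk).
- by apply: mmax'; exact: mwN.
- exact: mmax'.
- by move=> w; rewrite mulr_ge0.
- by move=> w; rewrite mulr_ge0.
- move=> D FD; have /(cge0_posneg FMk ich) H := ch.
  under eq_integral do rewrite maxM// mulNr.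
  by under [in leRHS]eq_integral do rewrite maxM//; exact: H.
- by apply: mwM; [exact: measurable_wrt_indic|exact: mprev].
- by move=> w; rewrite mulr_ge0.
Qed.

End weights.

Section conditional_tools.
Context (d : measure_display) (T : measurableType d) (R : realType).
Variables (P : probability T R) (G : set (set T)).
Hypotheses (sG : sigma_algebra setT G) (GM : G `<=` measurable).
Notation integ h := (P.-integrable setT (EFin \o h)).

Lemma cge0_mul_null (M : R) (f h : T -> R) : cge0 P G h -> cge0 P G (fun w => - h w) ->
  measurable_wrt G f -> (forall w, `|f w| <= M) -> cge0 P G (fun w => f w * h w).
Proof.
move=> h1 h2 mf fM.
rewrite (_ : (fun w => _) = fun w => Num.max (f w) 0 * h w + Num.max (- f w) 0 * - h w); last first.
  apply/funext => w; case: (leP (f w) 0) => a; case: (leP (- f w) 0) => b.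
  - have f0 : f w = 0 by lra.
    by rewrite f0; ring.
  - by ring.
  - by ring.
  - by exfalso; lra.
apply: (cge0D GM); apply: (@cge0_mul_bounded _ _ _ _ _ sG GM M) => //.
- by apply: mw_max => //; exact: mw_cst.
- by move=> w; have := fM w; rewrite ler_norml => /andP[? ?]; case: (leP (f w) 0) => ?; lra.
- by apply: mw_max; [exact: mwN|exact: mw_cst].
- by move=> w; have := fM w; rewrite ler_norml => /andP[? ?]; case: (leP (- f w) 0) => ?; lra.
Qed.

Lemma condexp_cge0 (h : T -> R) : integ h ->
  [/\ measurable_wrt G (condexp P G h), integ (condexp P G h),
      cge0 P G (fun w => condexp P G h w - h w) &
      cge0 P G (fun w => h w - condexp P G h w)].
Proof.
move=> ih; have [mY iY YE] := condexpP sG GM ih; split=> //.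
  by apply/(cge0B GM ih iY) => A /YE ->.
by apply/(cge0B GM iY ih) => A /YE ->.
Qed.

(** A version of the conditional expectation that obeys the expected bounds
    everywhere. *)
Lemma clamped_condexp (h a b : T -> R) : integ h ->
  measurable_wrt G a -> measurable_wrt G b -> (forall w, a w <= b w) ->
  cge0 P G (fun w => h w - a w) -> cge0 P G (fun w => b w - h w) ->
  exists m : T -> R, [/\ measurable_wrt G m, forall w, a w <= m w <= b w,
    cge0 P G (fun w => m w - h w) & cge0 P G (fun w => h w - m w)].
Proof.
move=> ih ma mb ab ca cb.
have [mY iY Y1 Y2] := condexp_cge0 ih.
set Y := condexp P G h in mY iY Y1 Y2.
have aY : {ae P, forall w, 0 <= Y w - a w}.
  apply: (cge0_ae sG GM); last exact: mwB.
  by have := cge0D GM Y1 ca; congr (cge0 _ _ _); apply/funext => w; ring.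
have Yb : {ae P, forall w, 0 <= b w - Y w}.
  apply: (cge0_ae sG GM); last exact: mwB.
  by have := cge0D GM Y2 cb; congr (cge0 _ _ _); apply/funext => w; ring.
pose m w := Num.max (a w) (Num.min (Y w) (b w)).
have mm : measurable_wrt G m by apply: mw_max => //; exact: mw_min.
have Ym : {ae P, forall w, Y w = m w}.
  move: aY; apply: filterS2 Yb => w /= h1 h2; rewrite /m min_l; last lra.
  by rewrite max_r//; lra.
have im : integ m.
  have ia : integ a.
    have [i1 _] := ca; have := integB ih i1; congr (integ _); apply/funext => w; ring.
  have ib : integ b.
    have [i1 _] := cb; have := integD ih i1; congr (integ _); apply/funext => w; ring.
  apply: (@integ_le _ _ _ _ _ (fun w => `|a w| + `|b w|)).
  - exact: measurable_wrt_sub mm.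
  - by apply: integD; exact: integrable_norm.
  - move=> w; have : a w <= m w <= b w.
      rewrite /m le_max lexx/= ge_max ab/= ge_min lexx orbT//.
    move=> /andP[h1 h2]; rewrite ler_norml; apply/andP; split.
      by have := ler_norm (- a w); rewrite normrN; have := normr_ge0 (b w); lra.
    by have := ler_norm (b w); have := normr_ge0 (a w); lra.
exists m; split=> //.
- by move=> w; rewrite /m le_max lexx/= ge_max ab/= ge_min lexx orbT.
- apply: (cge0_ae_eq GM Y1); first exact: integB.
  by apply: filterS Ym => w /= ->.
- apply: (cge0_ae_eq GM Y2); first exact: integB.
  by apply: filterS Ym => w /= ->.
Qed.

End conditional_tools.

(* Here [u] is a step divided by [eps], [s] its conditional variance and [t =
   lam * eps]. Each tilted moment is bounded by a combination of [u], [u^2 -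
   s] and [s / 6 - psi], whose conditional means under the original law are
   zero, zero and nonnegative. *)
Section tilted_moments.
Context (R : realType).
Variables (t s u : R).
Hypotheses (t01 : 0 <= t <= (4 * 4000)^-1) (s01 : 0 <= s <= 12).
Notation psi := (cosh1 u).
Notation e := (expR (t * u)).

Let t16 : 0 <= t <= 16^-1. Proof. by case/andP: t01 => h1 h2; lra. Qed.
Let t0 : 0 <= t. Proof. by case/andP: t01. Qed.
Let s0 : 0 <= s. Proof. by case/andP: s01. Qed.
Let t1 : t <= 1. Proof. by case/andP: t16 => _ h; lra. Qed.
Let q0 : 0 <= 1 + 240 * t. Proof. by move: t0; lra. Qed.
Let q1 : 0 <= 1 - 240 * t. Proof. by case/andP: t01 => _ h; lra. Qed.
Let q2 : 1 - 240 * t <= 1. Proof. by move: t0; lra. Qed.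
Let t12 : t * 12 <= 1. Proof. by case/andP: t01 => _ h; lra. Qed.
Let th : `|t| <= 2^-1. Proof. by rewrite ger0_norm//; case/andP: t01 => _ h; lra. Qed.
Let s12 : s <= 12. Proof. by case/andP: s01. Qed.
Let e1 : 1 + t * u <= e. Proof. exact: expR_ge1Dx. Qed.
Let e2 : e <= 1 + t * u + 700 * t ^+ 2 * psi.
Proof. by have := tilt_exp1 u t16; rewrite ler_norml => /andP[_ ?]; lra. Qed.
Let ts0 : 0 <= t * s. Proof. exact: mulr_ge0. Qed.

Lemma tilt_mean_le :
  (t * s * (1 + 240 * t) * t - 1) * u + - t * (u ^+ 2 - s) + 700 * t ^+ 2 * (s / 6 - psi) <=
  (t * s * (1 + 240 * t) - u) * e.
Proof.
have := tilt_mean u t16; rewrite ler_norml => /andP[_ h].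
have : t * s * (1 + 240 * t) * (1 + t * u) <= t * s * (1 + 240 * t) * e.
  exact: (ler_wpM2l (mulr_ge0 ts0 q0) e1).
have : 0 <= t * (t * s) by exact: mulr_ge0.
move: h; rewrite (expr2 t) (expr2 u); lra.
Qed.

Lemma tilt_mean_ge :
  (1 - t * s * (1 - 240 * t) * t) * u + t * (u ^+ 2 - s) +
    (700 * t ^+ 2 + t * s * (1 - 240 * t) * (700 * t ^+ 2)) * (s / 6 - psi) <=
  (u - t * s * (1 - 240 * t)) * e.
Proof.
have := tilt_mean u t16; rewrite ler_norml => /andP[h _].
have b1 : t * s * (1 - 240 * t) <= 1.
  apply: (@le_trans _ _ (t * s)); first by rewrite ler_piMr.
  by apply: le_trans t12; rewrite ler_wpM2l.
have b2 : 0 <= t * s * (1 - 240 * t) by rewrite mulr_ge0.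
have : t * s * (1 - 240 * t) * e <= t * s * (1 - 240 * t) * (1 + t * u + 700 * t ^+ 2 * psi).
  by rewrite ler_wpM2l.
have c0 : 0 <= t * (t * s) by exact: mulr_ge0.
have : t * s * (1 - 240 * t) * (t * (t * s)) <= 1 * (t * (t * s)) by rewrite ler_wpM2r.
move: h c0; rewrite (expr2 t) (expr2 u); lra.
Qed.

Lemma tilt_var_le :
  (1 + 240 * t) * s * t * u + -1 * (u ^+ 2 - s) + 700 * t * (s / 6 - psi) <=
  ((1 + 240 * t) * s - u ^+ 2) * e.
Proof.
have := tilt_square u t16; rewrite ler_norml => /andP[_ h].
have : (1 + 240 * t) * s * (1 + t * u) <= (1 + 240 * t) * s * e.
  exact: (ler_wpM2l (mulr_ge0 q0 s0) e1).
by move: h ts0; rewrite (expr2 u); lra.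
Qed.

Lemma tilt_var_ge :
  - ((1 - 240 * t) * s * t) * u + 1 * (u ^+ 2 - s) +
     (700 * t + (1 - 240 * t) * s * (700 * t ^+ 2)) * (s / 6 - psi) <=
  (u ^+ 2 - (1 - 240 * t) * s) * e.
Proof.
have := tilt_square u t16; rewrite ler_norml => /andP[h _].
have : (1 - 240 * t) * s * e <= (1 - 240 * t) * s * (1 + t * u + 700 * t ^+ 2 * psi).
  exact: (ler_wpM2l (mulr_ge0 q1 s0) e2).
have st : s * t <= 1.
  by apply: le_trans t12; rewrite mulrC ler_wpM2l.
have : (1 - 240 * t) * (s * t) * (t * s) <= 1 * (t * s).
  exact: (ler_wpM2r ts0 (mulr_ile1 q1 (mulr_ge0 s0 t0) q2 st)).
by move: h ts0; rewrite (expr2 t) (expr2 u); lra.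
Qed.

Lemma tilt_cube_le :
  120 * s * t * u + 0 * (u ^+ 2 - s) + 700 * (s / 6 - psi) <= (120 * s - `|u| ^+ 3) * e.
Proof.
have h := tilt_cube u t16.
have : 120 * s * (1 + t * u) <= 120 * s * e
  by exact: (ler_wpM2l (mulr_ge0 (ler0n _ _) s0) e1).
by move: h s0; lra.
Qed.

Lemma tilt_exp_le :
  t * u + t ^+ 2 / 2 * (u ^+ 2 - s) - 700 * t ^+ 3 * (s / 6 - psi) + (1 + t ^+ 2 / 2 * s + 700 * t ^+ 3 * (s / 6)) >= e.
Proof.
have := tilt_exp2 u t16; rewrite ler_norml => /andP[_ h].
by move: h; rewrite exprMn; lra.
Qed.

Lemma tilt_exp_ge :
  t * u + t ^+ 2 / 2 * (u ^+ 2 - s) + 700 * t ^+ 3 * (s / 6 - psi) + (1 + t ^+ 2 / 2 * s - 700 * t ^+ 3 * (s / 6)) <= e.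
Proof.
have := tilt_exp2 u t16; rewrite ler_norml => /andP[h _].
by move: h; rewrite exprMn; lra.
Qed.

Lemma tilt_growth : (1 + u ^+ 2 + `|u| ^+ 3) * e <= 3000 * (1 + psi).
Proof.
have p0 := cosh1_ge0 u.
have h1 := tilt_cube u t16.
have := tilt_square u t16; rewrite ler_norml => /andP[_ h2].
have h3 : e <= 2 * (1 + psi).
  exact: expR_le_cosh1.
have [_ h4] := cube_le_cosh1 u.
have h5 : u ^+ 2 <= 700 * psi.
  apply: le_trans h4; rewrite sqr_normr ler_peMr ?sqr_ge0//.
  by rewrite -expR0 ler_expR divr_ge0.
have h6 : t * psi <= psi by exact: ler_piMl.
move: h1 h2 h3 h5 h6 p0; set c := u ^+ 2; set c3 := `|u| ^+ 3; set E := expR _; lra.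
Qed.

End tilted_moments.

Section growth.
Context (R : realType).
Implicit Types z p y M : R.
Notation g z := (1 + z ^+ 2 + `|z| ^+ 3).

Lemma growth_bounds z : [/\ 1 <= g z, `|z| <= g z, `|z ^+ 2| <= g z & `| `|z| ^+ 3 | <= g z].
Proof.
have h3 : 0 <= `|z| ^+ 3 by rewrite exprn_ge0.
have h2 := sqr_ge0 z; rewrite (ger0_norm h3) (ger0_norm h2).
by have := norm_le_sqr z; split; lra.
Qed.

Lemma growth_sub z p y M : 0 <= p <= M -> `|y| <= g z ->
  `|p - y| <= (M + 1) * g z /\ `|y - p| <= (M + 1) * g z.
Proof.
move=> /andP[p0 pM] yg; rewrite (distrC y); suff h : `|p - y| <= (M + 1) * g z by [].
have [g1 _ _ _] := growth_bounds z.
rewrite (le_trans (ler_normB _ _))// mulrDl mul1r lerD// ger0_norm//.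
by rewrite (le_trans pM)// ler_peMr// (le_trans p0).
Qed.

End growth.

Section tilt_exists.
Context (d : measure_display) (T : measurableType d) (R : realType).
Variables (P : probability T R) (F : nat -> set (set T)).
Variables (x v : nat -> T -> R) (n : nat) (eps B lam : R).
Notation integ h := (P.-integrable setT (EFin \o h)).

Hypothesis bm : bernstein_martingale P F x v n eps B.
Hypothesis lam0 : 0 <= lam.
Hypothesis lam_small : lam * eps <= (4 * 4000)^-1.
Let t := lam * eps.
Let u k w := x k w / eps.
Let s k w := v k w / eps ^+ 2.

Let FM k : F k `<=` measurable. Proof. exact: (bm_sub bm). Qed.
Let sF k : sigma_algebra setT (F k). Proof. exact: (bm_sigma bm). Qed.
Let e0 : 0 < eps. Proof. exact: bm_eps bm. Qed.
Let en0 : eps != 0. Proof. by rewrite gt_eqF. Qed.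
Let t01 : 0 <= t <= (4 * 4000)^-1. Proof. by rewrite /t lam_small mulr_ge0// ltW. Qed.
Let t16 : 0 <= lam * eps <= 16^-1. Proof. by move: t01; rewrite /t => /andP[-> h]; lra. Qed.
Let s01 k w : 0 <= s k w <= 12.
Proof.
have /andP[h1 h2] := bm_v bm k w; have p : 0 < eps ^+ 2 by rewrite exprn_gt0.
by rewrite /s divr_ge0 ?(ltW p)//= ler_pdivrMr.
Qed.
Let ms k : measurable_wrt (F k) (s k).
Proof. by apply: mwM; [exact: (bm_predictable bm)|exact: mw_cst]. Qed.
Let mu k : measurable_wrt (F k.+1) (u k).
Proof. by apply: mwM; [exact: (bm_adapted bm)|exact: mw_cst]. Qed.
Let tuE k w : t * u k w = lam * x k w. Proof. by rewrite /t /u; field. Qed.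

(** Every conditional moment bound below follows from a pointwise minorant that
    is affine in the step, its centred square and its centred [cosh1], with
    coefficients affine in the conditional variance. *)
Lemma cge0_of_moments k (h : T -> R) (a0 a1 b c0 c1 : R) : 0 <= c0 -> 0 <= c1 -> integ h ->
  (forall w, (a0 + a1 * s k w) * u k w + b * (u k w ^+ 2 - s k w) +
    (c0 + c1 * s k w) * (s k w / 6 - cosh1 (u k w)) <= h w) -> cge0 P (F k) h.
Proof.
move=> c0_ge0 c1_ge0 ih hle.
have ei : 0 <= eps^-1 by rewrite invr_ge0 ltW.
have ei2 : 0 <= (eps ^+ 2)^-1 by rewrite invr_ge0 exprn_ge0// ltW.
have sB w : `|s k w| <= 12 by have /andP[h1 h2] := s01 k w; rewrite ger0_norm.
have maff (p q : R) : measurable_wrt (F k) (fun w => p + q * s k w).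
  by apply: mwD; [exact: mw_cst|apply: mwM; [exact: mw_cst|exact: ms]].
apply: (cge0_le (@FM k) _ ih hle).
apply: (cge0D (@FM k)); first apply: (cge0D (@FM k)).
- apply: (@cge0_mul_null _ _ _ _ _ (sF k) (@FM k) (`|a0| + `|a1| * 12)) => //.
  + by have := cge0Z (sF k) (@FM k) (bm_mean_ge bm k) ei; congr (cge0 _ _ _); apply/funext => w; rewrite mulrC.
  + by have := cge0Z (sF k) (@FM k) (bm_mean_le bm k) ei; congr (cge0 _ _ _); apply/funext => w; rewrite mulrC mulNr.
  + by move=> w; rewrite (le_trans (ler_normD _ _))// lerD2l normrM ler_wpM2l.
- apply: (@cge0_mul_null _ _ _ _ _ (sF k) (@FM k) `|b|) => //.
  + have := cge0Z (sF k) (@FM k) (bm_var_ge bm k) ei2; congr (cge0 _ _ _); apply/funext => w.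
    by rewrite /u /s; field.
  + have := cge0Z (sF k) (@FM k) (bm_var_le bm k) ei2; congr (cge0 _ _ _); apply/funext => w.
    by rewrite /u /s; field.
  + exact: mw_cst.
- apply: (@cge0_mul_bounded _ _ _ _ _ (sF k) (@FM k) (c0 + c1 * 12)) => //.
  + have := bm_cosh bm k; congr (cge0 _ _ _); apply/funext => w.
    by rewrite /u /s; field.
  + move=> w; have /andP[h1 h2] := s01 k w.
    apply/andP; split; first exact: addr_ge0 (mulr_ge0 _ _).
    by rewrite lerD2l ler_wpM2l.
Qed.

Lemma mgf_exists k : exists m : T -> R, [/\ measurable_wrt (F k) m,
  forall w, `|m w - 1 - lam ^+ 2 * v k w / 2| <= 120 * lam ^+ 3 * eps * v k w,
  cge0 P (F k) (fun w => m w - expR (lam * x k w)) &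
  cge0 P (F k) (fun w => expR (lam * x k w) - m w)].
Proof.
have t0 : 0 <= t by case/andP: t01.
pose b w := 1 + t ^+ 2 / 2 * s k w + 700 * t ^+ 3 * (s k w / 6).
pose a w := 1 + t ^+ 2 / 2 * s k w - 700 * t ^+ 3 * (s k w / 6).
have mb : measurable_wrt (F k) b.
  apply: mwD; first by apply: mwD; [exact: mw_cst|apply: mwM; [exact: mw_cst|exact: ms]].
  by apply: mwM; [exact: mw_cst|apply: mwM; [exact: ms|exact: mw_cst]].
have ma : measurable_wrt (F k) a.
  apply: mwB; first by apply: mwD; [exact: mw_cst|apply: mwM; [exact: mw_cst|exact: ms]].
  by apply: mwM; [exact: mw_cst|apply: mwM; [exact: ms|exact: mw_cst]].
have t3 : 0 <= t ^+ 3 by exact: exprn_ge0.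
have t3' : 0 <= 700 * t ^+ 3 by exact: mulr_ge0 (ler0n _ _) t3.
have ab w : a w <= b w.
  have /andP[s0 _] := s01 k w; have := mulr_ge0 t3' s0.
  by rewrite /a /b; move: (700 * t ^+ 3) => q; lra.
have ie : integ (fun w => expR (lam * x k w)) by exact: integ_exp bm t16 k.
have bnd (f : T -> R) : measurable_wrt (F k) f -> (forall w, a w <= f w <= b w) -> integ f.
  move=> mf fab; apply: (@integ_bounded _ _ _ _ _ (1 + t ^+ 2 / 2 * 12 + 700 * t ^+ 3 * 12)).
    exact: measurable_wrt_sub mf.
  move=> w; have := fab w; rewrite /a /b; have /andP[s0 s12] := s01 k w.
  have h1 : 0 <= t ^+ 2 / 2 by rewrite divr_ge0// sqr_ge0.
  have := ler_wpM2l h1 s12; have := ler_wpM2l t3' s12.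
  have := mulr_ge0 h1 s0; have := mulr_ge0 t3' s0.
  move: (700 * t ^+ 3) (t ^+ 2 / 2) => p q; rewrite ler_norml; move: (s k w) => z.
  by move=> ? ? ? ? /andP[? ?]; apply/andP; split; lra.
have ca : cge0 P (F k) (fun w => expR (lam * x k w) - a w).
  apply: (@cge0_of_moments k _ t 0 (t ^+ 2 / 2) (700 * t ^+ 3) 0) => //.
    by apply: integB => //; apply: bnd => // w; rewrite lexx ab.
  move=> w; have := @tilt_exp_ge R t (s k w) (u k w) t01; rewrite -tuE /a.
  by move: (expR _) (cosh1 _) (700 * t ^+ 3) => E' psi q; lra.
have cb : cge0 P (F k) (fun w => b w - expR (lam * x k w)).
  apply: (@cge0_of_moments k _ (- t) 0 (- (t ^+ 2 / 2)) (700 * t ^+ 3) 0) => //.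
    by apply: integB => //; apply: bnd => // w; rewrite lexx ab.
  move=> w; have := @tilt_exp_le R t (s k w) (u k w) t01; rewrite -tuE /b.
  by move: (expR _) (cosh1 _) (700 * t ^+ 3) => E' psi q; lra.
have [m [mm mab m1 m2]] := clamped_condexp (sF k) (@FM k) ie ma mb ab ca cb.
exists m; split=> // w; have := mab w; have /andP[v0 _] := bm_v bm k w.
have lv : 0 <= lam ^+ 3 * eps * v k w by rewrite !mulr_ge0 ?exprn_ge0// ltW.
have -> : a w = 1 + lam ^+ 2 * v k w / 2 - 700 / 6 * (lam ^+ 3 * eps * v k w).
  by rewrite /a /s /t; field.
have -> : b w = 1 + lam ^+ 2 * v k w / 2 + 700 / 6 * (lam ^+ 3 * eps * v k w).
  by rewrite /b /s /t; field.
rewrite -2!(mulrA 120).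
move: lv; move: (lam ^+ 3 * eps * v k w) (lam ^+ 2 * v k w) (m w) => p q r p0 /andP[h1 h2].
by rewrite ler_norml; apply/andP; split; lra.
Qed.

Variable m : nat -> T -> R.
Hypothesis mm : forall i, measurable_wrt (F i) (m i).
Hypothesis m1 : forall i w, 1 <= m i w.
Hypothesis m_ge : forall i, cge0 P (F i) (fun w => m i w - expR (lam * x i w)).
Hypothesis m_le : forall i, cge0 P (F i) (fun w => expR (lam * x i w) - m i w).
Hypothesis m_stop : forall i w, (n <= i)%N -> m i w = 1.

Let Q := @tilt _ _ _ _ _ _ _ _ _ _ _ _ bm t16 mm m1 m_ge m_le.

Lemma cge0_tilt_of_moments k (h : T -> R) (D a0 a1 b c0 c1 : R) : 0 <= c0 -> 0 <= c1 ->
  measurable_wrt (F k.+1) h ->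
  (forall w, `|h w| <= D * (1 + u k w ^+ 2 + `|u k w| ^+ 3)) ->
  (forall w, (a0 + a1 * s k w) * u k w + b * (u k w ^+ 2 - s k w) +
    (c0 + c1 * s k w) * (s k w / 6 - cosh1 (u k w)) <= h w * expR (t * u k w)) ->
  cge0 Q (F k) h.
Proof.
move=> c0_ge0 c1_ge0 mh hD hle.
have D0 : 0 <= D.
  have q0 : 0 < 1 + u k point ^+ 2 + `|u k point| ^+ 3.
    by rewrite ltr_pwDl ?exprn_ge0// ltr_pwDl ?sqr_ge0.
  by rewrite -(pmulr_lge0 _ q0) (le_trans _ (hD point)).
have growth w : `|h w| * expR (lam * x k w) <= D * 3000 * (1 + cosh1 (x k w / eps)).
  have := @tilt_growth R t (u k w) t01; rewrite tuE => H.
  apply: (@le_trans _ _ (D * (1 + u k w ^+ 2 + `|u k w| ^+ 3) * expR (lam * x k w))).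
    by rewrite ler_wpM2r ?expR_ge0.
  by rewrite -(mulrA D 3000) -mulrA; exact: ler_wpM2l.
apply: (@cge0_tilt _ _ _ _ _ _ _ _ _ _ _ _ bm t16 mm m1 m_ge m_le m_stop k h (D * 3000) mh growth).
have ipsi := integ_psi bm k.
apply: (@cge0_of_moments k _ a0 a1 b c0 c1) => //; last by move=> w; rewrite -tuE; exact: hle.
apply: (@integ_le _ _ _ _ _ (fun w => D * 3000 * (1 + cosh1 (x k w / eps)))).
- apply: (measurable_wrt_sub (bm_sub bm (i := k.+1))); apply: mwM => //.
  by apply: mw_comp => //; apply: mwM; [exact: mw_cst|exact: (bm_adapted bm)].
- by apply: integZ; apply: integD; [exact: integ_cst|].
- by move=> w; rewrite normrM (@ger0_norm _ (expR _)) ?expR_ge0//; exact: growth.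
Qed.


Let t0 : 0 <= t. Proof. by case/andP: t01. Qed.
Let q0 : 0 <= 1 - 240 * t. Proof. by case/andP: t01 => _ h; lra. Qed.
Let s0 k w : 0 <= s k w. Proof. by case/andP: (s01 k w). Qed.
Let s12 k w : s k w <= 12. Proof. by case/andP: (s01 k w). Qed.
Let mts k (c : R) : measurable_wrt (F k) (fun w => t * s k w * c).
Proof. by apply: mwM; [apply: mwM; [exact: mw_cst|exact: ms]|exact: mw_cst]. Qed.
Let mF k (h : T -> R) : measurable_wrt (F k) h -> measurable_wrt (F k.+1) h.
Proof. by apply: measurable_wrt_mono; exact: (bm_mono bm). Qed.

Let ts1 k w : t * s k w <= 1.
Proof.
apply: (@le_trans _ _ (t * 12)); first by rewrite ler_wpM2l.
by case/andP: t01 => _ h; lra.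
Qed.
Let ts_ge0 k w : 0 <= t * s k w. Proof. exact: mulr_ge0. Qed.

Let c2 : 0 <= 700 * t ^+ 2. Proof. exact: mulr_ge0 (ler0n _ _) (sqr_ge0 _). Qed.
Let c1 : 0 <= 700 * t. Proof. exact: mulr_ge0 (ler0n _ _) t0. Qed.
Let q1 : 0 <= 1 + 240 * t. Proof. exact: addr_ge0 ler01 (mulr_ge0 (ler0n _ _) t0). Qed.
Let q2 : 1 + 240 * t <= 2. Proof. by case/andP: t01 => _ h; lra. Qed.
Let q3 : 1 - 240 * t <= 1. Proof. by rewrite gerBl; exact: mulr_ge0 (ler0n _ _) t0. Qed.

Lemma tilt_mean_sub k : cge0 Q (F k) (fun w => t * s k w * (1 + 240 * t) - u k w).
Proof.
apply: (@cge0_tilt_of_moments k _ (2 + 1) (-1) (t * (1 + 240 * t) * t) (- t) (700 * t ^+ 2) 0 c2 (lexx _)).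
- by apply: mwB; [apply: (@mF k); exact: mts|exact: mu].
- move=> w; have [_ h _ _] := growth_bounds (u k w).
  have p01 : 0 <= t * s k w * (1 + 240 * t) <= 2.
    apply/andP; split; first exact: mulr_ge0.
    by rewrite -[leRHS]mul1r ler_pM.
  by have [] := growth_sub p01 h.
- move=> w; have := @tilt_mean_le R t (s k w) (u k w) t01 (s01 k w).
  by move: (expR _) (cosh1 _) => E' psi; lra.
Qed.

Lemma tilt_mean_sup k : cge0 Q (F k) (fun w => u k w - t * s k w * (1 - 240 * t)).
Proof.
have c3 : 0 <= t * (1 - 240 * t) * (700 * t ^+ 2) := mulr_ge0 (mulr_ge0 t0 q0) c2.
apply: (@cge0_tilt_of_moments k _ (1 + 1) 1 (- (t * (1 - 240 * t) * t)) t _ _ c2 c3).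
- by apply: mwB; [exact: mu|apply: (@mF k); exact: mts].
- move=> w; have [_ h _ _] := growth_bounds (u k w).
  have p01 : 0 <= t * s k w * (1 - 240 * t) <= 1.
    apply/andP; split; first exact: mulr_ge0.
    by rewrite -[leRHS]mul1r ler_pM.
  by have [] := growth_sub p01 h.
- move=> w; have := @tilt_mean_ge R t (s k w) (u k w) t01 (s01 k w).
  by move: (expR _) (cosh1 _) => E' psi; lra.
Qed.

Lemma tilt_var_sub k : cge0 Q (F k) (fun w => (1 + 240 * t) * s k w - u k w ^+ 2).
Proof.
apply: (@cge0_tilt_of_moments k _ (2 * 12 + 1) 0 ((1 + 240 * t) * t) (-1) _ 0 c1 (lexx _)).
- apply: mwB; last by apply: mwX; exact: mu.
  by apply: (@mF k); apply: mwM; [exact: mw_cst|exact: ms].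
- move=> w; have [_ _ h _] := growth_bounds (u k w).
  have p01 : 0 <= (1 + 240 * t) * s k w <= 2 * 12.
    by apply/andP; split; [exact: mulr_ge0|rewrite ler_pM].
  by have [] := growth_sub p01 h.
- move=> w; have := @tilt_var_le R t (s k w) (u k w) t01 (s01 k w).
  by move: (expR _) (cosh1 _) => E' psi; lra.
Qed.

Lemma tilt_var_sup k : cge0 Q (F k) (fun w => u k w ^+ 2 - (1 - 240 * t) * s k w).
Proof.
have c3 : 0 <= (1 - 240 * t) * (700 * t ^+ 2) by exact: mulr_ge0.
apply: (@cge0_tilt_of_moments k _ (1 * 12 + 1) 0 (- ((1 - 240 * t) * t)) 1 _ _ c1 c3).
- apply: mwB; first by apply: mwX; exact: mu.
  by apply: (@mF k); apply: mwM; [exact: mw_cst|exact: ms].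
- move=> w; have [_ _ h _] := growth_bounds (u k w).
  have p01 : 0 <= (1 - 240 * t) * s k w <= 1 * 12.
    by apply/andP; split; [exact: mulr_ge0|rewrite ler_pM].
  by have [] := growth_sub p01 h.
- move=> w; have := @tilt_var_ge R t (s k w) (u k w) t01 (s01 k w).
  by move: (expR _) (cosh1 _) => E' psi; lra.
Qed.

Lemma tilt_cube_sub k : cge0 Q (F k) (fun w => 120 * s k w - `|u k w| ^+ 3).
Proof.
apply: (@cge0_tilt_of_moments k _ (120 * 12 + 1) 0 (120 * t) 0 700 0 (ler0n _ _) (lexx _)).
- apply: mwB; last by apply: mwX; apply: mw_norm; exact: mu.
  by apply: (@mF k); apply: mwM; [exact: mw_cst|exact: ms].
- move=> w; have [_ _ _ h] := growth_bounds (u k w).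
  have p01 : 0 <= 120 * s k w <= 120 * 12.
    by apply/andP; split; [exact: mulr_ge0 (ler0n _ _) _|rewrite ler_wpM2l].
  by have [] := growth_sub p01 h.
- move=> w; have := @tilt_cube_le R t (s k w) (u k w) t01 (s01 k w).
  by move: (expR _) (cosh1 _) => E' psi; lra.
Qed.


(** Recentring changes the second and third moments by [b^2] and [b^3], which
    are of smaller order since [b / eps] is at most [2 * t * s]. *)
Lemma tilt_small_steps : exists b : nat -> T -> R,
  (forall k w, `|b k w - lam * v k w| <= 240 * lam ^+ 2 * eps * v k w) /\
  small_step_martingale Q F (fun k w => x k w - b k w) v (600 * eps) (1000 * (lam * eps)) B.
Proof.
have int_u k : Q.-integrable setT (EFin \o u k).
  have [i1 _] := tilt_mean_sup k.
  have i2 : Q.-integrable setT (EFin \o (fun w => t * s k w * (1 - 240 * t))).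
    apply: (@integ_bounded _ _ _ _ _ 1).
      by apply: (measurable_wrt_sub (@FM k)); exact: mts.
    move=> w; have p0 : 0 <= t * s k w * (1 - 240 * t) by exact: mulr_ge0.
    by rewrite (ger0_norm p0) -[leRHS]mul1r; apply: ler_pM.
  have := integD i1 i2; congr (integrable _ _ _); apply/funext => w /=; congr EFin; ring.
have bex k : exists b : T -> R, [/\ measurable_wrt (F k) b,
    forall w, t * s k w * (1 - 240 * t) <= b w <= t * s k w * (1 + 240 * t),
    cge0 Q (F k) (fun w => b w - u k w) & cge0 Q (F k) (fun w => u k w - b w)].
  apply: (clamped_condexp (sF k) (@FM k) (int_u k) (@mts k _) (@mts k _)).
  - by move=> w; rewrite ler_wpM2l//; have := q2; have := q3; have := t0; lra.
  - exact: tilt_mean_sup.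
  - exact: tilt_mean_sub.
have [b bP] := choice bex.
have mb k : measurable_wrt (F k) (b k) by case: (bP k).
have b_sup k w : b k w <= t * s k w * 2.
  case: (bP k) => _ /(_ w)/andP[_ h] _ _; apply: (le_trans h); exact: ler_wpM2l.
have b_ge0 k w : 0 <= b k w.
  case: (bP k) => _ /(_ w)/andP[h _] _ _; apply: le_trans h; exact: mulr_ge0.
have b_le2 k w : b k w <= 2.
  by apply: (le_trans (b_sup k w)); rewrite -[leRHS]mul1r ler_wpM2r.
have b_sq k w : b k w ^+ 2 <= t * s k w.
  rewrite expr2; apply: (@le_trans _ _ (t * s k w * 2 * (t * 12 * 2))).
    by rewrite ler_pM// (le_trans (b_sup k w))// ler_wpM2r// ler_wpM2l.
  rewrite -(mulrA _ 2) ler_piMr//; case/andP: t01 => _ h; lra.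
have e2 : 0 <= eps ^+ 2 by rewrite exprn_ge0// ltW.
have e3 : 0 <= eps ^+ 3 by rewrite exprn_ge0// ltW.
have mbT k : measurable_fun setT (b k) by apply: (measurable_wrt_sub (@FM k)).
have muT k : measurable_fun setT (u k) by apply: (measurable_wrt_sub (@FM k.+1)); exact: mu.
have msT k : measurable_fun setT (s k) by apply: (measurable_wrt_sub (@FM k)).
have cross k : cge0 Q (F k) (fun w => (2 * b k w) * (u k w - b k w)) /\
    cge0 Q (F k) (fun w => - (2 * b k w) * (u k w - b k w)).
  have m2b : measurable_wrt (F k) (fun w => 2 * b k w) by apply: mwM => //; exact: mw_cst.
  have n2b w : `|2 * b k w| <= 4.
    by rewrite ger0_norm ?mulr_ge0//; have := b_le2 k w; lra.
  case: (bP k) => _ _ h1 h2.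
  have h1' : cge0 Q (F k) (fun w => - (u k w - b k w)).
    by move: h1; congr (cge0 _ _ _); apply/funext => w; rewrite opprB.
  split; apply: (@cge0_mul_null _ _ _ _ _ (sF k) (@FM k) 4) => //; first exact: mwN.
  by move=> w; rewrite normrN.
have cst_ge0 k (f : T -> R) (M : R) : measurable_fun setT f -> (forall w, 0 <= f w <= M) -> cge0 Q (F k) f.
  move=> mf f0; apply: cge0_ge0; last by move=> w; case/andP: (f0 w).
  by apply: (@integ_bounded _ _ _ _ _ M) => // w; have /andP[? ?] := f0 w; rewrite ger0_norm.
have om0 : 0 <= 1000 * t by exact: mulr_ge0 (ler0n _ _) t0.
have om1 : 1000 * t <= 16^-1 by case/andP: t01 => _ h; lra.
exists (fun k w => eps * b k w); split.
  move=> k w; case: (bP k) => _ /(_ w) h _ _; move: h.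
  have -> : t * s k w * (1 - 240 * t) = (lam * v k w - 240 * lam ^+ 2 * eps * v k w) / eps.
    by rewrite /t /s; field.
  have -> : t * s k w * (1 + 240 * t) = (lam * v k w + 240 * lam ^+ 2 * eps * v k w) / eps.
    by rewrite /t /s; field.
  rewrite ler_pdivrMr// ler_pdivlMr// (mulrC (b k w)).
  move: (eps * b k w) (lam * v k w) (240 * lam ^+ 2 * eps * v k w) => p q r /andP[h1 h2].
  by rewrite ler_norml; apply/andP; split; lra.
have vE k w : v k w = eps ^+ 2 * s k w by rewrite /s; field.
have etaE k w : x k w - eps * b k w = eps * (u k w - b k w) by rewrite /u; field.
split.
- exact: sF.
- exact: FM.
- exact: (bm_mono bm).
- move=> k; apply: mwB; first exact: (bm_adapted bm).
  by apply: (@mF k); apply: mwM; [exact: mw_cst|].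
- exact: (bm_predictable bm).
- exact: mulr_ge0 (ler0n _ _) (ltW e0).
- by apply/andP.
- move=> k w; have /andP[-> h] := bm_v bm k w; apply: (le_trans h).
  rewrite exprMn; apply: (ler_wpM2r e2); apply: (@le_trans _ _ 600); first by lra.
  by rewrite expr2; apply: ler_peMr; [exact: ler0n|rewrite ler1n].
- move=> k; case: (bP k) => _ _ _ h; have := cge0Z (sF k) (@FM k) h (ltW e0).
  by congr (cge0 _ _ _); apply/funext => w; rewrite etaE.
- move=> k; case: (bP k) => _ _ h _; have := cge0Z (sF k) (@FM k) h (ltW e0).
  by congr (cge0 _ _ _); apply/funext => w; rewrite etaE; ring.
- move=> k; have [h _] := cross k.
  have r : cge0 Q (F k) (fun w => 760 * (t * s k w) + b k w ^+ 2).
    apply: (@cst_ge0 _ _ (760 * 1 + 1)).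
      apply: measurable_funD; last exact: measurable_funX.
      by apply: measurable_funM => //; apply: measurable_funM.
    move=> w; apply/andP; split.
      by apply: addr_ge0; [exact: mulr_ge0 (ler0n _ _) _|exact: sqr_ge0].
    by apply: lerD; [exact: ler_wpM2l (ler0n _ _) _ _ (ts1 k w)|exact: le_trans (b_sq k w) (ts1 k w)].
  have := cge0Z (sF k) (@FM k) (cge0D (@FM k) (cge0D (@FM k) (tilt_var_sub k) h) r) e2.
  by congr (cge0 _ _ _); apply/funext => w; rewrite etaE (vE k w) -/t; ring.
- move=> k; have [_ h] := cross k.
  have r : cge0 Q (F k) (fun w => 760 * (t * s k w) - b k w ^+ 2).
    apply: (@cst_ge0 _ _ (760 * 1)).
      apply: measurable_funB; last exact: measurable_funX.
      by apply: measurable_funM => //; apply: measurable_funM.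
    move=> w; have := b_sq k w; have := ts1 k w; have := ts_ge0 k w; have := sqr_ge0 (b k w).
    by move: (t * s k w) (b k w ^+ 2) => p q *; apply/andP; split; lra.
  have := cge0Z (sF k) (@FM k) (cge0D (@FM k) (cge0D (@FM k) (tilt_var_sup k) h) r) e2.
  by congr (cge0 _ _ _); apply/funext => w; rewrite etaE (vE k w) -/t; ring.
- move=> k.
  have cb w : `|u k w - b k w| ^+ 3 <= 4 * `|u k w| ^+ 3 + 32 * s k w.
    apply: (@le_trans _ _ (4 * (`|u k w| ^+ 3 + b k w ^+ 3))).
      apply: (@le_trans _ _ ((`|u k w| + b k w) ^+ 3)).
        by rewrite lerXn2r ?nnegrE ?addr_ge0// (le_trans (ler_normB _ _))// (@ger0_norm _ (b k w)).
      have := normr_ge0 (u k w); have := b_ge0 k w; move: `|u k w| (b k w) => p q p0' q0'.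
      rewrite -subr_ge0 (_ : _ - _ = 3 * ((p + q) * (p - q) ^+ 2)); last by ring.
      by rewrite mulr_ge0// mulr_ge0// ?sqr_ge0// addr_ge0.
    have : b k w ^+ 3 <= 8 * s k w.
      have h : b k w ^+ 2 * b k w <= t * s k w * 2 by rewrite ler_pM ?sqr_ge0.
      rewrite exprSr (le_trans h)//.
      have : t * s k w <= 1 * s k w.
        by rewrite ler_wpM2r//; case/andP: t01 => _ h'; lra.
      by have := s0 k w; lra.
    by lra.
  have h4 := cge0Z (sF k) (@FM k) (tilt_cube_sub k) (ler0n R 4).
  have ih : Q.-integrable setT (EFin \o (fun w => 600 * s k w - `|u k w - b k w| ^+ 3)).
    have [i4 _] := h4.
    have is12 : Q.-integrable setT (EFin \o s k).
      by apply: (@integ_bounded _ _ _ _ _ 12) => // w; rewrite ger0_norm.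
    have iu3 : Q.-integrable setT (EFin \o (fun w => 4 * `|u k w| ^+ 3)).
      have := integB (integZ 480 is12) i4; congr (integrable _ _ _).
      by apply/funext => w /=; congr EFin; ring.
    apply: integB; first exact: integZ.
    apply: (@integ_le _ _ _ _ _ (fun w => 4 * `|u k w| ^+ 3 + 32 * s k w)).
    - by apply: measurable_funX; apply: measurableT_comp => //; exact: measurable_funB.
    - by apply: integD => //; exact: integZ.
    - by move=> w; rewrite ger0_norm ?exprn_ge0.
  have h5 : cge0 Q (F k) (fun w => 600 * s k w - `|u k w - b k w| ^+ 3).
    apply: (cge0_le (@FM k) h4 ih) => w; have := cb w; have := s0 k w.
    by move: (`|u k w| ^+ 3) (`|_| ^+ 3) (s k w) => p q r *; lra.
  have := cge0Z (sF k) (@FM k) h5 e3.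
  congr (cge0 _ _ _); apply/funext => w; rewrite etaE (vE k w) normrM (gtr0_norm e0) exprMn; ring.
- exact: (bm_total bm).
Qed.

End tilt_exists.

(** Cramer's change of measure. The conditional mean [m] of [expR (lam * x)]
    is [1 + lam^2 v / 2] up to [lam^3 eps v], and the new conditional mean [b]
    of a step is [lam * v] up to [lam^2 eps v]. *)
Theorem exponential_tilt (d : measure_display) (T : measurableType d) (R : realType)
    (P : probability T R) (F : nat -> set (set T)) (x v : nat -> T -> R) (n : nat)
    (eps B lam : R) :
  bernstein_martingale P F x v n eps B -> 0 <= lam -> lam * eps <= (4 * 4000)^-1 ->
  exists (Q : probability T R) (b m : nat -> T -> R),
  [/\ small_step_martingale Q F (fun k w => x k w - b k w) v (600 * eps) (1000 * (lam * eps)) B,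
      forall k w, `|b k w - lam * v k w| <= 240 * lam ^+ 2 * eps * v k w,
      forall k w, `|m k w - 1 - lam ^+ 2 * v k w / 2| <= 120 * lam ^+ 3 * eps * v k w,
      forall k, measurable_fun setT (m k) /\ (forall w, 1 <= m k w) &
      forall f : T -> R, measurable_fun setT f -> (forall w, 0 <= f w) ->
        (\int[Q]_w (f w)%:E =
         \int[P]_w (f w * \prod_(i < n) (expR (lam * x i w) / m i w))%:E)%E].
Proof.
move=> bm lam0 lam_small.
have [m mP] := choice (mgf_exists bm lam0 lam_small).
have mm k : measurable_wrt (F k) (m k) by case: (mP k).
have mB k w : `|m k w - 1 - lam ^+ 2 * v k w / 2| <= 120 * lam ^+ 3 * eps * v k w.
  by case: (mP k).
have m_ge k : cge0 P (F k) (fun w => m k w - expR (lam * x k w)) by case: (mP k).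
have m_le k : cge0 P (F k) (fun w => expR (lam * x k w) - m k w) by case: (mP k).
have m1 k w : 1 <= m k w.
  have := mB k w; have /andP[v0 _] := bm_v bm k w.
  have lv : 0 <= lam ^+ 2 * v k w by rewrite mulr_ge0// sqr_ge0.
  have : (lam * eps) * (lam ^+ 2 * v k w) <= (4 * 4000)^-1 * (lam ^+ 2 * v k w) by rewrite ler_wpM2r.
  rewrite (_ : 120 * lam ^+ 3 * eps * v k w = 120 * (lam * eps * (lam ^+ 2 * v k w))); last by ring.
  move: lv; move: (lam ^+ 2 * v k w) (lam * eps * _) (m k w) => p q r; rewrite ler_norml.
  by move=> ? ? /andP[? _]; lra.
have m_stop k w : (n <= k)%N -> m k w = 1.
  move=> nk; have [_ v0] := bm_stop bm w nk.
  have := mB k w; rewrite v0 !mulr0 mul0r subr0 normr_le0 subr_eq0.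
  by move/eqP.
have [b [bB ssm]] := tilt_small_steps bm lam0 lam_small mm m1 m_ge m_le m_stop.
eexists; exists b, m; split; [exact: ssm|exact: bB|exact: mB| |].
- by move=> k; split=> //; exact: (measurable_wrt_sub (bm_sub bm (i := k)) (mm k)).
- by move=> f mf f0; rewrite integral_tilted.
Qed.

(** * The tail ratio *)

Section ratio.
Context (R : realType).
Implicit Types r a b z q A D zD k y c eps : R.

(** The exponential factor alone reaches [r] when [r] lies between [expR (-
    a)] and [expR a]; otherwise it is taken at its extreme value. *)
Lemma ratio_thetas r a b : 0 <= a -> 0 <= b -> 0 <= r ->
  expR (- a) * (1 - b) <= r <= expR a * (1 + b) ->
  exists t1 t2 : R, [/\ `|t1| <= 1, `|t2| <= 1 & r = expR (t1 * a) * (1 + t2 * b)].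
Proof.
move=> a0 b0 r0 /andP[lo hi].
have [ra|ra] := ltP (expR a) r.
  have b1 : 0 < b.
    rewrite lt_neqAle b0 andbT; apply/negP => /eqP bE.
    by move: hi; rewrite -bE addr0 mulr1 leNgt ra.
  exists 1, ((r * expR (- a) - 1) / b); rewrite normr1 lexx mul1r divfK ?gt_eqF//; split=> //.
    rewrite normrM normfV (gtr0_norm b1) ler_pdivrMr// mul1r ger0_norm.
      by rewrite lerBlDl expRN ler_pdivrMr ?expR_gt0// mulrC.
    by rewrite subr_ge0 expRN ler_pdivlMr ?expR_gt0// mul1r ltW.
  by rewrite addrC subrK mulrC -mulrA -expRD addNr expR0 mulr1.
have [ra'|ra'] := ltP r (expR (- a)).
  have b1 : 0 < b.
    rewrite lt_neqAle b0 andbT; apply/negP => /eqP bE.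
    by move: lo; rewrite -bE subr0 mulr1 leNgt ra'.
  exists (-1), ((r * expR a - 1) / b); rewrite normrN normr1 lexx mulN1r divfK ?gt_eqF//; split=> //.
    have h : r * expR a <= 1.
      by rewrite -ler_pdivlMr ?expR_gt0// mul1r -expRN ltW.
    rewrite normrM normfV (gtr0_norm b1) ler_pdivrMr// mul1r ler0_norm ?subr_le0//.
    rewrite opprB lerBlDl -lerBlDr -ler_pdivrMr ?expR_gt0// -expRN mulrC//.
  by rewrite addrC subrK mulrC -mulrA -expRD subrr expR0 mulr1.
have rp : 0 < r by apply: lt_le_trans ra'; exact: expR_gt0.
have [a00|a00] := eqVneq a 0.
  exists 0, 0; rewrite normr0 ler01 !mul0r addr0 expR0 mulr1; split=> //.
  by apply/eqP; rewrite eq_le; move: ra ra'; rewrite a00 oppr0 expR0 => -> ->.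
have a1 : 0 < a by rewrite lt_neqAle eq_sym a00.
exists (ln r / a), 0; rewrite normr0 ler01 mul0r addr0 mulr1 divfK// lnK ?posrE//; split=> //.
rewrite normrM normfV (gtr0_norm a1) ler_pdivrMr// mul1r ler_norml.
by rewrite -ler_expR -[X in _ && X]ler_expR lnK ?posrE// ra' ra.
Qed.

Lemma expR_le_linear c y : 0 <= c -> 0 <= y <= 1 -> expR (c * y) <= 1 + c * expR c * y.
Proof.
move=> c0 /andP[y0 y1].
have h := expR_ge1Dx (- (c * y)).
have h2 : expR (c * y) * expR (- (c * y)) = 1 by rewrite -expRD subrr expR0.
have : expR (c * y) * (1 - c * y) <= 1 by rewrite -[leRHS]h2; apply: ler_wpM2l; [exact: expR_ge0|].
have : expR (c * y) * (c * y) <= expR c * (c * y).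
  by rewrite ler_wpM2r ?mulr_ge0// ler_expR ler_piMr.
lra.
Qed.

Lemma expR_N_le y : 0 <= y <= 2^-1 -> expR (- (2 * y)) <= 1 - y.
Proof.
move=> /andP[y0 y1]; rewrite expRN -[leRHS]invrK lef_pV2 ?posrE ?expR_gt0//; last first.
  by rewrite invr_gt0; lra.
apply: le_trans (expR_ge1Dx _); rewrite -[leLHS]mul1r ler_pdivrMr; last lra.
have : 0 <= y * (1 - 2 * y) by rewrite mulr_ge0//; lra.
lra.
Qed.

(** As [zD] is bounded, its exponential is dominated by a linear function,
    while that of [A] is kept. *)
Lemma ratio_upper r c2 c4 A D1 zD k : 0 <= c2 -> 0 <= c4 -> 0 <= A -> 0 <= zD <= 1 -> zD <= D1 ->
  D1 <= 3 -> k <= c4 * (D1 + A) -> r <= expR (c2 * (zD + A)) * (1 + k) ->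
  r <= expR ((c2 + c4) * A) * (1 + (c2 * expR c2 + c4 + 3 * (c2 * expR c2) * c4) * D1).
Proof.
move=> c20 c40 A0 zD01 zDD1 D13 kle rle; have /andP[zD0 zD1] := zD01.
have D0 : 0 <= D1 by exact: le_trans zDD1.
set c3 := c2 * expR c2; have c30 : 0 <= c3 by rewrite mulr_ge0 ?expR_ge0.
have e1 : expR (c2 * zD) <= 1 + c3 * D1.
  by apply: (le_trans (expR_le_linear c20 zD01)); rewrite lerD2l ler_wpM2l.
have e2 : 1 + k <= (1 + c4 * D1) * expR (c4 * A).
  have h : 1 + c4 * A <= expR (c4 * A) by exact: expR_ge1Dx.
  have h2 : 0 <= c4 * D1 by exact: mulr_ge0.
  have h3 : 0 <= c4 * D1 * (c4 * A) by rewrite !mulr_ge0.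
  apply: (@le_trans _ _ ((1 + c4 * D1) * (1 + c4 * A))); first lra.
  by rewrite ler_wpM2l// addr_ge0.
apply: (le_trans rle); rewrite (mulrDr c2) expRD (mulrDl c2 c4) (expRD (c2 * A)).
apply: (@le_trans _ _ ((1 + c3 * D1) * expR (c2 * A) * ((1 + c4 * D1) * expR (c4 * A)))).
  have [k0|k0] := leP 0 (1 + k).
    by rewrite ler_pM ?mulr_ge0 ?expR_ge0// ler_wpM2r ?expR_ge0.
  apply: (@le_trans _ _ 0).
    by rewrite mulr_ge0_le0 ?mulr_ge0 ?expR_ge0// ltW.
  by rewrite !mulr_ge0 ?expR_ge0// addr_ge0// mulr_ge0.
rewrite (_ : _ * _ * (_ * _) = expR (c2 * A) * expR (c4 * A) * ((1 + c3 * D1) * (1 + c4 * D1))); last by ring.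
rewrite ler_wpM2l ?mulr_ge0 ?expR_ge0//.
have : c3 * c4 * D1 * D1 <= c3 * c4 * D1 * 3 by rewrite ler_wpM2l// !mulr_ge0.
lra.
Qed.

(** As [c5 * q] is small, [1 - c5 * q] is at least [expR (- 2 * c5 * q)] and
    can join the exponential factor. *)
Lemma ratio_lower_small r c2 c5 A D1 zD k q : 0 <= c2 -> 0 < c5 -> 0 <= A -> 0 <= zD -> zD <= D1 ->
  0 <= q -> q <= 2 * D1 + A -> c5 * q <= 4^-1 ->
  k <= c5 * (D1 + q) -> expR (- (c2 * (zD + A))) * (1 - k) <= r ->
  (c2 + 6 * c5) * D1 <= 1 ->
  expR (- ((c2 + 2 * c5) * A)) * (1 - (c2 + 6 * c5) * D1) <= r.
Proof.
move=> c20 c50 A0 zD0 zDD1 q0 qle q1 kle rle cD; apply: le_trans rle.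
have D0 : 0 <= D1 by exact: le_trans zDD1.
have d2 : 0 <= c2 * D1 by exact: mulr_ge0.
have d5 : 0 <= c5 * D1 by rewrite mulr_ge0// ltW.
have q5 : 0 <= c5 * q by rewrite mulr_ge0// ltW.
have A5 : 0 <= c5 * A by rewrite mulr_ge0// ltW.
have h1 : (1 - 2 * (c5 * D1)) * (1 - c5 * q) <= 1 - k.
  have : c5 * D1 * (c5 * q) <= c5 * D1 * 4^-1 by rewrite ler_wpM2l.
  by lra.
have h2 : (1 - 4 * (c5 * D1)) * expR (- (2 * (c5 * A))) <= 1 - c5 * q.
  apply: le_trans (expR_N_le _); last by apply/andP; split => //; lra.
  apply: (@le_trans _ _ (expR (- (4 * (c5 * D1))) * expR (- (2 * (c5 * A))))).
    by rewrite ler_wpM2r ?expR_ge0//; exact: expR_ge1Dx.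
  rewrite -expRD ler_expR; have : c5 * q <= c5 * (2 * D1 + A) by rewrite ler_wpM2l// ltW.
  by lra.
have h3 : (1 - c2 * D1) * expR (- (c2 * A)) <= expR (- (c2 * (zD + A))).
  rewrite mulrDr opprD expRD ler_wpM2r ?expR_ge0//.
  apply: (le_trans (expR_ge1Dx _)); rewrite ler_expR lerN2; exact: ler_wpM2l.
have p1 : 0 <= 1 - c2 * D1 by lra.
have p2 : 0 <= 1 - 2 * (c5 * D1) by lra.
have p3 : 0 <= 1 - 4 * (c5 * D1) by lra.
apply: (@le_trans _ _ ((1 - c2 * D1) * expR (- (c2 * A)) * ((1 - 2 * (c5 * D1)) * ((1 - 4 * (c5 * D1)) * expR (- (2 * (c5 * A))))))).
  rewrite (_ : - ((c2 + 2 * c5) * A) = - (c2 * A) + - (2 * (c5 * A))); last by ring.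
  rewrite expRD; set e1 := expR _; set e2 := expR _.
  have e10 : 0 <= e1 by exact: expR_ge0.
  have e20 : 0 <= e2 by exact: expR_ge0.
  rewrite (_ : _ * (_ * (_ * e2)) = e1 * e2 * ((1 - c2 * D1) * ((1 - 2 * (c5 * D1)) * (1 - 4 * (c5 * D1))))); last by ring.
  rewrite ler_wpM2l ?mulr_ge0//.
  have u1 : 0 <= c5 * D1 * (c5 * D1) by exact: mulr_ge0.
  have u2 : 1 - 6 * (c5 * D1) <= (1 - 2 * (c5 * D1)) * (1 - 4 * (c5 * D1)) by lra.
  apply: (@le_trans _ _ ((1 - c2 * D1) * (1 - 6 * (c5 * D1)))); last by rewrite ler_wpM2l.
  have : 0 <= c2 * D1 * (c5 * D1) by exact: mulr_ge0.
  lra.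
apply: ler_pM h3 _ => //; first by rewrite mulr_ge0// expR_ge0.
  by rewrite !mulr_ge0// expR_ge0.
by apply: le_trans h1; rewrite ler_wpM2l.
Qed.

(** As [q] is bounded below, both [z] and 1 are at most multiples of [A = z *
    q]: any lower bound exponential in [z] is good enough. *)
Lemma ratio_lower_large r c2 a0 A zD z q eps : 0 <= c2 -> 0 < a0 <= 1 -> 0 <= zD <= 1 -> 0 <= z ->
  0 < eps <= 2^-1 -> q = z ^+ 2 * eps -> A = z ^+ 3 * eps -> a0 <= q ->
  expR (- (c2 * (zD + A))) * (expR (- (2 * z)) / 18) <= r ->
  expR (- ((c2 + 2 / a0 + (c2 + 18) / a0 ^+ 2) * A)) <= r.
Proof.
move=> c20 /andP[a00 a01] /andP[zD0 zD1] z0 /andP[e0 e1] qE AE aq; apply: le_trans.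
have e18 : expR (- 18) <= 18^-1 :> R.
  by rewrite expRN lef_pV2 ?posrE ?expR_gt0//; apply: le_trans (expR_ge1Dx _); lra.
have zA : a0 * z <= A.
  by rewrite AE (_ : z ^+ 3 * eps = q * z); [rewrite ler_wpM2r|rewrite qE; ring].
have za : a0 <= z.
  rewrite leNgt; apply/negP => h; have : z ^+ 2 * eps < a0.
    apply: (@le_lt_trans _ _ (z * 1)); last by rewrite mulr1.
    rewrite expr2 -mulrA ler_wpM2l// mulr_ile1 ?(ltW e0)//; lra.
  by rewrite -qE ltNge aq.
have A2 : a0 ^+ 2 <= A by apply: le_trans zA; rewrite expr2 ler_wpM2l// ltW.
have A0 : 0 <= A by apply: le_trans A2; exact: sqr_ge0.
have zA' : z <= A / a0 by rewrite ler_pdivlMr// mulrC.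
have A2' : 1 <= A / a0 ^+ 2 by rewrite ler_pdivlMr ?exprn_gt0// mul1r.
apply: (@le_trans _ _ (expR (- (c2 * (zD + A))) * (expR (- (2 * z)) * expR (- 18)))); last first.
  by rewrite ler_wpM2l ?expR_ge0// ler_wpM2l ?expR_ge0.
rewrite -!expRD ler_expR.
have : c2 * zD <= c2 by rewrite ler_piMr.
have : c2 + 18 <= (c2 + 18) * (A / a0 ^+ 2) by rewrite ler_peMr// addr_ge0.
rewrite (_ : (_ + _ / a0 + _) * A = c2 * A + 2 * (A / a0) + (c2 + 18) * (A / a0 ^+ 2)); last by field; rewrite gt_eqF.
lra.
Qed.

End ratio.

Section tilted_tail.
Context (d : measure_display) (T : measurableType d) (R : realType).
Variables (Q : probability T R) (X Y M : T -> R) (z gam e K p : R).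
Notation Phi := (@std_normal_cdf R).
Notation Cm := (mills_constant R).
Notation integ h := (Q.-integrable setT (EFin \o h)).
Notation Exp f := (\int[Q]_w f w).
(* [X] is the sum, [Y] its recentring under the tilted law [Q], [M] the
   product of the conditional means, and [p] the probability of [X > z] under
   the original law. *)
Let lam := z + gam.
Let G := 1 - Phi z.
Let E := e + 2 * lam * gam + gam ^+ 2 / 2 + 2 * Cm * (1 + z) * gam.

Hypothesis mX : measurable_fun setT X.
Hypothesis mY : measurable_fun setT Y.
Hypothesis mM : measurable_fun setT M.
Hypothesis M_ge0 : forall w, 0 <= M w.
Hypothesis z0 : 0 <= z.
Hypothesis gam_bounds : 0 <= gam <= z.
Hypothesis K0 : 0 <= K.
Hypothesis XY : {ae Q, forall w, Y w <= X w - z <= Y w + 2 * gam}.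
Hypothesis MB : {ae Q, forall w, expR (lam ^+ 2 / 2 - e) <= M w <= expR (lam ^+ 2 / 2 + e)}.
Hypothesis nY : near_normal Q Y K.
Let g w := \1_[set w | z < X w] w * expR (- (lam * X w)) * M w.
Hypothesis pE : p%:E = (\int[Q]_w (g w)%:E)%E.

Let Cm0 : 0 <= Cm. Proof. exact: ltW (mills_constant_gt0 R). Qed.
Let g0 w : 0 <= g w.
Proof. by rewrite /g indicE !mulr_ge0 ?expR_ge0. Qed.
Let mg : measurable_fun setT g.
Proof.
apply: measurable_funM => //; apply: measurable_funM.
  by apply: measurable_indic; exact: measurable_gt_set.
by apply: measurableT_comp => //; apply: measurableT_comp => //; apply: measurable_funM.
Qed.
Let gam0 : 0 <= gam. Proof. by case/andP: gam_bounds. Qed.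
Let lam0 : 0 <= lam. Proof. exact: addr_ge0. Qed.
Let lamz : 1 + lam <= 2 * (1 + z). Proof. by case/andP: gam_bounds => _ h; rewrite /lam; lra. Qed.
Let lamgam0 : 0 <= lam * gam. Proof. exact: mulr_ge0. Qed.
Let lamE : lam ^+ 2 - lam * z = lam * gam. Proof. by rewrite /lam; ring. Qed.
Let halfE : lam ^+ 2 / 2 - lam * z = - (z ^+ 2 / 2) + gam ^+ 2 / 2.
Proof. by rewrite /lam; field. Qed.
Let G0 : 0 < G. Proof. exact: Phi_lt1. Qed.
Let mg0 : 0 <= 2 * Cm * (1 + z) * gam.
Proof. by rewrite !mulr_ge0// addr_ge0. Qed.
Let gg0 : 0 <= gam ^+ 2 / 2. Proof. by rewrite divr_ge0// sqr_ge0. Qed.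

Let ig : integ g.
Proof.
apply/integrableP; split; first exact/measurable_EFinP.
by under eq_integral do rewrite /= ger0_norm//; rewrite -pE ltry.
Qed.
Let pR : p = Exp g. Proof. by apply: EFin_inj; rewrite pE Exp_EFin. Qed.
Let p0 : 0 <= p. Proof. by rewrite pR; apply: Rintegral_ge0. Qed.

Let itail b : integ (fun w => exp_tail lam b (Y w)).
Proof.
apply: (@integ_bounded _ _ _ _ _ 1); first by apply: measurableT_comp mY; exact: measurable_exp_tail.
by move=> w; have /andP[h1 h2] := exp_tail_bounds b lam0 (Y w); rewrite ger0_norm.
Qed.

(** Enlarging the event to [Y > - 2 * gam] leaves an exponential tail of [Y].
    Its normal value involves [1 - Phi (z - gam)], and [mills_lower] makes the
    error [2 * K] relative to [1 - Phi z]. *)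
Lemma tilted_tail_upper : p <= expR E * (1 + 2 * Cm * (1 + z) * K) * G.
Proof.
have step : p <= expR (lam ^+ 2 / 2 + e - lam * z + 2 * lam * gam) * Exp (fun w => exp_tail lam (- (2 * gam)) (Y w)).
  rewrite -RintegralZl// pR; apply: Exp_le_ae => //; first exact: integZ.
  move: XY; apply: filterS2 MB => w /andP[_ Mle] /andP[h1 h2].
  rewrite /g exp_tailE indicE; have [zX|zX] := boolP (w \in _); last first.
    by rewrite mul0r mul0r mulr_ge0 ?expR_ge0//; case: ifP => //; rewrite expR_ge0.
  move: zX; rewrite inE/= => zX; rewrite (_ : - (2 * gam) < Y w); last lra.
  rewrite mul1r; apply: (@le_trans _ _ (expR (- (lam * X w)) * expR (lam ^+ 2 / 2 + e))).
    by rewrite ler_wpM2l ?expR_ge0.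
  rewrite -!expRD ler_expR.
  have : lam * (Y w + z) <= lam * X w by rewrite ler_wpM2l//; lra.
  lra.
have := exp_transfer (- (2 * gam)) mY nY lam0; rewrite ler_norml => /andP[_ tr].
apply: (le_trans step).
set I := Rintegral _ _ _ in tr *; set Ph := 1 - Phi _ in tr.
have Ple : Ph <= G * expR (Cm * (1 + z) * gam).
  have h := @gauss_tail_ratio R (z - gam) z.
  rewrite /Ph (_ : - (2 * gam) + lam = z - gam); last by rewrite /lam; ring.
  apply: (le_trans (h _ _)); first by case/andP: gam_bounds; rewrite subr_ge0.
    by rewrite gerBl.
  by rewrite (_ : z - (z - gam) = gam) //; ring.
set a := lam ^+ 2 / 2 + e - lam * z + 2 * lam * gam in step *.
apply: (@le_trans _ _ (expR a * (expR (lam * - (2 * gam) + lam ^+ 2 / 2) * Ph) + expR a * (2 * K))).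
  by rewrite -mulrDr ler_wpM2l ?expR_ge0//; lra.
rewrite (_ : expR E * _ * G = expR E * G + expR E * (2 * Cm * (1 + z) * K) * G); last by ring.
apply: lerD.
  rewrite mulrA -expRD.
  apply: (@le_trans _ _ (expR (a + (lam * - (2 * gam) + lam ^+ 2 / 2)) * (G * expR (Cm * (1 + z) * gam)))).
    by rewrite ler_wpM2l ?expR_ge0.
  rewrite mulrCA -expRD mulrC ler_wpM2r ?(ltW G0)// ler_expR /a /E.
  have : lam ^+ 2 - lam * z = lam * gam by [].
  have : 0 <= Cm * (1 + z) * gam by rewrite !mulr_ge0// addr_ge0.
  move: gg0 lamgam0; lra.
have m := mills_lower z0.
rewrite (_ : a = - (z ^+ 2 / 2) + (e + 2 * lam * gam + gam ^+ 2 / 2)); last first.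
  by rewrite /a; have := halfE; lra.
rewrite expRD.
apply: (@le_trans _ _ (Cm * (1 + z) * G * expR E * (2 * K))).
  rewrite ler_wpM2r ?mulr_ge0//; apply: ler_pM; rewrite ?expR_ge0//.
  by rewrite ler_expR /E; move: mg0; lra.
by rewrite le_eqVlt; apply/orP; left; apply/eqP; ring.
Qed.

(** Shrink the event to [Y > 0]. The normal value of the exponential tail is
    at least [1 / (Cm * (1 + lam))], so that the error [2 * K] is relative to
    it and costs nothing in the exponent. *)
Lemma tilted_tail_lower : expR (- E) * (1 - 4 * Cm * (1 + z) * K) * G <= p.
Proof.
have [neg|pos] := leP (1 - 4 * Cm * (1 + z) * K) 0.
  apply: le_trans p0; rewrite mulr_le0_ge0 ?(ltW G0)// mulr_ge0_le0 ?expR_ge0//.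
pose a := lam ^+ 2 / 2 - e - lam * z - 2 * lam * gam.
have step : expR a * Exp (fun w => exp_tail lam 0 (Y w)) <= p.
  rewrite -RintegralZl// pR; apply: Exp_le_ae => //; first exact: integZ.
  move: XY; apply: filterS2 MB => w /andP[Mle _] /andP[h1 h2].
  rewrite exp_tailE; case: ifP => Y0; last by rewrite mulr0.
  rewrite /g indicE (_ : w \in _); last by rewrite inE/=; lra.
  rewrite mul1r; apply: (@le_trans _ _ (expR (- (lam * X w)) * expR (lam ^+ 2 / 2 - e))); last first.
    by rewrite ler_wpM2l ?expR_ge0.
  rewrite -!expRD ler_expR /a.
  have : lam * X w <= lam * (Y w + 2 * gam + z) by rewrite ler_wpM2l//; lra.
  lra.
apply: le_trans step.
have := exp_transfer 0 mY nY lam0; rewrite ler_norml mulr0 !add0r => /andP[tr _].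
set I := Rintegral _ _ _ in tr *; set H := expR _ * _ in tr.
have H1 : 1 <= Cm * (1 + lam) * H.
  have := mills_lower lam0 => m.
  rewrite /H mulrCA; apply: (@le_trans _ _ (expR (lam ^+ 2 / 2) * expR (- (lam ^+ 2 / 2)))).
    by rewrite -expRD subrr expR0.
  by rewrite ler_wpM2l ?expR_ge0.
have H0 : 0 <= H by rewrite mulr_ge0 ?expR_ge0// ltW// Phi_lt1.
have IH : H * (1 - 4 * Cm * (1 + z) * K) <= I.
  have : 2 * K * 1 <= 2 * K * (Cm * (1 + lam) * H) by rewrite ler_wpM2l// mulr_ge0.
  have : 2 * K * (Cm * H) * (1 + lam) <= 2 * K * (Cm * H) * (2 * (1 + z)).
    by apply: ler_wpM2l => //; exact: mulr_ge0 (mulr_ge0 _ _) (mulr_ge0 _ _).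
  lra.
apply: (@le_trans _ _ (expR a * (H * (1 - 4 * Cm * (1 + z) * K)))); last by rewrite ler_wpM2l ?expR_ge0.
rewrite mulrAC mulrA ler_wpM2r ?(ltW pos)// /H mulrA -expRD.
have rat : G * expR (- (2 * Cm * (1 + z) * gam)) <= 1 - Phi lam.
  have := @gauss_tail_ratio R z lam z0; rewrite lerDl gam0 => /(_ isT).
  rewrite /lam [z + gam - z]addrC addKr -/lam -/G => r.
  rewrite expRN ler_pdivrMr ?expR_gt0//; apply: (le_trans r).
  rewrite ler_wpM2l ?(ltW (Phi_lt1 _))// ler_expR ler_wpM2r//.
  by rewrite (_ : 2 * Cm * _ = Cm * (2 * (1 + z))); [rewrite ler_wpM2l|ring].
apply: (@le_trans _ _ (expR (a + lam ^+ 2 / 2) * (G * expR (- (2 * Cm * (1 + z) * gam))))); last first.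
  by rewrite ler_wpM2l ?expR_ge0.
rewrite mulrCA -expRD mulrC ler_wpM2l ?(ltW G0)// ler_expR /a /E.
by move: gg0 lamgam0 lamE; lra.
Qed.

(** Only the event [0 < Y < 1] is kept; [Phi_window] bounds its probability
    below. *)
Lemma tilted_tail_window : K <= 18^-1 -> expR (- E) * (expR (- (2 * z)) / 18) * G <= p.
Proof.
move=> K18; pose a := lam ^+ 2 / 2 - e - lam * z - 2 * lam * gam - lam.
pose A := [set w | 0 < Y w < 1].
have mA : measurable A.
  rewrite /A (_ : [set w | _] = [set w | Y w \in `]0, 1[]); first exact: measurable_preimage_itv.
  by apply/seteqP; split => w /=; rewrite in_itv.
have step : expR a * Exp (\1_A : T -> R) <= p.
  have iA := integ_indic Q mA.
  rewrite -RintegralZl// pR; apply: Exp_le_ae => //; first exact: integZ.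
  move: XY; apply: filterS2 MB => w /andP[Mle _] /andP[h1 h2].
  rewrite [in leLHS]indicE; have [wA|wA] := boolP (w \in A); last by rewrite mulr0.
  move: wA; rewrite inE /A/= => /andP[Y0 Y1].
  rewrite /g indicE (_ : w \in _); last by rewrite inE/=; lra.
  rewrite mulr1 mul1r; apply: (@le_trans _ _ (expR (- (lam * X w)) * expR (lam ^+ 2 / 2 - e))); last first.
    by rewrite ler_wpM2l ?expR_ge0.
  rewrite -!expRD ler_expR /a.
  have : lam * X w <= lam * (1 + 2 * gam + z) by rewrite ler_wpM2l//; lra.
  lra.
apply: le_trans step; rewrite Exp_indic//.
have h18 : 18^-1 <= fine (Q A).
  have [_ /(_ 0 1 ltr01)] := nY; rewrite ler_norml => /andP[h _].
  have := @Phi_window R 1; rewrite ler01 lexx => /(_ isT) w; lra.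
apply: (@le_trans _ _ (expR a * 18^-1)); last by rewrite ler_wpM2l ?expR_ge0.
rewrite (_ : _ * _ * G = G * (expR (- E) * expR (- (2 * z))) / 18); last by ring.
rewrite ler_wpM2r// -expRD.
apply: (@le_trans _ _ (expR (- (z ^+ 2 / 2)) * expR (- E + - (2 * z)))).
  by rewrite ler_wpM2r ?expR_ge0// gauss_tail_le.
rewrite -expRD ler_expR /a /E; have := halfE; move: mg0 gg0.
have : lam <= 2 * z by case/andP: gam_bounds => _; rewrite /lam; lra.
lra.
Qed.

End tilted_tail.

Section tilt_parameters.
Context (R : realType).
Variables (z delta eps L gam lam : R).
Hypothesis z0 : 0 <= z.
Hypothesis d01 : 0 <= delta <= 2^-1.
Hypothesis e0 : 0 < eps.
Hypothesis L0 : 2^-1 <= L.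
Hypothesis zd1 : z * delta <= 1.
Hypothesis ze1 : 1200 * (z * eps) <= 2^-1.
Hypothesis gamE : gam = 2 * z * delta ^+ 2 + 1200 * (z ^+ 2 * eps).
Hypothesis lamE : lam = z + gam.

Let d0 : 0 <= delta. Proof. by case/andP: d01. Qed.
Let dh : delta <= 2^-1. Proof. by case/andP: d01. Qed.
Let zd0 : 0 <= z * delta. Proof. exact: mulr_ge0. Qed.
Let ze0 : 0 <= z * eps. Proof. by rewrite mulr_ge0// ltW. Qed.
Let q0 : 0 <= z ^+ 2 * eps. Proof. by rewrite mulr_ge0 ?sqr_ge0// ltW. Qed.
Let A0 : 0 <= z ^+ 3 * eps. Proof. by rewrite mulr_ge0 ?exprn_ge0// ltW. Qed.
Let zd2 : z * delta ^+ 2 <= z * delta / 2.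
Proof. by rewrite expr2 mulrA ler_wpM2l. Qed.
Let zd2_ge0 : 0 <= z * delta ^+ 2. Proof. by rewrite mulr_ge0// sqr_ge0. Qed.

Lemma gam_ge0 : 0 <= gam.
Proof. by rewrite gamE; move: zd2_ge0 q0; lra. Qed.

Lemma gam_le : gam <= z.
Proof.
have h1 : z * delta * delta <= z * 2^-1 * 2^-1 by rewrite ler_pM// ler_wpM2l.
have h2 : z * (1200 * (z * eps)) <= z * 2^-1 by rewrite ler_wpM2l.
by rewrite gamE !expr2; lra.
Qed.

Lemma lam_ge0 : 0 <= lam. Proof. by rewrite lamE addr_ge0// gam_ge0. Qed.
Lemma lam_le : lam <= 2 * z. Proof. by rewrite lamE; have := gam_le; lra. Qed.

(** The first term of [gam] covers the uncertainty [delta^2] of the variance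
    and the second the relative error of the drift. *)
Lemma drift_bounds S B : 1 - delta ^+ 2 <= S <= 1 + delta ^+ 2 ->
  `|B - lam * S| <= 240 * lam ^+ 2 * eps * S -> z <= B <= z + 2 * gam.
Proof.
move=> /andP[S1 S2]; rewrite ler_norml => /andP[B1 B2].
have l0 := lam_ge0; have l2 := lam_le.
have d2 : delta ^+ 2 <= 4^-1.
  have : delta * delta <= 2^-1 * 2^-1 by rewrite ler_pM.
  by rewrite expr2; lra.
have h1 : lam * S <= lam * (1 + delta ^+ 2) by rewrite ler_wpM2l.
have h2 : lam * (1 - delta ^+ 2) <= lam * S by rewrite ler_wpM2l.
have h3 : lam * delta ^+ 2 <= 2 * z * delta ^+ 2 by rewrite ler_wpM2r ?sqr_ge0.
have h4 : lam ^+ 2 * eps * S <= 5 * (z ^+ 2 * eps).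
  have ll : lam ^+ 2 * eps <= (2 * z) ^+ 2 * eps.
    by rewrite ler_wpM2r ?(ltW e0)// lerXn2r ?nnegrE// mulr_ge0.
  have le0 : 0 <= lam ^+ 2 * eps by rewrite mulr_ge0 ?sqr_ge0// ltW.
  have S54 : S <= 5 / 4 by lra.
  have : lam ^+ 2 * eps * S <= lam ^+ 2 * eps * (5 / 4) by rewrite ler_wpM2l.
  by move: ll; rewrite exprMn; lra.
have h5 : 240 * lam ^+ 2 * eps * S = 240 * (lam ^+ 2 * eps * S) by ring.
rewrite h5 in B1 B2.
have gE := gamE; have lE := lamE; rewrite -[1200 * _]mulr1 in gE.
by apply/andP; split; move: h1 h2 h3 h4 B1 B2 lE gE; lra.
Qed.

(** All terms reduce to [z * delta], [z * eps] and [z^3 eps], by [z^2 eps <= z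
    * eps + z^3 eps]. *)
Lemma tilt_exponent_le (Cm : R) : 0 <= Cm ->
  (lam ^+ 2 * delta ^+ 2 / 2 + 152 * (lam ^+ 3 * eps)) + 2 * lam * gam + gam ^+ 2 / 2 + 2 * Cm * (1 + z) * gam <=
  (1218 + 2403 * (5 + 2 * Cm)) * (z * (eps * L + delta) + z ^+ 3 * eps).
Proof.
move=> Cm0; have l0 := lam_ge0; have l2 := lam_le; have g0 := gam_ge0; have gz := gam_le.
have A0' := A0; set A := z ^+ 3 * eps in A0' *; set zD := z * (eps * L + delta).
have zeL : z * eps <= 2 * (z * eps * L).
  by have := ler_wpM2l ze0 L0; lra.
have zDE : zD = z * eps * L + z * delta by rewrite /zD; ring.
have zd22 : z ^+ 2 * delta ^+ 2 <= z * delta.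
  by rewrite (_ : _ * _ = z * delta * (z * delta)); [rewrite ler_piMr|ring].
have qle : z ^+ 2 * eps <= z * eps + A.
  rewrite -subr_ge0 (_ : _ - _ = z * eps * ((z - 2^-1) ^+ 2 + 3 / 4)); last by rewrite /A; field.
  by rewrite mulr_ge0// addr_ge0 ?sqr_ge0//; lra.
have e1 : lam ^+ 2 * delta ^+ 2 <= 4 * (z ^+ 2 * delta ^+ 2).
  apply: (@le_trans _ _ ((2 * z) ^+ 2 * delta ^+ 2)).
    by rewrite ler_wpM2r ?sqr_ge0// lerXn2r ?nnegrE// mulr_ge0.
  by rewrite exprMn; lra.
have e3 : lam ^+ 3 * eps <= 8 * A.
  apply: (@le_trans _ _ ((2 * z) ^+ 3 * eps)).
    by rewrite ler_wpM2r ?(ltW e0)// lerXn2r ?nnegrE// mulr_ge0.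
  by rewrite exprMn /A; lra.
have lg : 2 * lam * gam <= 4 * ((1 + z) * gam).
  have : lam * gam <= 2 * z * gam by rewrite ler_wpM2r.
  lra.
have gg : gam ^+ 2 / 2 <= (1 + z) * gam.
  have : gam * gam <= z * gam by rewrite ler_wpM2r.
  rewrite expr2; have : 0 <= z * gam by exact: mulr_ge0.
  lra.
have gle : (1 + z) * gam <= 2403 * (zD + A).
  rewrite gamE (_ : (1 + z) * _ = 2 * (z * delta ^+ 2) + 2 * (z ^+ 2 * delta ^+ 2) + 1200 * (z ^+ 2 * eps) + 1200 * A); last by rewrite /A; ring.
  by rewrite zDE; move: zd2 zd22 qle zeL A0' zd0 ze0; lra.
have : Cm * ((1 + z) * gam) <= Cm * (2403 * (zD + A)) by rewrite ler_wpM2l.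
have zDA : z * delta <= zD by rewrite zDE; move: zeL ze0; lra.
by move: e1 e3 lg gg gle zd22 A0' zd0; lra.
Qed.

End tilt_parameters.

Section tilt_product.
Context (R : realType).

Lemma expR_sub_sqr_le (a : R) : 0 <= a -> expR (a - a ^+ 2) <= 1 + a.
Proof.
move=> a0; rewrite -[a - _]opprK expRN -[leRHS]invrK lef_pV2 ?posrE ?expR_gt0//; last first.
  by rewrite invr_gt0; lra.
apply: le_trans (expR_ge1Dx _); rewrite -[leLHS]mul1r ler_pdivrMr; last lra.
have : 0 <= a ^+ 3 by rewrite exprn_ge0.
by lra.
Qed.

(** From [1 + a <= expR a] and [expR (a - a^2) <= 1 + a], where [a^2] is at
    most [lam^3 eps v]. *)
Lemma mgf_factor_bounds (lam eps v m : R) : 0 <= lam -> 0 < eps -> lam * eps <= (4 * 4000)^-1 ->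
  0 <= v <= 12 * eps ^+ 2 -> `|m - 1 - lam ^+ 2 * v / 2| <= 120 * lam ^+ 3 * eps * v ->
  expR ((lam ^+ 2 / 2 - 121 * (lam ^+ 3 * eps)) * v) <= m <=
  expR ((lam ^+ 2 / 2 + 121 * (lam ^+ 3 * eps)) * v).
Proof.
move=> l0 e0 le /andP[v0 v1]; rewrite ler_norml => /andP[m1 m2].
have lv0 : 0 <= lam ^+ 2 * v by rewrite mulr_ge0// sqr_ge0.
have r0 : 0 <= lam ^+ 3 * eps * v by rewrite !mulr_ge0 ?exprn_ge0// ltW.
have rE : 120 * lam ^+ 3 * eps * v = 120 * (lam ^+ 3 * eps * v) by ring.
rewrite rE in m1 m2.
have ry : lam ^+ 3 * eps * v <= (4 * 4000)^-1 * (lam ^+ 2 * v).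
  by rewrite (_ : _ * v = lam * eps * (lam ^+ 2 * v)); [rewrite ler_wpM2r|ring].
apply/andP; split; last first.
  apply: le_trans (expR_ge1Dx _); rewrite mulrDl; move: m2 r0; clear; lra.
set a := lam ^+ 2 * v / 2 - 120 * (lam ^+ 3 * eps * v).
have a0 : 0 <= a by rewrite /a; move: ry lv0; clear; lra.
have am : 1 + a <= m by rewrite /a; move: m1; clear; lra.
apply: le_trans am; apply: le_trans (expR_sub_sqr_le a0); rewrite ler_expR.
have ay : a <= lam ^+ 2 * v / 2 by rewrite /a; move: r0; clear; lra.
have : a ^+ 2 <= lam ^+ 3 * eps * v.
  rewrite expr2; apply: (@le_trans _ _ (lam ^+ 2 * v / 2 * (lam ^+ 2 * v / 2))); first by rewrite ler_pM.
  have : lam ^+ 2 * v * (lam ^+ 2 * v) <= lam ^+ 2 * v * (lam ^+ 2 * (12 * eps ^+ 2)).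
    by rewrite ler_wpM2l// ler_wpM2l// sqr_ge0.
  have : lam ^+ 3 * eps * v * (lam * eps) <= lam ^+ 3 * eps * v * (4 * 4000)^-1.
    by rewrite ler_wpM2l.
  move: r0; clear; lra.
by rewrite /a; clear; lra.
Qed.

Lemma prod_expR_bounds n (lo hi : R) (v m : nat -> R) :
  (forall i, expR (lo * v i) <= m i <= expR (hi * v i)) ->
  expR (lo * \sum_(i < n) v i) <= \prod_(i < n) m i <= expR (hi * \sum_(i < n) v i).
Proof.
move=> H; elim: n => [|n IH]; first by rewrite !big_ord0 !mulr0 expR0 lexx.
rewrite !big_ord_recr/= !mulrDr !expRD; case/andP: IH => h1 h2; case/andP: (H n) => h3 h4.
have p0 : 0 <= m n by apply: le_trans h3; exact: expR_ge0.
have p1 : 0 <= \prod_(i < n) m i by apply: le_trans h1; exact: expR_ge0.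
by rewrite !ler_pM ?expR_ge0.
Qed.

End tilt_product.

(** The lower bound is trivial when [c * (1 + z) * D] exceeds one. Otherwise
    it comes from the sharp bound if [z^2 eps] is small, and from the crude
    one if not. *)
Lemma ratio_bounds (R : realType) (C Cm c2 : R) : 0 < C -> 0 < Cm -> 0 <= c2 ->
  exists2 c : R, 0 < c & forall r z eps D K : R, 0 <= r -> 0 <= z -> 0 < eps <= 2^-1 ->
  0 <= D -> z * D <= 1 -> (1 + z) * D <= 3 -> z * eps <= 2 * (z * D) ->
  K <= C * (D + 2000 * (z * eps)) -> 36 * (C * (2000 * (z * eps))) <= 1 ->
  r <= expR (c2 * (z * D + z ^+ 3 * eps)) * (1 + 2 * Cm * (1 + z) * K) ->
  expR (- (c2 * (z * D + z ^+ 3 * eps))) * (1 - 4 * Cm * (1 + z) * K) <= r ->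
  (K <= 18^-1 -> expR (- (c2 * (z * D + z ^+ 3 * eps))) * (expR (- (2 * z)) / 18) <= r) ->
  expR (- (c * (z ^+ 3 * eps))) * (1 - c * ((1 + z) * D)) <= r <=
  expR (c * (z ^+ 3 * eps)) * (1 + c * ((1 + z) * D)).
Proof.
move=> C0 Cm0 c20.
have [C3 [C30 C3E]] : exists C3 : R, 0 < C3 /\ C3 = 4001 * C.
  by exists (4001 * C); split; [exact: mulr_gt0 (ltr0Sn _ _) C0|reflexivity].
have CC0 : 0 < Cm * C3 by exact: mulr_gt0.
have [c4 [c40 c4E]] : exists c4 : R, 0 < c4 /\ c4 = 6 * (Cm * C3).
  by exists (6 * (Cm * C3)); split => //; lra.
have [c5 [c50 c5E]] : exists c5 : R, 0 < c5 /\ c5 = 4 * (Cm * C3).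
  by exists (4 * (Cm * C3)); split => //; lra.
have a0p : 0 < 4 * c5 + 1 by lra.
have [a0 a01 ca0] : exists2 a0 : R, 0 < a0 <= 1 & c5 * a0 <= 4^-1.
  exists (4 * c5 + 1)^-1; first by rewrite invr_gt0 a0p/= invf_le1//; lra.
  by rewrite ler_pdivrMr//; lra.
pose u1 := c2 + c4; pose u2 := c2 * expR c2 + c4 + 3 * (c2 * expR c2) * c4.
pose l1 := c2 + 2 * c5; pose l2 := c2 + 6 * c5.
pose w1 := c2 + 2 / a0 + (c2 + 18) / a0 ^+ 2.
have ce0 : 0 <= c2 * expR c2 by rewrite mulr_ge0 ?expR_ge0.
have u10 : 0 <= u1 := addr_ge0 c20 (ltW c40).
have u20 : 0 <= u2.
  exact: addr_ge0 (addr_ge0 ce0 (ltW c40)) (mulr_ge0 (mulr_ge0 (ler0n R 3) ce0) (ltW c40)).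
have l10 : 0 <= l1 := addr_ge0 c20 (mulr_ge0 (ler0n R 2) (ltW c50)).
have l20 : 0 <= l2 := addr_ge0 c20 (mulr_ge0 (ler0n R 6) (ltW c50)).
have w10 : 0 <= w1.
  case/andP: a01 => a00 _; rewrite /w1 !addr_ge0// divr_ge0 ?sqr_ge0 ?(ltW a00)//.
  by rewrite addr_ge0.
have [c [cu1 cu2 cl1 cl2 [cw1 cC]]] : exists c : R,
    [/\ u1 <= c, u2 <= c, l1 <= c, l2 <= c & w1 <= c /\ 36 * C <= c].
  exists (u1 + u2 + l1 + l2 + w1 + 36 * C).
  by move: u10 u20 l10 l20 w10 C0; move: (u1) (u2) (l1) (l2) (w1); clear => *; do 5?split; lra.
have c0 : 0 < c := lt_le_trans (mulr_gt0 (ltr0Sn R 35) C0) cC.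
exists c => // r z eps D K r0 z0 e01 D0 zD1 D13 ze KC Cze U L1 L2.
have /andP[e0 e1] := e01.
set A := z ^+ 3 * eps in U L1 L2 *; set D1 := (1 + z) * D in D13 *.
have A0 : 0 <= A by rewrite mulr_ge0 ?exprn_ge0// ltW.
have zD0 : 0 <= z * D by exact: mulr_ge0.
have zDD1 : z * D <= D1 by rewrite /D1 mulrDl mul1r lerDr.
have DD1 : D <= D1 by rewrite /D1 mulrDl mul1r lerDl.
have D10 : 0 <= D1 by exact: le_trans D0 DD1.
pose q := z ^+ 2 * eps.
have q0 : 0 <= q by rewrite mulr_ge0 ?sqr_ge0// ltW.
have ze0 : 0 <= z * eps by rewrite mulr_ge0// ltW.
have qle : q <= 2 * D1 + A.
  apply: (@le_trans _ _ (z * eps + A)); last by move: ze zDD1; clear; lra.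
  rewrite -subr_ge0 (_ : _ - _ = z * eps * ((z - 2^-1) ^+ 2 + 3 / 4)); last by rewrite /A /q; field.
  by rewrite mulr_ge0// addr_ge0 ?sqr_ge0//; lra.
have kle : (1 + z) * K <= C3 * (D1 + q).
  have h : (1 + z) * K <= (1 + z) * (C * (D + 2000 * (z * eps))) by rewrite ler_wpM2l// addr_ge0.
  have -> : C3 * (D1 + q) = C * (4001 * (D1 + q)) by rewrite C3E; ring.
  apply: (le_trans h); rewrite mulrCA ler_pM2l//.
  rewrite (_ : (1 + z) * _ = D1 + 2000 * (z * eps) + 2000 * q); last by rewrite /D1 /q; ring.
  by move: ze zDD1 q0; clear; lra.
have kU : 2 * Cm * (1 + z) * K <= c4 * (D1 + A).
  rewrite -mulrA; apply: (@le_trans _ _ (2 * Cm * (C3 * (D1 + q)))).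
    by apply: ler_wpM2l kle; exact: mulr_ge0 (ler0n _ _) (ltW Cm0).
  rewrite (_ : c4 * _ = 2 * Cm * (C3 * (3 * (D1 + A)))); last by rewrite c4E; ring.
  apply: ler_wpM2l; first exact: mulr_ge0 (ler0n _ _) (ltW Cm0).
  by apply: (ler_wpM2l (ltW C30)); move: qle A0; clear; lra.
have kL : 4 * Cm * (1 + z) * K <= c5 * (D1 + q).
  rewrite -mulrA c5E (_ : 4 * (Cm * C3) * _ = 4 * Cm * (C3 * (D1 + q))); last by ring.
  by apply: ler_wpM2l kle; exact: mulr_ge0 (ler0n _ _) (ltW Cm0).
apply/andP; split; last first.
  have := @ratio_upper R r c2 c4 A D1 (z * D) _ c20 (ltW c40) A0 _ zDD1 D13 kU U.
  rewrite zD0 zD1 => /(_ isT); rewrite -/u1 -/u2 => /le_trans; apply.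
  apply: ler_pM.
  - exact: expR_ge0.
  - exact: addr_ge0 ler01 (mulr_ge0 _ _).
  - by rewrite ler_expR ler_wpM2r.
  - by rewrite lerD2l ler_wpM2r.
have [big|small] := leP 1 (c * D1).
  by apply: le_trans r0; rewrite mulr_ge0_le0 ?expR_ge0//; move: big; clear; lra.
have lD : l2 * D1 <= c * D1 by rewrite ler_wpM2r.
have [qs|ql] := leP q a0.
  have q4 : c5 * q <= 4^-1 by apply: le_trans ca0; rewrite ler_wpM2l// ltW.
  have := @ratio_lower_small R r c2 c5 A D1 (z * D) _ q c20 c50 A0 zD0 zDD1 q0 qle q4 kL L1.
  rewrite -/l1 -/l2 => h; apply: le_trans (h _); last by move: lD small; clear; lra.
  apply: ler_pM.
  - exact: expR_ge0.
  - by move: small; clear; lra.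
  - by rewrite ler_expR lerN2 ler_wpM2r.
  - by move: lD; clear; lra.
have K18 : K <= 18^-1.
  have : 36 * C * D <= c * D1 by apply: ler_pM => //; exact: mulr_ge0 (ler0n _ _) (ltW C0).
  by move: KC Cze small; clear; lra.
have zD01 : 0 <= z * D <= 1 by rewrite zD0.
have := @ratio_lower_large R r c2 a0 A (z * D) z q eps c20 a01 zD01 z0 e01 erefl erefl (ltW ql) (L2 K18).
rewrite -/w1; apply: le_trans.
apply: (@le_trans _ _ (expR (- (c * A)) * 1)).
  by rewrite ler_wpM2l ?expR_ge0// gerBl mulr_ge0// ltW.
by rewrite mulr1 ler_expR lerN2 ler_wpM2r.
Qed.

Lemma prod_tilt_factors (R : realType) n (lam : R) (x m : nat -> R) :
  (forall i, m i != 0) ->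
  \prod_(i < n) m i * \prod_(i < n) (expR (lam * x i) / m i) = expR (lam * \sum_(i < n) x i).
Proof.
move=> m0; rewrite -big_split/= mulr_sumr expR_sum; apply: eq_bigr => i _.
by rewrite mulrC divfK.
Qed.

Lemma eps_abs_ln_le1 (R : realType) (eps : R) : 0 < eps <= 2^-1 -> eps * `|ln eps| <= 1.
Proof.
move=> /andP[e0 e1]; rewrite ler0_norm; last by rewrite ln_le0//; lra.
rewrite -lnV ?posrE// mulrC -ler_pdivlMr// mul1r ltW// ln_sublinear ?invr_gt0//.
Qed.

(** The integral of the indicator of a null set vanishes against any density. *)
Lemma ae_tilt (d : measure_display) (T : measurableType d) (R : realType)
    (P Q : probability T R) (W : T -> R) (D : T -> Prop) :
  measurable_fun setT W -> measurable [set w | D w] ->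
  (forall f : T -> R, measurable_fun setT f -> (forall w, 0 <= f w) ->
     (\int[Q]_w (f w)%:E = \int[P]_w (f w * W w)%:E)%E) ->
  {ae P, forall w, D w} -> {ae Q, forall w, D w}.
Proof.
move=> mW mD HQ hP; have mC : measurable (~` [set w | D w]) by exact: measurableC.
exists (~` [set w | D w]); split=> //.
have mI : measurable_fun setT (\1_(~` [set w | D w]) : T -> R) by exact: measurable_indic.
have -> : Q (~` [set w | D w]) = (\int[Q]_w (\1_(~` [set w | D w]) w)%:E)%E.
  by rewrite integral_indic// setIT.
rewrite HQ//.
transitivity (\int[P]_w (cst 0%E w))%E; last by rewrite integral0.
apply: ae_eq_integral => //.
- by apply/measurable_EFinP; exact: measurable_funM.
- apply: filterS hP => w Dw _ /=; rewrite indicE memNset ?mul0r//=.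
Qed.

(** The range of [z] keeps [lam * eps] small, as the tilt requires, and [lam *
    eps * |ln eps|] small, as [berry_esseen] does. *)
Theorem bernstein_tail_ratio (R : realType) :
  exists2 alpha0 : R, 0 < alpha0 & exists2 c : R, 0 < c &
  forall (d : measure_display) (T : measurableType d) (P : probability T R)
    (F : nat -> set (set T)) (x v : nat -> T -> R) (n : nat) (eps delta : R),
    0 < eps <= 2^-1 -> 0 <= delta <= 2^-1 ->
    bernstein_martingale P F x v n eps (1 + delta ^+ 2) ->
    {ae P, forall w, 1 - delta ^+ 2 <= partial v n w} ->
    forall z : R, 0 <= z -> z * (eps * `|ln eps|) <= alpha0 -> z * delta <= alpha0 ->
    expR (- (c * (z ^+ 3 * eps))) * (1 - c * ((1 + z) * (eps * `|ln eps| + delta))) <=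
    fine (P [set w | z < partial x n w]) / (1 - std_normal_cdf z) <=
    expR (c * (z ^+ 3 * eps)) * (1 + c * ((1 + z) * (eps * `|ln eps| + delta))).
Proof.
have [C C0 [kappa kappa0 BE]] := @berry_esseen R 600 (ltac:(by rewrite ler1n)).
have Cm0 := mills_constant_gt0 R.
set Cm := mills_constant R in Cm0.
have c20 : 0 <= 1218 + 2403 * (5 + 2 * Cm).
  by apply: addr_ge0; [exact: ler0n|apply: mulr_ge0; [exact: ler0n|move: Cm0; clear; lra]].
have [c c0 final] := ratio_bounds C0 Cm0 c20.
(* The bounds on [alpha0] are for the tilt, for [berry_esseen] and for the
   window of [tilted_tail_window]. *)
have [alpha0 a0 [a1 a2 a3]] : exists2 alpha0 : R, 0 < alpha0 &
    [/\ alpha0 <= (16 * 4000)^-1, 2000 * alpha0 <= kappa & 36 * (C * (4000 * alpha0)) <= 1].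
  have [h1 h2 h3] : [/\ 0 < (16 * 4000)^-1 :> R, 0 < kappa / 2000 & 0 < (36 * C * 4000)^-1].
    have p n : 0 < n.+1%:R :> R by [].
    split; rewrite ?invr_gt0.
    - exact: mulr_gt0 (ltr0Sn _ _) (ltr0Sn _ _).
    - by apply: divr_gt0 => //; exact: ltr0Sn.
    - exact: mulr_gt0 (mulr_gt0 (ltr0Sn _ _) C0) (ltr0Sn _ _).
  exists (Num.min (16 * 4000)^-1 (Num.min (kappa / 2000) (36 * C * 4000)^-1)).
    by rewrite !lt_min h1 h2 h3.
  set m := Num.min _ _.
  have m1 : m <= (16 * 4000)^-1 by rewrite /m ge_min lexx.
  have m2 : m <= kappa / 2000 by rewrite /m !ge_min lexx !orbT.
  have m3 : m <= (36 * C * 4000)^-1 by rewrite /m !ge_min lexx !orbT.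
  split; first exact: m1.
  - by move: m2; rewrite ler_pdivlMr ?ltr0Sn// mulrC.
  - move: m3; rewrite -[leRHS]mul1r ler_pdivlMr; last by rewrite -invr_gt0.
    by congr (_ <= _); ring.
exists alpha0 => //; exists c => // d T P F x v n eps delta e01 d01 bm Slow z z0 zeL zd.
set L := `|ln eps| in zeL *.
have /andP[e0 eh] := e01; have /andP[d0 dh] := d01.
have Lh : 2^-1 <= L by exact: abs_ln_ge_half.
have zdeps0 : 0 <= z * eps by rewrite mulr_ge0// ltW.
have L0 : 0 <= L by rewrite /L normr_ge0.
have eL0 : 0 <= eps * L by rewrite mulr_ge0// ltW.
have ze : z * eps <= 2 * (z * (eps * L)).
  by have := ler_wpM2l zdeps0 Lh; rewrite mulrA; clear; lra.
have ze2 : z * eps <= 2 * alpha0 by move: ze zeL; clear; lra.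
pose gam := 2 * z * delta ^+ 2 + 1200 * (z ^+ 2 * eps); pose lam := z + gam.
have zd1 : z * delta <= 1.
  by apply: (le_trans zd); apply: (le_trans a1); clear; lra.
have ze1 : 1200 * (z * eps) <= 2^-1 by move: ze2 a1; clear; lra.
have l0 : 0 <= lam := lam_ge0 z0 e0 erefl erefl.
have lz : lam <= 2 * z := lam_le z0 d01 ze1 erefl erefl.
have le4 : lam * eps <= 2 * (z * eps) by rewrite mulrA ler_wpM2r// ltW.
have lam_small : lam * eps <= (4 * 4000)^-1 by move: le4 ze2 a1; clear; lra.
have [Q [b [m [ssm bB mB m1 HQ]]]] := exponential_tilt bm l0 lam_small.
have mm k : measurable_fun setT (m k) by case: (m1 k).
have m_ge1 k w : 1 <= m k w by case: (m1 k).
have mx k : measurable_fun setT (x k).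
  by apply: (measurable_wrt_sub (bm_sub bm (i := k.+1))); exact: (bm_adapted bm).
have mv k : measurable_fun setT (v k).
  by apply: (measurable_wrt_sub (bm_sub bm (i := k))); exact: (bm_predictable bm).
have mpart (y : nat -> T -> R) : (forall k, measurable_fun setT (y k)) -> measurable_fun setT (partial y n).
  by move=> my; apply: measurable_sum => i; exact: my.
pose W w := \prod_(i < n) (expR (lam * x i w) / m i w).
have mW : measurable_fun setT W.
  apply: measurable_prod => i _; apply: measurable_funM.
    by apply: measurableT_comp => //; apply: measurable_funM.
  apply: (@measurable_wrt_sub _ _ _ measurable) => //.
  by apply: mwV; [apply: measurable_wrt_measurable|move=> w; exact: lt_le_trans (m_ge1 i w)].
have SlowQ : {ae Q, forall w, 1 - delta ^+ 2 <= partial v n w}.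
  apply: (@ae_tilt _ _ _ P Q W) => //.
  exact: measurable_ge_set (mpart _ mv).
have omL : 1000 * (lam * eps) * `|ln eps| <= kappa.
  apply: le_trans a2; rewrite -mulrA (_ : 2000 * alpha0 = 1000 * (2 * alpha0)); last by ring.
  apply: (ler_wpM2l (ler0n R 1000)).
  have : lam * (eps * L) <= 2 * z * (eps * L) by rewrite ler_wpM2r.
  by rewrite -/L; move: zeL; clear; lra.
have hK := BE _ _ Q F _ v eps _ delta n e01 d01 ssm SlowQ omL.
set eta := (fun k w => x k w - b k w) in ssm hK.
set K := C * _ in hK.
have meta k : measurable_fun setT (eta k).
  by apply: (measurable_wrt_sub (ssm_sub ssm (i := k.+1))); exact: (ssm_adapted ssm).
have mY := mpart _ meta.
have nY := near_normal_kolmogorov mY hK.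
have D0 : 0 <= eps * L + delta by rewrite addr_ge0.
have K0 : 0 <= K.
  exact: mulr_ge0 (ltW C0) (addr_ge0 D0 (mulr_ge0 (ler0n R 1000) (mulr_ge0 l0 (ltW e0)))).
pose M w := \prod_(i < n) m i w.
have mM : measurable_fun setT M by apply: measurable_prod => i _.
have M0 w : 0 <= M w by apply: prodr_ge0 => i _; apply: le_trans (m_ge1 i w).
have BS w : `|\sum_(i < n) b i w - lam * partial v n w| <= 240 * lam ^+ 2 * eps * partial v n w.
  rewrite /partial !mulr_sumr -sumrB (le_trans (ler_norm_sum _ _ _))// ler_sum// => i _.
have Sup w : partial v n w <= 1 + delta ^+ 2 by exact: (bm_total bm).
have XY : {ae Q, forall w, partial eta n w <= partial x n w - z <= partial eta n w + 2 * gam}.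
  apply: filterS SlowQ => w S1.
  have S12 : 1 - delta ^+ 2 <= partial v n w <= 1 + delta ^+ 2 by rewrite S1 Sup.
  have := drift_bounds z0 d01 e0 ze1 erefl erefl S12 (BS w).
  have -> : partial eta n w = partial x n w - \sum_(i < n) b i w by rewrite /partial -sumrB.
  by move: (partial x n w) (\sum_(i < n) b i w) => p q; rewrite -/gam; clear; move=> /andP[h1 h2]; apply/andP; split; lra.
pose e := lam ^+ 2 * delta ^+ 2 / 2 + 152 * (lam ^+ 3 * eps).
have l3 : 0 <= lam ^+ 3 * eps by rewrite mulr_ge0 ?exprn_ge0// ltW.
have MB : {ae Q, forall w, expR (lam ^+ 2 / 2 - e) <= M w <= expR (lam ^+ 2 / 2 + e)}.
  apply: filterS SlowQ => w S1; have S2 := Sup w.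
  have := @prod_expR_bounds R n _ _ (fun i => v i w) (fun i => m i w)
    (fun i => mgf_factor_bounds l0 e0 lam_small (bm_v bm i w) (mB i w)).
  rewrite -/(M w) -/(partial v n w) => /andP[h1 h2].
  move: S1 S2 h1 h2; set S := partial v n w => S1 S2 h1 h2.
  have d2 : delta ^+ 2 <= 4^-1.
    have : delta * delta <= 2^-1 * 2^-1 by rewrite ler_pM.
    by rewrite expr2; clear; lra.
  have ll : 0 <= lam ^+ 2 / 2 by rewrite divr_ge0// sqr_ge0.
  have g1 : lam ^+ 2 / 2 * S <= lam ^+ 2 / 2 * (1 + delta ^+ 2) by rewrite ler_wpM2l.
  have g2 : lam ^+ 2 / 2 * (1 - delta ^+ 2) <= lam ^+ 2 / 2 * S by rewrite ler_wpM2l.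
  have g3 : lam ^+ 3 * eps * S <= lam ^+ 3 * eps * (5 / 4).
    by rewrite ler_wpM2l//; move: S2 d2; clear; lra.
  apply/andP; split; [apply: le_trans h1|apply: (le_trans h2)]; rewrite ler_expR /e.
    by move: g2 g3 l3; clear; lra.
  by move: g1 g3 l3; clear; lra.
have pE : (fine (P [set w | z < partial x n w]))%:E =
    (\int[Q]_w (\1_[set w | z < partial x n w] w * expR (- (lam * partial x n w)) * M w)%:E)%E.
  have mA : measurable [set w | z < partial x n w] by exact: measurable_gt_set (mpart _ mx).
  have mI : measurable_fun setT (\1_[set w | z < partial x n w] : T -> R) by exact: measurable_indic.
  rewrite HQ; last 2 first.
  - apply: measurable_funM => //; apply: measurable_funM => //.
    by apply: measurableT_comp => //; apply: measurableT_comp => //; apply: measurable_funM => //; exact: mpart.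
  - by move=> w; rewrite indicE !mulr_ge0 ?expR_ge0.
  transitivity (\int[P]_w (\1_[set w | z < partial x n w] w)%:E)%E.
    by rewrite integral_indic// setIT fineK//; exact: fin_num_measure.
  apply: eq_integral => w _; congr EFin.
  have mn0 i : m i w != 0 by rewrite gt_eqF// (lt_le_trans _ (m_ge1 i w)).
  have := @prod_tilt_factors R n lam (fun i => x i w) (fun i => m i w) mn0.
  rewrite -/(M w) -/(partial x n w) => h.
  by rewrite -[RHS]mulrA h -mulrA -expRD addNr expR0 mulr1.
have gz : 0 <= gam <= z by rewrite (gam_ge0 z0 e0 erefl) (gam_le z0 d01 ze1 erefl).
have E1 := tilt_exponent_le z0 d01 e0 Lh zd1 ze1 erefl erefl (ltW Cm0).
have mX := mpart _ mx.
have U := tilted_tail_upper mX mY mM M0 z0 gz K0 XY MB nY pE.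
have L1 := tilted_tail_lower mX mY mM M0 z0 gz K0 XY MB nY pE.
have L2 := tilted_tail_window mX mY mM M0 z0 gz XY MB nY pE.
move: E1 U L1 L2; rewrite -/gam -/lam -/e -/Cm.
have G0 := Phi_lt1 z.
set E := e + _ + _ + _; set p := fine _ => E1 U L1 L2.
have p0 : 0 <= p by exact: fine_ge0.
apply: (final _ z eps (eps * L + delta) K (divr_ge0 p0 (ltW G0)) z0 e01 D0).
- by rewrite mulrDr; move: zeL zd a1; clear; lra.
- have := eps_abs_ln_le1 e01; rewrite -/L mulrDl mul1r mulrDr.
  by move: zeL zd a1 dh; clear; lra.
- by apply: (le_trans ze); rewrite ler_wpM2l// ler_wpM2l// lerDl.
- rewrite /K ler_wpM2l ?(ltW C0)// lerD2l (_ : 2000 * _ = 1000 * (2 * (z * eps))); last by ring.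
  exact: (ler_wpM2l (ler0n R 1000)).
- apply: le_trans a3; apply: (ler_wpM2l (ler0n R 36)); apply: (ler_wpM2l (ltW C0)).
  rewrite (_ : 4000 * alpha0 = 2000 * (2 * alpha0)); last by ring.
  exact: (ler_wpM2l (ler0n R 2000)).
- rewrite ler_pdivrMr//; apply: (le_trans U); apply: (ler_wpM2r (ltW G0)).
  apply: ler_wpM2r; last by rewrite ler_expR.
  exact: addr_ge0 ler01 (mulr_ge0 (mulr_ge0 (mulr_ge0 (ler0n _ 2) (ltW Cm0)) (addr_ge0 ler01 z0)) K0).
- have [neg|pos] := leP (1 - 4 * Cm * (1 + z) * K) 0.
    by apply: (@le_trans _ _ 0); [rewrite mulr_ge0_le0 ?expR_ge0|rewrite divr_ge0// ltW].
  rewrite ler_pdivlMr//; apply: le_trans L1; apply: (ler_wpM2r (ltW G0)).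
  by apply: (ler_wpM2r (ltW pos)); rewrite ler_expR lerN2.
- move=> K18; rewrite ler_pdivlMr//; apply: le_trans (L2 K18).
  apply: (ler_wpM2r (ltW G0)); apply: ler_wpM2r; last by rewrite ler_expR lerN2.
  exact: divr_ge0 (expR_ge0 _) (ler0n _ _).
Qed.

(** * From moment conditions to bounded conditional variances *)

Section cosh_series.
Context (R : realType).
Implicit Types u y : R.

Definition cosh_part M y : R := \sum_(j < M) y ^+ (2 * j.+1) / (2 * j.+1)`!%:R.

Lemma cosh_part_ge0 M y : 0 <= cosh_part M y.
Proof. by apply: sumr_ge0 => j _; rewrite divr_ge0// exprM exprn_ge0// sqr_ge0. Qed.

Lemma cosh_part_nd y : {homo (fun M => cosh_part M y) : n m / (n <= m)%N >-> n <= m}.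
Proof.
apply/nondecreasing_seqP => M; rewrite /cosh_part big_ord_recr/= lerDl.
by rewrite divr_ge0// exprM exprn_ge0// sqr_ge0.
Qed.

Lemma cosh_partE M y :
  series (exp_coeff y) (2 * M).+1 + series (exp_coeff (- y)) (2 * M).+1 = 2 + 2 * cosh_part M y.
Proof.
elim: M => [|M IH].
  by rewrite muln0 /series/= !big_nat1 /exp_coeff/= /cosh_part big_ord0 !expr0 !divr1 mulr0 addr0.
have e : (2 * M.+1 = (2 * M).+2)%N by rewrite mulnS.
rewrite [X in series _ X.+1]e [X in _ + series _ X.+1]e.
have S (z : R) : series (exp_coeff z) (2 * M).+3 = series (exp_coeff z) (2 * M).+1 +
    (z ^+ (2 * M).+1 / (2 * M).+1`!%:R + z ^+ (2 * M).+2 / (2 * M).+2`!%:R).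
  by rewrite /series/= !big_nat_recr//= -!addrA.
rewrite !S /cosh_part big_ord_recr/= -/(cosh_part M y) e.
rewrite addrACA IH; have -> : (- y) ^+ (2 * M).+1 = - y ^+ (2 * M).+1.
  by rewrite !exprS -mulNr exprM sqrrN -exprM.
have -> : (- y) ^+ (2 * M).+2 = y ^+ (2 * M).+2 by rewrite -e !exprM sqrrN.
by rewrite mulrDr; lra.
Qed.

Lemma cosh_part_cvg u : (fun M => cosh_part M (u / 2)) @ \oo --> cosh1 u.
Proof.
have c (z : R) : (fun M => series (exp_coeff z) (2 * M).+1) @ \oo --> expR z.
  have h : (fun M => (2 * M).+1) @ \oo --> \oo.
    apply/cvgnyPge => A; exists A => // M /= AM; apply: ltnW.
    by rewrite ltnS (leq_trans AM)// leq_pmull.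
  exact: (cvg_comp _ _ h (is_cvg_series_exp_coeff z)).
rewrite (_ : (fun M => _) = fun M => (series (exp_coeff (u / 2)) (2 * M).+1 +
  series (exp_coeff (- (u / 2))) (2 * M).+1) / 2 - 1).
  by apply: cvgB; [apply: cvgM; [exact: cvgD|exact: cvg_cst]|exact: cvg_cst].
by apply/funext => M; rewrite cosh_partE; field.
Qed.

Lemma geo_sum_le M : \sum_(j < M) (4^-1 : R) ^+ j.+1 / 2 <= 6^-1.
Proof.
have -> : \sum_(j < M) (4^-1 : R) ^+ j.+1 / 2 = 6^-1 * (1 - 4^-1 ^+ M).
  elim: M => [|M IH]; first by rewrite big_ord0 expr0 subrr mulr0.
  by rewrite big_ord_recr/= IH exprS; field.
by rewrite ler_piMr// gerBl exprn_ge0.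
Qed.

End cosh_series.

(** Sum the even terms of the series of [cosh]: the term of order [2 * j]
    contributes [4^-j / 2] times [V / eps^2], and [\sum_j 4^-j / 2 = 1 / 6]. *)
Lemma cge0_cosh_of_moments (d : measure_display) (T : measurableType d) (R : realType)
    (P : probability T R) (G : set (set T)) (xi V : T -> R) (eps : R) :
  sigma_algebra setT G -> G `<=` measurable -> 0 < eps ->
  measurable_fun setT xi -> P.-integrable setT (EFin \o V) -> (forall w, 0 <= V w) ->
  (forall j, cge0 P G (fun w =>
     2^-1 * (2 * j.+1)`!%:R * eps ^+ (2 * j) * V w - xi w ^+ (2 * j.+1))) ->
  cge0 P G (fun w => V w / (6 * eps ^+ 2) - cosh1 (xi w / eps)).
Proof.
move=> sG GM e0 mxi iV V0 mom.
have en0 : eps != 0 by rewrite gt_eqF.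
pose g M w := cosh_part M (xi w / eps / 2).
have mg M : measurable_fun setT (g M).
  by apply: measurable_sum => j; apply: measurable_funM => //; apply: measurable_funX; apply: measurable_funM => //; apply: measurable_funM.
have term j : cge0 P G (fun w => (4^-1) ^+ j.+1 / 2 * (V w / eps ^+ 2) - (xi w / eps / 2) ^+ (2 * j.+1) / (2 * j.+1)`!%:R).
  have f0 : 0 <= ((2 * j.+1)`!%:R * (2 * eps) ^+ (2 * j.+1))^-1 :> R.
    by rewrite invr_ge0 mulr_ge0// exprn_ge0// mulr_ge0// ltW.
  have := cge0Z sG GM (mom j) f0; congr (cge0 _ _ _); apply/funext => w.
  have ff : (2 * j.+1)`!%:R != 0 :> R by rewrite pnatr_eq0 -lt0n fact_gt0.
  rewrite !expr_div_n exprMn.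
  have -> : eps ^+ (2 * j.+1) = eps ^+ (2 * j) * eps ^+ 2 by rewrite mulnS addnC exprD.
  have -> : (2 : R) ^+ (2 * j.+1) = 4 ^+ j.+1 by rewrite exprM; congr (_ ^+ _); ring.
  rewrite !exprVn; move: (xi w ^+ _) (V w) => X v; have p4 : (4 : R) ^+ j.+1 != 0 by rewrite expf_neq0.
  have pe : eps ^+ (2 * j) != 0 by rewrite expf_neq0.
  have pe2 : eps ^+ 2 != 0 by rewrite expf_neq0.
  move: ((2 * j.+1)`!%:R) (4 ^+ j.+1) (eps ^+ (2 * j)) ff p4 pe => f p q ff p4 pe.
  by field; rewrite ff p4 pe en0.
have ub M : cge0 P G (fun w => V w / (6 * eps ^+ 2) - g M w).
  have iVs (c : R) : P.-integrable setT (EFin \o (fun w => c * V w)) by exact: integZ.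
  have c1 : cge0 P G (fun w => (\sum_(j < M) (4^-1 : R) ^+ j.+1 / 2) * (V w / eps ^+ 2) - g M w).
    rewrite /g /cosh_part; elim: M => [|M IH].
      rewrite (_ : (fun w => _) = fun=> 0); last by apply/funext => w; rewrite !big_ord0 mul0r subr0.
      by apply: cge0_ge0 => //; exact: integ_cst.
    have := cge0D GM IH (term M); congr (cge0 _ _ _); apply/funext => w.
    by rewrite !big_ord_recr/=; ring.
  have [i1 _] := c1; apply: (cge0_le GM c1) => [|w].
    have i2 : P.-integrable setT (EFin \o (fun w => ((6 * eps ^+ 2)^-1 - (\sum_(j < M) (4^-1 : R) ^+ j.+1 / 2) / eps ^+ 2) * V w)) by exact: iVs.
    have := integD i1 i2; congr (integrable _ _ _); apply/funext => w /=; congr EFin; ring.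
  rewrite lerB// (_ : V w / (6 * eps ^+ 2) = 6^-1 * (V w / eps ^+ 2)); last by field.
  by rewrite ler_wpM2r ?geo_sum_le// divr_ge0// sqr_ge0.
have lim_g w : (fun M => (g M w)%:E) @ \oo --> (cosh1 (xi w / eps))%:E.
  by apply: cvg_EFin; [near=> M; rewrite //|exact: cosh_part_cvg].
have iV6 : P.-integrable setT (EFin \o (fun w => V w / (6 * eps ^+ 2))).
  by have := integZ ((6 * eps ^+ 2)^-1) iV; congr (integrable _ _ _); apply/funext => w /=; rewrite mulrC.
have g_le M A : G A ->
    (\int[P]_(w in A) (g M w)%:E <= \int[P]_(w in A) (V w / (6 * eps ^+ 2))%:E)%E.
  have [iM _] := ub M.
  have ig : P.-integrable setT (EFin \o g M).
    have := integB iV6 iM; congr (integrable _ _ _); apply/funext => w /=; congr EFin; ring.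
  by move: A; apply/(cge0B GM ig iV6).
have int_cosh A : G A -> (\int[P]_(w in A) (cosh1 (xi w / eps))%:E <= \int[P]_(w in A) (V w / (6 * eps ^+ 2))%:E)%E.
  move=> GA; have mA := GM _ GA.
  have -> : (\int[P]_(w in A) (cosh1 (xi w / eps))%:E = \int[P]_(w in A) limn (fun M => (g M w)%:E))%E.
    by apply: eq_integral => w _; apply/esym/cvg_lim.
  have h : (\int[P]_(w in A) (g M w)%:E)%E @[M --> \oo] -->
      (\int[P]_(w in A) limn (fun M => (g M w)%:E))%E.
    apply: (@cvg_monotone_convergence _ _ _ P A mA (fun M w => (g M w)%:E)).
    - by move=> M; apply: measurable_funTS; apply/measurable_EFinP.
    - by move=> M w _; rewrite lee_fin cosh_part_ge0.
    - by move=> w _ k m km; rewrite lee_fin; exact: cosh_part_nd.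
  rewrite -(cvg_lim _ h)//; apply: lime_le; first by apply/cvg_ex; eexists; exact: h.
  by apply: nearW => M; exact: g_le.
have mcosh : measurable_fun setT (fun w => cosh1 (xi w / eps)).
  rewrite /cosh1; apply: measurable_funB => //; apply: measurable_funM => //.
  have m1 : measurable_fun setT (fun w => xi w / eps / 2) by apply: measurable_funM => //; apply: measurable_funM.
  apply: measurable_funD; apply: measurableT_comp => //.
  exact: measurableT_comp.
have GT : G setT by case: sG => G0 GC _; rewrite -(setD0 setT); exact: GC.
have icosh : P.-integrable setT (EFin \o (fun w => cosh1 (xi w / eps))).
  apply/integrableP; split; first exact/measurable_EFinP.
  under eq_integral do rewrite /= ger0_norm ?cosh1_ge0//.
  apply: (le_lt_trans (int_cosh _ GT)).
  by have := integrable_fin_num measurableT iV6; rewrite fin_numElt => /andP[].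
by apply/(cge0B GM icosh iV6) => A GA; exact: int_cosh.
Unshelve. all: by end_near.
Qed.

Lemma bernstein_martingaleN (d : measure_display) (T : measurableType d) (R : realType)
    (P : probability T R) (F : nat -> set (set T)) (x v : nat -> T -> R) n (eps B : R) :
  bernstein_martingale P F x v n eps B ->
  bernstein_martingale P F (fun i w => - x i w) v n eps B.
Proof.
case=> sF FM F_le ad pr e0 v0 tot m_ge m_le v_le v_ge ch st.
split; [exact: sF|exact: FM|exact: F_le| |exact: pr|exact: e0|exact: v0|exact: tot|exact: m_le|..].
- by move=> i; exact: mwN.
- by move=> i; have := m_ge i; congr (cge0 _ _ _); apply/funext => w; rewrite opprK.
- by move=> i; have := v_le i; congr (cge0 _ _ _); apply/funext => w; rewrite sqrrN.
- by move=> i; have := v_ge i; congr (cge0 _ _ _); apply/funext => w; rewrite sqrrN.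
- by move=> i; have := ch i; congr (cge0 _ _ _); apply/funext => w; rewrite mulNr cosh1N.
- by move=> i w /(st i w)[-> ->]; rewrite oppr0.
Qed.

Section truncation.
Context (T : Type) (R : realType).
Variables (V : nat -> T -> R) (B : R).
Hypotheses (V0 : forall i w, 0 <= V i w) (B0 : 0 <= B).

Definition stopped i w := Num.min (partial V i.+1 w) B - Num.min (partial V i w) B.

Lemma partial_stopped k w : partial stopped k w = Num.min (partial V k w) B.
Proof.
elim: k => [|k IH]; first by rewrite /partial !big_ord0 min_l.
by rewrite partialS IH /stopped addrC subrK.
Qed.

Lemma stopped_bounds i w : 0 <= stopped i w <= V i w.
Proof.
rewrite /stopped partialS; have := V0 i w; move: (partial V i w) (V i w) => p q q0.
by case: (leP (p + q) B) => h1; case: (leP p B) => h2; apply/andP; split; lra.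
Qed.

Lemma stopped_eq i k w : (i < k)%N -> partial V k w <= B -> stopped i w = V i w.
Proof.
move=> ik kB; have h j : (j <= k)%N -> partial V j w <= B.
  move=> jk; apply: le_trans kB; rewrite -(subnKC jk); elim: (k - j)%N => [|m IH]; first by rewrite addn0.
  by rewrite addnS partialS (le_trans IH)// lerDl.
by rewrite /stopped !min_l ?h// ?(ltnW ik)// partialS addrC addKr.
Qed.

End truncation.

Section reduction.
Context (d : measure_display) (T : measurableType d) (R : realType).
Variables (P : probability T R) (n : nat) (F : nat -> set (set T)) (xi : nat -> T -> R).
Variables (eps delta : R).
Hypothesis md : martingale_differences P n F xi.
Hypothesis e01 : 0 < eps <= 2^-1.
Hypothesis A1 : condition_A1 P n F xi eps.
Hypothesis A2 : condition_A2 P n F xi delta.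
Notation integ h := (P.-integrable setT (EFin \o h)).

(** Indices are shifted by one, so that step [i] is known at time [i + 1], and
    nothing happens after [n]. *)
Definition steps i w : R := if (i < n)%N then xi i.+1 w else 0.
Definition stopped_filtration i := F (minn i n).
Notation FF := stopped_filtration.

Lemma partial_steps : partial steps n = partial_sum n xi.
Proof.
apply/funext => w; rewrite /partial /partial_sum big_add1/= big_mkord.
by apply: eq_bigr => i _; rewrite /steps ltn_ord.
Qed.

Let e0 : 0 < eps. Proof. by case/andP: e01. Qed.
Let F_le i j : (i <= j)%N -> (j <= n)%N -> F i `<=` F j.
Proof.
move=> ij; rewrite -(subnKC ij); elim: (j - i)%N => [|k IH] kn; first by rewrite addn0.
rewrite addnS; apply: (subset_trans (IH _)); first by apply: ltnW; rewrite -addnS.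
by apply: (md_increasing md); rewrite -addnS.
Qed.
Let sFF i : sigma_algebra setT (FF i).
Proof. by apply: (md_sigma_algebra md); exact: geq_minr. Qed.
Let FFM i : FF i `<=` measurable.
Proof. by apply: subset_trans (md_sub md); apply: F_le => //; exact: geq_minr. Qed.
Let FF_mono i : FF i `<=` FF i.+1.
Proof. by apply: F_le; [rewrite leq_min geq_minr andbT (leq_trans (geq_minl _ _))|exact: geq_minr]. Qed.
Let FFE i : (i <= n)%N -> FF i = F i. Proof. by move=> h; rewrite /FF (minn_idPl h). Qed.

Let V0 i w := if (i < n)%N then condexp P (F i) (fun v => xi i.+1 v ^+ 2) w else 0.
Let V i w := Num.max 0 (Num.min (V0 i w) (12 * eps ^+ 2)).
Let v := stopped V (1 + delta ^+ 2).

Let xi_int i : (i <= n)%N -> integ (xi i).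
Proof.
move=> ilen; apply: (@integ_le _ _ _ _ _ (fun w => 1 + xi i w ^+ 2)).
- have h := md_adapted md ilen; apply: measurable_wrt_sub h.
  by apply: subset_trans (md_sub md); exact: F_le.
- by apply: integD; [exact: integ_cst|exact: (md_square_integrable md)].
- by move=> w; exact: norm_le_sqr.
Qed.

Let moment i k : (i < n)%N -> (3 <= k)%N ->
  integ (fun w => xi i.+1 w ^+ k) /\
  cge0 P (F i) (fun w => 2^-1 * k`!%:R * eps ^+ (k - 2) * V0 i w - xi i.+1 w ^+ k).
Proof.
move=> ilt k3; have [ik Ak] := @A1 i.+1 k ilt k3; split=> //.
have sFi := md_sigma_algebra md (ltnW ilt).
have FMi : F i `<=` measurable by rewrite -(FFE (ltnW ilt)).
have [mW iW W1 W2] := condexp_cge0 sFi FMi ik.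
have [mV iV _ _] := condexp_cge0 sFi FMi (md_square_integrable md ilt).
set c := 2^-1 * _ * _.
pose Wk := condexp P (F i) (fun w => xi i.+1 w ^+ k).
have h1 : cge0 P (F i) (fun w => c * V0 i w - Wk w).
  have iV0 : integ (V0 i) by rewrite /V0 ilt.
  have iD : integ (fun w => c * V0 i w - Wk w) by apply: integB => //; exact: integZ.
  apply: (cge0_ae_eq FMi _ iD (f := fun w => `|c * V0 i w - Wk w|)).
    by apply: cge0_ge0 => //; exact: integrable_norm iD.
  apply: filterS Ak => w; rewrite /= -/c => h; rewrite ger0_norm// subr_ge0 /V0 ilt.
  by apply: le_trans h; exact: ler_norm.
by have := cge0D FMi h1 W1; congr (cge0 _ _ _); apply/funext => w; rewrite addrA subrK.
Qed.

Let V0_facts i : (i < n)%N -> [/\ measurable_wrt (F i) (V0 i), integ (V0 i),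
  cge0 P (F i) (fun w => V0 i w - xi i.+1 w ^+ 2) &
  cge0 P (F i) (fun w => xi i.+1 w ^+ 2 - V0 i w)].
Proof.
move=> ilt; have FMi : F i `<=` measurable by rewrite -(FFE (ltnW ilt)).
have := condexp_cge0 (md_sigma_algebra md (ltnW ilt)) FMi (md_square_integrable md ilt).
by rewrite /V0 ilt.
Qed.

Let V0_bounds i : {ae P, forall w, V i w = V0 i w}.
Proof.
have e2 : 0 < 12 * eps ^+ 2 by rewrite mulr_gt0// exprn_gt0.
have [ilt|ige] := ltnP i n; last first.
  apply: aeW => w; rewrite /V /V0 ltnNge ige/= min_l ?(ltW e2)//.
  by rewrite max_l.
have FMi : F i `<=` measurable by rewrite -(FFE (ltnW ilt)).
have sFi := md_sigma_algebra md (ltnW ilt).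
have [mV iV V1 V2] := V0_facts ilt.
have [i4 m4] := moment ilt (isT : (3 <= 4)%N).
have ix2 := md_square_integrable md ilt.
have p0 : {ae P, forall w, 0 <= V0 i w}.
  apply: (cge0_ae sFi FMi) => //.
  have x2 : cge0 P (F i) (fun w => xi i.+1 w ^+ 2) by apply: cge0_ge0 => // w; exact: sqr_ge0.
  by have := cge0D FMi V1 x2; congr (cge0 _ _ _); apply/funext => w; rewrite subrK.
have p1 : {ae P, forall w, 0 <= 12 * eps ^+ 2 - V0 i w}.
  apply: (cge0_ae sFi FMi); last by apply: mwB => //; exact: mw_cst.
  set a := 12 * eps ^+ 2 in e2 *.
  (* The fourth moment bounds the variance: integrate [(xi^2 - a)^2 >= 0] at
     the value of [a] that gives [V0 <= a]. *)
  have sq : cge0 P (F i) (fun w => xi i.+1 w ^+ 4 + a ^+ 2 - 2 * a * xi i.+1 w ^+ 2).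
    apply: cge0_ge0.
      by apply: integB; [apply: integD => //; exact: integ_cst|exact: integZ].
    move=> w; have := sqr_ge0 (xi i.+1 w ^+ 2 - a).
    by rewrite (_ : (_ - a) ^+ 2 = xi i.+1 w ^+ 4 + a ^+ 2 - 2 * a * xi i.+1 w ^+ 2); last ring.
  have a2 : 0 <= 2 * a by lra.
  have := cge0Z sFi FMi (cge0D FMi (cge0D FMi sq (cge0Z sFi FMi V2 a2)) m4) (ltW (ltac:(by rewrite invr_gt0) : 0 < a^-1)).
  congr (cge0 _ _ _); apply/funext => w; rewrite /a (_ : 4`!%:R = 24 :> R)//.
  by field; rewrite gt_eqF.
move: p0; apply: filterS2 p1 => w h1 h2; rewrite /V min_l ?max_r//; lra.
Qed.

Let V_ge0 i w : 0 <= V i w. Proof. by rewrite /V le_max lexx. Qed.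
Let V_le i w : V i w <= 12 * eps ^+ 2.
Proof.
by rewrite /V ge_max mulr_ge0 ?sqr_ge0//= ge_min lexx orbT.
Qed.
Let B0 : 0 <= 1 + delta ^+ 2. Proof. by rewrite addr_ge0// sqr_ge0. Qed.

Let all_V : {ae P, forall w, forall i, V i w = V0 i w}.
Proof. by apply/ae_foralln => i; exact: V0_bounds. Qed.

Let total : {ae P, forall w, `|partial V n w - 1| <= delta ^+ 2}.
Proof.
move: A2; apply: filterS2 all_V => w VE; rewrite /quadratic_characteristic big_add1/= big_mkord.
by congr (`|_ - 1| <= _); apply: eq_bigr => i _; rewrite VE /V0 ltn_ord.
Qed.

Let v_eq i : (i < n)%N -> {ae P, forall w, V0 i w = v i w}.
Proof.
move=> ilt; move: total; apply: filterS2 all_V => w VE tot.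
rewrite /v (@stopped_eq _ _ _ _ V_ge0 i n)//.
by move: tot; rewrite ler_norml => /andP[_]; lra.
Qed.

Let mV i : measurable_wrt (FF i) (V i).
Proof.
apply: mw_max; first exact: mw_cst; apply: mw_min; last exact: mw_cst.
have [ilt|ige] := ltnP i n.
  by rewrite FFE ?(ltnW ilt)//; case: (V0_facts ilt).
by rewrite /V0 ltnNge ige; exact: mw_cst.
Qed.

Let mw_le i j (f : T -> R) : (i <= j)%N -> measurable_wrt (FF i) f -> measurable_wrt (FF j) f.
Proof. exact: measurable_wrt_le. Qed.

Let mv i : measurable_wrt (FF i) (v i).
Proof.
apply: mwB; apply: mw_min; try exact: mw_cst; apply: mw_sum => j.
  by apply: (@mw_le j i); [rewrite -ltnS|exact: mV].
by apply: (@mw_le j i); [exact: ltnW|exact: mV].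
Qed.

Let v_bounds i w : 0 <= v i w <= 12 * eps ^+ 2.
Proof.
have /andP[-> h] := stopped_bounds (1 + delta ^+ 2) V_ge0 i w.
by rewrite (le_trans h).
Qed.

Let iv i : integ (v i).
Proof.
apply: (@integ_bounded _ _ _ _ _ (12 * eps ^+ 2)); first by apply: measurable_wrt_sub (@mv i).
by move=> w; have /andP[h1 h2] := v_bounds i w; rewrite ger0_norm.
Qed.

Let v_stop i w : (n <= i)%N -> v i w = 0.
Proof.
move=> ni; have /andP[h1 h2] := stopped_bounds (1 + delta ^+ 2) V_ge0 i w.
have e2 : 0 <= 12 * eps ^+ 2 by rewrite mulr_ge0// sqr_ge0.
apply/eqP; rewrite eq_le h1 andbT; apply: (le_trans h2).
by rewrite /V /V0 ltnNge ni/= min_l// max_l.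
Qed.

Let cge0_0 i : cge0 P (FF i) (fun=> 0).
Proof. by apply: cge0_ge0 => //; exact: integ_cst. Qed.

(** The conditional variances are modified on a null set so that their bounds
    hold everywhere: they are clamped at [12 * eps^2], and their sum is
    stopped at [1 + delta^2], which keeps them predictable. *)
Theorem bernstein_of_moments : exists v : nat -> T -> R,
  bernstein_martingale P FF steps v n eps (1 + delta ^+ 2) /\
  {ae P, forall w, 1 - delta ^+ 2 <= partial v n w}.
Proof.
exists v; split; last first.
  move: total; apply: filterS => w; rewrite ler_norml => /andP[h1 h2].
  by rewrite /v partial_stopped// min_l; lra.
have null i : (i < n)%N -> cge0 P (F i) (xi i.+1) /\ cge0 P (F i) (fun w => - xi i.+1 w).
  move=> ilt; have FMi : F i `<=` measurable by rewrite -(FFE (ltnW ilt)).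
  have ix := xi_int ilt.
  have [_ _ h1 h2] := condexp_cge0 (md_sigma_algebra md (ltnW ilt)) FMi ix.
  have z := md_condexp0 md (i := i.+1) ilt.
  split.
    by apply: (cge0_ae_eq FMi h2) => //; apply: filterS z => w /= ->; rewrite subr0.
  apply: (cge0_ae_eq FMi h1); first exact: integN.
  by apply: filterS z => w /= ->; rewrite sub0r.
split=> //.
- move=> i; rewrite /steps; have [ilt|ige] := ltnP i n; last exact: mw_cst.
  by rewrite FFE//; exact: (md_adapted md).
- by move=> k w; rewrite /v partial_stopped// ge_min lexx orbT.
- move=> i; rewrite /steps; have [ilt|ige] := ltnP i n; last exact: cge0_0.
  by rewrite FFE ?(ltnW ilt)//; case: (null i ilt).
- move=> i; rewrite /steps; have [ilt|ige] := ltnP i n; last by rewrite oppr0; exact: cge0_0.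
  by rewrite FFE ?(ltnW ilt)//; case: (null i ilt).
- move=> i; rewrite /steps; have [ilt|ige] := ltnP i n; last first.
    by rewrite (_ : (fun w => _) = fun=> 0) //; apply/funext => w; rewrite v_stop// expr0n subrr.
  have [_ _ h _] := V0_facts ilt; have FMi := @FFM i; rewrite FFE ?(ltnW ilt)// in FMi *.
  apply: (cge0_ae_eq FMi h).
    by apply: integB => //; exact: (md_square_integrable md).
  by apply: filterS (v_eq ilt) => w /= ->.
- move=> i; rewrite /steps; have [ilt|ige] := ltnP i n; last first.
    by rewrite (_ : (fun w => _) = fun=> 0) //; apply/funext => w; rewrite v_stop// expr0n subrr.
  have [_ _ _ h] := V0_facts ilt; have FMi := @FFM i; rewrite FFE ?(ltnW ilt)// in FMi *.
  apply: (cge0_ae_eq FMi h).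
    by apply: integB => //; exact: (md_square_integrable md).
  by apply: filterS (v_eq ilt) => w /= ->.
- move=> i; rewrite /steps; have [ilt|ige] := ltnP i n; last first.
    rewrite (_ : (fun w => _) = fun=> 0) //; apply/funext => w.
    by rewrite v_stop// /cosh1 !mul0r oppr0 expR0; field.
  have sFi := @sFF i; have FMi := @FFM i; rewrite FFE ?(ltnW ilt)// in sFi FMi *.
  have mxi : measurable_fun setT (xi i.+1).
    apply: (measurable_wrt_sub (@FFM i.+1)); rewrite FFE//; exact: (md_adapted md).
  apply: cge0_cosh_of_moments => //; first by move=> w; case/andP: (v_bounds i w).
  move=> j; have iD k : integ (fun w => xi i.+1 w ^+ k) -> integ (fun w => 2^-1 * k`!%:R * eps ^+ (k - 2) * v i w - xi i.+1 w ^+ k).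
    by move=> ik; apply: integB => //; exact: integZ.
  have -> : (2 * j = 2 * j.+1 - 2)%N by rewrite mulnS addKn.
  case: j => [|j]; last first.
    have [ik mk] := @moment i (2 * j.+2) ilt (ltac:(by rewrite !mulnS)).
    apply: (cge0_ae_eq FMi mk); first exact: iD.
    by apply: filterS (v_eq ilt) => w /= ->.
  have [_ _ h _] := V0_facts ilt.
  have i2 := md_square_integrable md ilt.
  apply: (cge0_ae_eq FMi h); first exact: iD.
  by apply: filterS (v_eq ilt) => w /= ->; rewrite expr0 mulr1 mulVf// mul1r.
- move=> i w ni; split; last exact: v_stop.
  by rewrite /steps ltnNge ni.
Qed.

End reduction.

(** * Conclusion *)

(** A vanishing [delta] has an infinite inverse and imposes nothing. *)
Lemma range_bounds (R : realType) (alpha0 eps delta x : R) :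
  0 < alpha0 -> 0 < eps <= 2^-1 -> 0 <= delta ->
  (x%:E <= alpha0%:E * Order.min ((eps * `|ln eps|)^-1)%:E (delta%:E^-1))%E ->
  x * (eps * `|ln eps|) <= alpha0 /\ x * delta <= alpha0.
Proof.
move=> a0 e01 d0 hx; have /andP[e0 _] := e01.
have L0 : 0 < eps * `|ln eps|.
  by rewrite mulr_gt0//; have := abs_ln_ge_half e01; lra.
have xle (y : \bar R) : (Order.min ((eps * `|ln eps|)^-1)%:E (delta%:E^-1) <= y)%E -> (x%:E <= alpha0%:E * y)%E.
  by move=> my; apply: (le_trans hx); rewrite lee_pmul2l// lte_fin.
split.
  have := xle ((eps * `|ln eps|)^-1)%:E; rewrite ge_min lexx => /(_ isT).
  by rewrite -EFinM lee_fin ler_pdivlMr.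
have := xle (delta%:E^-1)%E; rewrite ge_min lexx orbT => /(_ isT).
have [->|dn0] := eqVneq delta 0; first by rewrite mulr0 (ltW a0).
by rewrite inver (negbTE dn0) -EFinM lee_fin ler_pdivlMr// lt_neqAle eq_sym dn0.
Qed.

Theorem corollary2p1 (R : realType) :
  exists2 alpha0 : R, 0 < alpha0 &
  exists2 c : R, 0 < c &
  forall (d : measure_display) (T : measurableType d) (P : probability T R)
    (n : nat) (F : nat -> set (set T)) (xi : nat -> T -> R) (eps delta : R),
    (1 <= n)%N ->
    martingale_differences P n F xi ->
    0 < eps <= 2^-1 ->
    0 <= delta <= 2^-1 ->
    condition_A1 P n F xi eps ->
    condition_A2 P n F xi delta ->
    forall x : R, 0 <= x ->
      (x%:E <= alpha0%:E *
         Order.min ((eps * `|ln eps|)^-1)%:E (delta%:E^-1))%E ->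
      exists theta1 theta2 theta3 theta4 : R,
        [/\ [/\ `|theta1| <= 1, `|theta2| <= 1, `|theta3| <= 1
              & `|theta4| <= 1],
            fine (P [set w | x < partial_sum n xi w]) / (1 - std_normal_cdf x) =
              expR (theta1 * c * x ^+ 3 * eps) *
              (1 + theta2 * c * (1 + x) * (eps * `|ln eps| + delta))
          & fine (P [set w | partial_sum n xi w < - x]) / std_normal_cdf (- x) =
              expR (theta3 * c * x ^+ 3 * eps) *
              (1 + theta4 * c * (1 + x) * (eps * `|ln eps| + delta))].
Proof.
have [alpha0 a0 [c c0 main]] := bernstein_tail_ratio R.
exists alpha0 => //; exists c => // d T P n F xi eps delta n1 md e01 d01 A1 A2 x x0 hx.
have /andP[e0 _] := e01; have /andP[d0 _] := d01.
have [xe xd] := range_bounds a0 e01 d0 hx.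
have [v [bm low]] := bernstein_of_moments md e01 A1 A2.
have D0 : 0 <= eps * `|ln eps| + delta by rewrite addr_ge0// mulr_ge0// ltW.
have a_ge0 : 0 <= c * (x ^+ 3 * eps).
  by apply: mulr_ge0; [exact: ltW|apply: mulr_ge0; [exact: exprn_ge0|exact: ltW]].
have b_ge0 : 0 <= c * ((1 + x) * (eps * `|ln eps| + delta)).
  by apply: mulr_ge0; [exact: ltW|apply: mulr_ge0 => //; exact: addr_ge0].
have G0 : 0 < 1 - std_normal_cdf x := Phi_lt1 x.
have thetas (p : R) : 0 <= p ->
    expR (- (c * (x ^+ 3 * eps))) * (1 - c * ((1 + x) * (eps * `|ln eps| + delta))) <=
      p / (1 - std_normal_cdf x) <=
    expR (c * (x ^+ 3 * eps)) * (1 + c * ((1 + x) * (eps * `|ln eps| + delta))) ->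
    exists t1 t2 : R, [/\ `|t1| <= 1, `|t2| <= 1 &
      p / (1 - std_normal_cdf x) = expR (t1 * c * x ^+ 3 * eps) *
        (1 + t2 * c * (1 + x) * (eps * `|ln eps| + delta))].
  move=> p0 /(ratio_thetas a_ge0 b_ge0 (divr_ge0 p0 (ltW G0)))[t1 [t2 [h1 h2 ->]]].
  by exists t1, t2; split=> //; rewrite -!mulrA.
have pos (A : set T) : 0 <= fine (P A) by rewrite fine_ge0.
have [t1 [t2 [h1 h2 E1]]] := thetas _ (pos _) (main _ _ _ _ _ _ _ _ _ e01 d01 bm low x x0 xe xd).
have [t3 [t4 [h3 h4 E2]]] := thetas _ (pos _)
  (main _ _ _ _ _ _ _ _ _ e01 d01 (bernstein_martingaleN bm) low x x0 xe xd).
exists t1, t2, t3, t4; split=> //; first by rewrite -E1 partial_steps.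
rewrite -E2 PhiN; congr (fine (P _) / _); apply/seteqP; split => w /=.
  by rewrite -partial_steps ltrNr /partial sumrN.
by rewrite -partial_steps ltrNr /partial sumrN.
Qed.
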